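(* (1) Every uplifting cardinal $\kappa$ has an ordinal-anticipating uplifting Laver function $\ell:\kappa\to\kappa$ definable in $H_\kappa$. (2) Every uplifting cardinal $\kappa$ has a ${\rm HOD}$-anticipating uplifting Laver function $\ell:\kappa\to H_\kappa$ definable in $H_\kappa$. (3) If $V={\rm HOD}$, then every uplifting cardinal $\kappa$ has an uplifting Laver function $\ell:\kappa\to H_\kappa$ definable in $H_\kappa$.
   Context: An inaccessible cardinal $\kappa$ is uplifting if for every ordinal $\theta$ there is an inaccessible $\gamma\ge\theta$ with $V_\kappa\prec V_\gamma$ a proper elementary extension. For uplifting $\kappa$, a (partial) function $\ell:\kappa\to H_\kappa$ is an uplifting Laver function for $\kappa$ if for every set $x$ there are unboundedly many inaccessible cardinals $\gamma$ with a function $\ell^*:\gamma\to H_\gamma$ such that $\langle H_\kappa,\in,\ell\rangle\prec\langle H_\gamma,\in,\ell^*\rangle$ and $\ell^*(\kappa)=x$. It is ordinal-anticipating (with $\ell:\kappa\to\kappa$, $\ell^*:\gamma\to\gamma$) if this is required only for ordinals $x$, and ${\rm HOD}$-anticipating if required only for $x\in{\rm HOD}$. *)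

(* Defs.v *)
(* Only the Rocq prelude is used: set theory is developed over an arbitrary
   first-order model (V, mem) of ZFC.  All notions below are first-order over
   (V, mem), relational (is_foo y x reads "y = foo(x)"), and internal to the
   model: in particular omega, formulas, assignments and the satisfaction
   relation of a set structure are elements of V, so that nothing is assumed
   about well-foundedness of mem or standardness of omega. *)

Set Implicit Arguments.
Unset Strict Implicit.

(* Metatheoretic formulas, used only for the two axiom schemes.  Variables are
   de Bruijn indices: the quantifier binds variable 0. *)
Inductive form : Type :=
| FMem (i j : nat)
| FEq (i j : nat)
| FNeg (p : form)
| FAnd (p q : form)
| FEx (p : form).

Definition scons {V : Type} (x : V) (e : nat -> V) : nat -> V :=
  fun n => match n with O => x | S m => e m end.

Section SetTheory.

Context {V : Type} (mem : V -> V -> Prop).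

Local Notation "x ∈ y" := (mem x y) (at level 70, no associativity).

Fixpoint fsat (e : nat -> V) (p : form) : Prop :=
  match p with
  | FMem i j => e i ∈ e j
  | FEq i j => e i = e j
  | FNeg q => ~ fsat e q
  | FAnd q r => fsat e q /\ fsat e r
  | FEx q => exists x, fsat (scons x e) q
  end.

Definition sub (x y : V) : Prop := forall z, z ∈ x -> z ∈ y.
Definition is_empty (x : V) : Prop := forall z, ~ z ∈ x.
Definition is_upair (p x y : V) : Prop := forall z, z ∈ p <-> z = x \/ z = y.
Definition is_pow (p x : V) : Prop := forall z, z ∈ p <-> sub z x.
Definition is_succ (y x : V) : Prop := forall z, z ∈ y <-> z ∈ x \/ z = x.

Record ZFC : Prop := {
  zfc_ext : forall x y, (forall z, z ∈ x <-> z ∈ y) -> x = y;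
  zfc_found : forall x, (exists y, y ∈ x) ->
    exists y, y ∈ x /\ forall z, z ∈ x -> ~ z ∈ y;
  zfc_pair : forall x y, exists p, is_upair p x y;
  zfc_union : forall x, exists u, forall z, z ∈ u <-> exists y, y ∈ x /\ z ∈ y;
  zfc_pow : forall x, exists p, is_pow p x;
  zfc_inf : exists w, (exists z, is_empty z /\ z ∈ w) /\
    forall x, x ∈ w -> exists y, is_succ y x /\ y ∈ w;
  zfc_sep : forall (p : form) (e : nat -> V) (a : V),
    exists b, forall x, x ∈ b <-> x ∈ a /\ fsat (scons x e) p;
  zfc_repl : forall (p : form) (e : nat -> V) (a : V),
    (forall x y y', x ∈ a -> fsat (scons x (scons y e)) p ->
       fsat (scons x (scons y' e)) p -> y = y') ->
    exists b, forall y, y ∈ b <->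
      exists x, x ∈ a /\ fsat (scons x (scons y e)) p;
  zfc_choice : forall a,
    (forall x, x ∈ a -> exists z, z ∈ x) ->
    (forall x y z, x ∈ a -> y ∈ a -> z ∈ x -> z ∈ y -> x = y) ->
    exists c, forall x, x ∈ a ->
      exists z, (z ∈ c /\ z ∈ x) /\ forall z', z' ∈ c /\ z' ∈ x -> z' = z
}.

(* Kuratowski pairs; gr r x y reads "⟨x, y⟩ ∈ r". *)
Definition is_pair (p x y : V) : Prop :=
  exists a b, is_upair a x x /\ is_upair b x y /\ is_upair p a b.
Definition gr (r x y : V) : Prop := exists p, is_pair p x y /\ p ∈ r.

(* Partial, total, and total injective functions from a to b. *)
Definition is_pfun (f a b : V) : Prop :=
  (forall p, p ∈ f -> exists x y, x ∈ a /\ y ∈ b /\ is_pair p x y) /\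
  (forall x y y', gr f x y -> gr f x y' -> y = y').
Definition is_fun (f a b : V) : Prop :=
  is_pfun f a b /\ forall x, x ∈ a -> exists y, gr f x y.
Definition is_inj (f a b : V) : Prop :=
  is_fun f a b /\ forall x x' y, gr f x y -> gr f x' y -> x = x'.
Definition injects (a b : V) : Prop := exists f, is_inj f a b.

Definition transitive (x : V) : Prop := forall y, y ∈ x -> sub y x.
Definition is_tc (t x : V) : Prop :=
  transitive t /\ sub x t /\ forall u, transitive u -> sub x u -> sub t u.

Definition ord (x : V) : Prop :=
  transitive x /\ forall y, y ∈ x -> transitive y.
Definition ole (a b : V) : Prop := a ∈ b \/ a = b.
Definition limit (x : V) : Prop :=
  ord x /\ ~ is_empty x /\ forall y, y ∈ x -> exists z, z ∈ x /\ y ∈ z.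
Definition is_omega (w : V) : Prop :=
  limit w /\ forall n, n ∈ w -> ~ limit n.
Definition is_nat (n : V) : Prop := exists w, is_omega w /\ n ∈ w.

(* card_lt a k reads "|a| < k", for k a cardinal. *)
Definition card_lt (a k : V) : Prop := exists b, b ∈ k /\ injects a b.
Definition cardinal (k : V) : Prop := ord k /\ ~ card_lt k k.
Definition regular (k : V) : Prop :=
  limit k /\ forall a f, a ∈ k -> is_fun f a k ->
    exists b, b ∈ k /\ forall x y, gr f x y -> y ∈ b.
Definition strong_limit (k : V) : Prop :=
  forall a p, a ∈ k -> is_pow p a -> card_lt p k.
Definition inaccessible (k : V) : Prop :=
  cardinal k /\ (exists w, is_omega w /\ w ∈ k) /\ regular k /\ strong_limit k.

Definition is_H (h k : V) : Prop :=
  forall x, x ∈ h <-> exists t, is_tc t x /\ card_lt t k.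

(* v = V_a: v is the value at a of the function f on a + 1 determined by
   f(b) = union of the power sets of the f(c), c < b. *)
Definition is_Vlevel (v a : V) : Prop :=
  ord a /\ exists f,
    (forall b, ole b a <-> exists u, gr f b u) /\
    (forall b u u', gr f b u -> gr f b u' -> u = u') /\
    (forall b u, gr f b u -> forall x,
       x ∈ u <-> exists c w, c ∈ b /\ gr f c w /\ sub x w) /\
    gr f a v.

(* Coded first-order syntax.  A structure ⟨M, ∈⟩ is given by M and F = None,
   a structure ⟨M, ∈, l⟩, with l a partial function, by M and F = Some l; in
   the second case the language has the further atomic formulas l(x_i) = x_j.
   The code of a formula is the tuple
     x_i ∈ x_j : ⟨0,⟨i,j⟩⟩    x_i = x_j : ⟨1,⟨i,j⟩⟩    l(x_i) = x_j : ⟨2,⟨i,j⟩⟩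
     ¬ f : ⟨3,f⟩              f ∧ g : ⟨4,⟨f,g⟩⟩        ∃ f : ⟨5,f⟩
   where variables are de Bruijn indices (elements of omega). *)
Fixpoint is_num (k : nat) (x : V) : Prop :=
  match k with
  | O => is_empty x
  | S m => exists y, is_num m y /\ is_succ x y
  end.

Definition code1 (k : nat) (p x : V) : Prop :=
  exists t, is_num k t /\ is_pair p t x.
Definition code2 (k : nat) (p x y : V) : Prop :=
  exists q, is_pair q x y /\ code1 k p q.

Definition is_cMem : V -> V -> V -> Prop := code2 0.
Definition is_cEq : V -> V -> V -> Prop := code2 1.
Definition is_cFun : V -> V -> V -> Prop := code2 2.
Definition is_cNeg : V -> V -> Prop := code1 3.
Definition is_cAnd : V -> V -> V -> Prop := code2 4.
Definition is_cEx : V -> V -> Prop := code1 5.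

Definition fml_closed (F : option V) (X : V) : Prop :=
  (forall p i j, is_nat i -> is_nat j -> is_cMem p i j -> p ∈ X) /\
  (forall p i j, is_nat i -> is_nat j -> is_cEq p i j -> p ∈ X) /\
  match F with
  | None => True
  | Some _ =>
      forall p i j, is_nat i -> is_nat j -> is_cFun p i j -> p ∈ X
  end /\
  (forall p f, f ∈ X -> is_cNeg p f -> p ∈ X) /\
  (forall p f g, f ∈ X -> g ∈ X -> is_cAnd p f g -> p ∈ X) /\
  (forall p f, f ∈ X -> is_cEx p f -> p ∈ X).

Definition is_fml (F : option V) (p : V) : Prop :=
  forall X, fml_closed F X -> p ∈ X.

Definition assign (M s : V) : Prop := exists w, is_omega w /\ is_fun s w M.

(* t(0) = a and t(i+1) = s(i). *)
Definition is_scons (t a s : V) : Prop :=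
  (forall z, is_empty z -> gr t z a) /\
  (forall i j b, is_succ j i -> gr s i b -> gr t j b).

(* The set S of pairs ⟨p, s⟩ obeys Tarski's clauses for the structure. *)
Definition is_truth (M : V) (F : option V) (S : V) : Prop :=
  forall p s, is_fml F p -> assign M s ->
  (forall i j, is_cMem p i j ->
     (gr S p s <-> exists a b, gr s i a /\ gr s j b /\ a ∈ b)) /\
  (forall i j, is_cEq p i j ->
     (gr S p s <-> exists a, gr s i a /\ gr s j a)) /\
  match F with
  | None => True
  | Some l =>
      forall i j, is_cFun p i j ->
        (gr S p s <-> exists a b, gr s i a /\ gr s j b /\ gr l a b)
  end /\
  (forall f, is_cNeg p f -> (gr S p s <-> ~ gr S f s)) /\
  (forall f g, is_cAnd p f g -> (gr S p s <-> gr S f s /\ gr S g s)) /\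
  (forall f, is_cEx p f ->
     (gr S p s <->
      exists a t, a ∈ M /\ assign M t /\ is_scons t a s /\ gr S f t)).

Definition sat (M : V) (F : option V) (p s : V) : Prop :=
  exists S, is_truth M F S /\ gr S p s.

Definition elem_sub (M : V) (F : option V) (N : V) (G : option V) : Prop :=
  sub M N /\
  forall p s, is_fml F p -> assign M s -> (sat M F p s <-> sat N G p s).

Definition uplifting (k : V) : Prop :=
  inaccessible k /\
  forall th, ord th ->
    exists g vk vg, inaccessible g /\ ole th g /\
      is_Vlevel vk k /\ is_Vlevel vg g /\
      elem_sub vk None vg None /\ vk <> vg.

(* x is the unique element u of some V_a with V_a ⊨ p[u, s(0), s(1), ...],
   where the parameters s(i) are ordinals below a, all but finitely many of
   them 0. *)
Definition OD (x : V) : Prop :=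
  exists a v p s, is_Vlevel v a /\ x ∈ v /\ is_fml None p /\
    (exists w, is_omega w /\ is_fun s w a) /\
    (exists n, is_nat n /\ forall i b, gr s i b -> ~ i ∈ n -> is_empty b) /\
    forall u t, u ∈ v -> assign v t -> is_scons t u s ->
      (sat v None p t <-> u = x).

Definition HOD (x : V) : Prop :=
  exists u t, is_upair u x x /\ is_tc t u /\ forall y, y ∈ t -> OD y.

(* Common form of the Laver function notions: P is the class of sets to be
   anticipated, and cod c k says that c is the codomain (k or H_k) required of
   functions on k. *)
Definition laver_for (P : V -> Prop) (cod : V -> V -> Prop) (k l : V) : Prop :=
  exists hk c, is_H hk k /\ cod c k /\ is_pfun l k c /\
  forall x, P x -> forall th, ord th ->
    exists g hg d l', inaccessible g /\ ole th g /\
      is_H hg g /\ cod d g /\ is_pfun l' g d /\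
      elem_sub hk (Some l) hg (Some l') /\ gr l' k x.

Definition uplifting_laver : V -> V -> Prop :=
  laver_for (fun _ => True) is_H.
Definition ord_anticipating_laver : V -> V -> Prop :=
  laver_for ord (fun c k => c = k).
Definition HOD_anticipating_laver : V -> V -> Prop :=
  laver_for HOD is_H.

(* Definability of the graph of l without parameters: p defines it through the
   variables 0 and 1, whatever the values of the other variables. *)
Definition definable_in (M l : V) : Prop :=
  exists p, is_fml None p /\
    forall s, assign M s ->
      (sat M None p s <->
       exists i j a b, is_num 0 i /\ is_num 1 j /\
         gr s i a /\ gr s j b /\ gr l a b).

End SetTheory.

(* Main.v *)
From Stdlib Require Import PeanoNat Classical ClassicalEpsilon.
Require Import Defs.

(* Call an inaccessible g > d with V_d ≺ V_g an uplift of d, and call it isolated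
   if the uplifts of d below g are bounded in g; the least uplift of d above a
   given ordinal is isolated, so that an uplifting d has a proper class of
   isolated uplifts.  Fix a definable set-like well-order of codes, a code being
   obtained by pairing from ordinals and finitely supported sequences of
   ordinals.  Assign greedily to each isolated uplift g of d the least code in
   V_g not assigned earlier.  Every code of an ordinal definable set x contains
   a dummy ordinal, so x has a proper class of codes; each code is assigned
   eventually, because the assignment is injective and defined on a proper
   class; hence codes of x are assigned at unboundedly many g.  All the notions
   involved are absolute between V_g and V, and the assignment below g is a
   member of V_g because g is isolated, so V_g can compute from d the code
   assigned to g, as the first one not assigned below g.  Let l(d), as computed
   in V_k, be the set coded by that first unassigned code.  This l is definable
   in V_k = H_k, and the same definition in V_g yields l', so V_k ≺ V_g entails
   (V_k, l) ≺ (V_g, l'), while l'(k) = x when g is assigned a code of x. *)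

Set Implicit Arguments.
Unset Strict Implicit.

(** * Definability *)

Record structure : Type := Structure { dom : Type; rel : dom -> dom -> Prop }.
Arguments rel : clear implicits.

Fixpoint rename (f : nat -> nat) (p : form) : form :=
  match p with
  | FMem i j => FMem (f i) (f j)
  | FEq i j => FEq (f i) (f j)
  | FNeg q => FNeg (rename f q)
  | FAnd q r => FAnd (rename f q) (rename f r)
  | FEx q => FEx (rename (fun n => match n with O => O | S k => S (f k) end) q)
  end.

Lemma fsat_ext (W : Type) (m : W -> W -> Prop) (p : form) : forall e e',
  (forall n, e n = e' n) -> (fsat m e p <-> fsat m e' p).
Proof.
  induction p as [i j|i j|p IH|p IHp q IHq|p IH]; intros e e' E; simpl.
  - rewrite !E; tauto.
  - rewrite !E; tauto.
  - rewrite (IH e e' E); tauto.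
  - rewrite (IHp e e' E), (IHq e e' E); tauto.
  - split; intros [x Hx]; exists x; revert Hx; apply IH; intros [|n]; simpl; auto.
Qed.

Lemma fsat_rename (W : Type) (m : W -> W -> Prop) (p : form) : forall f e,
  fsat m e (rename f p) <-> fsat m (fun n => e (f n)) p.
Proof.
  induction p as [i j|i j|p IH|p IHp q IHq|p IH]; intros f e; simpl.
  - tauto.
  - tauto.
  - rewrite IH; tauto.
  - rewrite IHp, IHq; tauto.
  - split; intros [x Hx]; exists x; revert Hx; rewrite IH; apply fsat_ext;
      intros [|n]; reflexivity.
Qed.

(* A single formula defines P in all structures of the family; every variable
   of the formula is either a free variable or a parameter.  Over the family of
   all structures this is parameter-free definability, uniform in the structure,
   which is what lets V_k and V_g share definitions; over a single structure it
   is definability with parameters. *)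
Section Definability.

Context {I : Type} {M : I -> structure}.

Definition interp (r : nat -> nat + (forall i, dom (M i))) (i : I)
    (e : nat -> dom (M i)) (n : nat) : dom (M i) :=
  match r n with inl k => e k | inr c => c i end.
Definition definable (P : forall i, (nat -> dom (M i)) -> Prop) : Prop :=
  exists p r, forall i e, fsat (rel (M i)) (interp r e) p <-> P i e.
Definition definable_term (t : forall i, (nat -> dom (M i)) -> dom (M i)) : Prop :=
  definable (fun i e => e 0 = t i (fun n => e (S n))).

Lemma definable_iff (P Q : forall i, (nat -> dom (M i)) -> Prop) :
  (forall i e, P i e <-> Q i e) -> definable P -> definable Q.
Proof. intros E (p & r & Hp); exists p, r; intros; rewrite Hp; apply E. Qed.

Lemma definable_rename (f : nat -> nat) (P : forall i, (nat -> dom (M i)) -> Prop) :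
  definable P -> definable (fun i e => P i (fun n => e (f n))).
Proof.
  intros (p & r & Hp).
  exists p, (fun n => match r n with inl k => inl (f k) | inr c => inr c end).
  intros i e; rewrite <- Hp; apply fsat_ext; intros n; unfold interp.
  destruct (r n); reflexivity.
Qed.

Lemma definable_not P : definable P -> definable (fun i e => ~ P i e).
Proof. intros (p & r & Hp); exists (FNeg p), r; intros; simpl; rewrite Hp; tauto. Qed.

Lemma definable_and P Q :
  definable P -> definable Q -> definable (fun i e => P i e /\ Q i e).
Proof.
  intros (p & r & Hp) (q & s & Hq).
  exists (FAnd (rename (fun n => 2 * n) p) (rename (fun n => S (2 * n)) q)),
    (fun n => if Nat.even n then r (Nat.div2 n) else s (Nat.div2 n)).
  intros i e; cbn [fsat]; rewrite !fsat_rename, <- Hp, <- Hq.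
  rewrite (fsat_ext (rel (M i)) p (e' := interp r e)),
    (fsat_ext (rel (M i)) q (e' := interp s e)); [tauto| |];
    intros n; unfold interp.
  - rewrite Nat.even_succ, Nat.odd_mul, Nat.div2_succ_double; reflexivity.
  - rewrite Nat.even_mul, Nat.div2_double; reflexivity.
Qed.

Lemma definable_ex (P : forall i, dom (M i) -> (nat -> dom (M i)) -> Prop) :
  definable (fun i e => P i (e 0) (fun n => e (S n))) ->
  definable (fun i e => exists x, P i x e).
Proof.
  intros (p & r & Hp).
  set (f := fun n => match r n with inl O => O | _ => S n end).
  exists (FEx (rename f p)),
    (fun n => match r n with inl (S k) => inl k | v => v end).
  intros i e; cbn [fsat].
  split; intros [x Hx]; exists x; [apply (Hp i (scons x e))|apply (Hp i (scons x e)) in Hx];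
    revert Hx; rewrite fsat_rename; apply fsat_ext; intros n; unfold f, interp;
    destruct (r n) as [[|k]|c] eqn:E; simpl; rewrite ?E; reflexivity.
Qed.

Lemma definable_or P Q :
  definable P -> definable Q -> definable (fun i e => P i e \/ Q i e).
Proof.
  intros HP HQ; apply (@definable_iff (fun i e => ~ (~ P i e /\ ~ Q i e))).
  - intros; split; [intros H; apply NNPP|]; tauto.
  - auto using definable_not, definable_and.
Qed.

Lemma definable_imp P Q :
  definable P -> definable Q -> definable (fun i e => P i e -> Q i e).
Proof.
  intros HP HQ; apply (@definable_iff (fun i e => ~ (P i e /\ ~ Q i e))).
  - intros; split; [intros H Hp; apply NNPP|]; tauto.
  - auto using definable_not, definable_and.
Qed.

Lemma definable_bi P Q :
  definable P -> definable Q -> definable (fun i e => P i e <-> Q i e).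
Proof. intros; apply definable_and; apply definable_imp; assumption. Qed.

Lemma definable_all (P : forall i, dom (M i) -> (nat -> dom (M i)) -> Prop) :
  definable (fun i e => P i (e 0) (fun n => e (S n))) ->
  definable (fun i e => forall x, P i x e).
Proof.
  intros HP; apply (@definable_iff (fun i e => ~ exists x, ~ P i x e)).
  - intros; split; [|intros H [x Hx]; auto].
    intros H x; apply NNPP; eauto.
  - apply definable_not, (@definable_ex (fun i x e => ~ P i x e)), definable_not, HP.
Qed.

Lemma definable_const (A : Prop) : definable (fun _ _ => A).
Proof.
  assert (HT : definable (fun i e => e 0 = e 0)).
  { exists (FEq 0 0), inl; intros; simpl; reflexivity. }
  destruct (classic A); [revert HT|apply definable_not in HT; revert HT];
    apply definable_iff; tauto.
Qed.

Lemma definable_term_rename (f : nat -> nat) (t : forall i, (nat -> dom (M i)) -> dom (M i)) :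
  definable_term t -> definable_term (fun i e => t i (fun n => e (f n))).
Proof. apply (definable_rename (fun n => match n with O => O | S k => S (f k) end)). Qed.

Lemma definable_term_var n : definable_term (fun i e => e n).
Proof. exists (FEq 0 (S n)), inl; intros; simpl; tauto. Qed.

Lemma definable_term_const (c : forall i, dom (M i)) : definable_term (fun i _ => c i).
Proof.
  exists (FEq 0 1), (fun n => match n with O => inl O | _ => inr c end).
  intros; simpl; tauto.
Qed.

Lemma definable_subst (P : forall i, dom (M i) -> (nat -> dom (M i)) -> Prop) t :
  definable (fun i e => P i (e 0) (fun n => e (S n))) -> definable_term t ->
  definable (fun i e => P i (t i e) e).
Proof.
  intros HP Ht; apply (@definable_iff (fun i e => exists x, x = t i e /\ P i x e)).
  - intros i e; split; [intros (x & -> & Hx); exact Hx|eauto].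
  - apply (@definable_ex (fun i x e => x = t i e /\ P i x e)), definable_and;
      [exact Ht|exact HP].
Qed.

Lemma definable_subst2 (R : forall i, dom (M i) -> dom (M i) -> (nat -> dom (M i)) -> Prop) t u :
  definable (fun i e => R i (e 0) (e 1) (fun n => e (S (S n)))) ->
  definable_term t -> definable_term u -> definable (fun i e => R i (t i e) (u i e) e).
Proof.
  intros HR Ht Hu; apply (@definable_subst (fun i y e => R i (t i e) y e)); [|exact Hu].
  apply (@definable_subst (fun i x e => R i x (e 0) (fun n => e (S n)))); [exact HR|].
  apply (definable_term_rename S), Ht.
Qed.

Lemma definable_rel t u : definable_term t -> definable_term u ->
  definable (fun i e => rel (M i) (t i e) (u i e)).
Proof.
  apply (@definable_subst2 (fun i x y _ => rel (M i) x y)).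
  exists (FMem 0 1), inl; intros; simpl; reflexivity.
Qed.

Lemma definable_eq t u : definable_term t -> definable_term u ->
  definable (fun i e => t i e = u i e).
Proof.
  apply (@definable_subst2 (fun i x y _ => x = y)).
  exists (FEq 0 1), inl; intros; simpl; reflexivity.
Qed.

End Definability.

(* The empty structure shows that the formula cannot mention parameters. *)
Lemma uniform_formula (P : forall s : structure, (nat -> dom s) -> Prop) :
  definable (M := fun s => s) P -> exists p, forall s e, fsat (rel s) e p <-> P s e.
Proof.
  intros (p & r & Hp).
  exists (rename (fun n => match r n with inl k => k | inr _ => O end) p).
  intros s e; rewrite fsat_rename, <- Hp; apply fsat_ext; intros n; unfold interp.
  destruct (r n) as [k|c]; [reflexivity|].
  destruct (c (@Structure False (fun _ _ => False))).
Qed.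

Create HintDb definable discriminated.
#[local] Hint Constants Opaque : definable.
#[local] Hint Transparent rel dom : definable.
#[local] Hint Resolve definable_not definable_and definable_or definable_imp definable_bi
  definable_ex definable_all definable_const definable_rel definable_eq
  definable_term_var definable_term_const : definable.
#[local] Hint Extern 5 (definable_term (fun _ e => ?t _ (fun n => e (@?f n)))) =>
  simple apply (@definable_term_rename _ _ f t) : definable.
Ltac definability := intros; cbv beta; typeclasses eauto with definable.

Local Notation definable1 R := (forall (I : Type) (M : I -> structure)
  (t : forall i, (nat -> dom (M i)) -> dom (M i)),
  definable_term t -> definable (fun i e => R (rel (M i)) (t i e))).
Local Notation definable2 R := (forall (I : Type) (M : I -> structure)
  (t u : forall i, (nat -> dom (M i)) -> dom (M i)), definable_term t -> definable_term u ->
  definable (fun i e => R (rel (M i)) (t i e) (u i e))).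
Local Notation definable3 R := (forall (I : Type) (M : I -> structure)
  (t u v : forall i, (nat -> dom (M i)) -> dom (M i)),
  definable_term t -> definable_term u -> definable_term v ->
  definable (fun i e => R (rel (M i)) (t i e) (u i e) (v i e))).

Lemma definable_sub : definable2 (@sub _).
Proof. unfold sub; definability. Qed.
Lemma definable_is_empty : definable1 (@is_empty _).
Proof. unfold is_empty; definability. Qed.
Lemma definable_is_upair : definable3 (@is_upair _).
Proof. unfold is_upair; definability. Qed.
Lemma definable_is_succ : definable2 (@is_succ _).
Proof. unfold is_succ; definability. Qed.
Lemma definable_ole : definable2 (@ole _).
Proof. unfold ole; definability. Qed.
#[local] Hint Resolve definable_sub definable_is_empty definable_is_upair definable_is_succ
  definable_ole : definable.

Lemma definable_is_pow : definable2 (@is_pow _).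
Proof. unfold is_pow; definability. Qed.
Lemma definable_is_pair : definable3 (@is_pair _).
Proof. unfold is_pair; definability. Qed.
Lemma definable_transitive : definable1 (@transitive _).
Proof. unfold transitive; definability. Qed.
#[local] Hint Resolve definable_is_pow definable_is_pair definable_transitive : definable.

Lemma definable_gr : definable3 (@gr _).
Proof. unfold gr; definability. Qed.
Lemma definable_ord : definable1 (@ord _).
Proof. unfold ord; definability. Qed.
Lemma definable_is_num n : definable1 (fun m x => is_num m n x).
Proof. induction n; cbn [is_num]; definability. Qed.
#[local] Hint Resolve definable_gr definable_ord definable_is_num : definable.

Lemma definable_is_pfun : definable3 (@is_pfun _).
Proof. unfold is_pfun; definability. Qed.
Lemma definable_limit : definable1 (@limit _).
Proof. unfold limit; definability. Qed.
Lemma definable_is_Vlevel : definable2 (@is_Vlevel _).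
Proof. unfold is_Vlevel; definability. Qed.
Lemma definable_is_scons : definable3 (@is_scons _).
Proof. unfold is_scons; definability. Qed.
Lemma definable_code1 n : definable2 (fun m x y => code1 m n x y).
Proof. unfold code1; definability. Qed.
#[local] Hint Resolve definable_is_pfun definable_limit definable_is_Vlevel
  definable_is_scons definable_code1 : definable.

Lemma definable_is_fun : definable3 (@is_fun _).
Proof. unfold is_fun; definability. Qed.
Lemma definable_is_omega : definable1 (@is_omega _).
Proof. unfold is_omega; definability. Qed.
Lemma definable_code2 n : definable3 (fun m x y z => code2 m n x y z).
Proof. unfold code2; definability. Qed.
#[local] Hint Resolve definable_is_fun definable_is_omega definable_code2 : definable.

Lemma definable_is_inj : definable3 (@is_inj _).
Proof. unfold is_inj; definability. Qed.
Lemma definable_is_nat : definable1 (@is_nat _).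
Proof. unfold is_nat; definability. Qed.
Lemma definable_assign : definable2 (@assign _).
Proof. unfold assign; definability. Qed.
Lemma definable_regular : definable1 (@regular _).
Proof. unfold regular; definability. Qed.
#[local] Hint Resolve definable_is_inj definable_is_nat definable_assign
  definable_regular : definable.

Lemma definable_injects : definable2 (@injects _).
Proof. unfold injects; definability. Qed.
#[local] Hint Resolve definable_injects : definable.
Lemma definable_card_lt : definable2 (@card_lt _).
Proof. unfold card_lt; definability. Qed.
#[local] Hint Resolve definable_card_lt : definable.
Lemma definable_inaccessible : definable1 (@inaccessible _).
Proof. unfold inaccessible, cardinal, strong_limit; definability. Qed.

Lemma definable_is_fml_None : definable1 (fun m x => is_fml m None x).
Proof.
  unfold is_fml, fml_closed, is_cMem, is_cEq, is_cNeg, is_cAnd, is_cEx; definability.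
Qed.
Lemma definable_is_fml_Some : definable2 (fun m l x => is_fml m (Some l) x).
Proof.
  unfold is_fml, fml_closed, is_cMem, is_cEq, is_cFun, is_cNeg, is_cAnd, is_cEx; definability.
Qed.
#[local] Hint Resolve definable_inaccessible definable_is_fml_None definable_is_fml_Some
  : definable.

Lemma definable_sat_None : definable3 (fun m x y z => sat m x None y z).
Proof.
  unfold sat, is_truth, is_cMem, is_cEq, is_cNeg, is_cAnd, is_cEx; definability.
Qed.
Lemma definable_sat_Some I M (t l u v : forall i : I, (nat -> dom (M i)) -> dom (M i)) :
  definable_term t -> definable_term l -> definable_term u -> definable_term v ->
  definable (fun i e => sat (rel (M i)) (t i e) (Some (l i e)) (u i e) (v i e)).
Proof.
  unfold sat, is_truth, is_cMem, is_cEq, is_cFun, is_cNeg, is_cAnd, is_cEx; definability.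
Qed.
#[local] Hint Resolve definable_sat_None definable_sat_Some : definable.
Lemma definable_elem_sub : definable2 (fun m x y => elem_sub m x None y None).
Proof. unfold elem_sub; definability. Qed.
#[local] Hint Resolve definable_elem_sub : definable.

(** * The formula defining the Laver function *)

Section LaverFormula.

Context {W : Type} (m : W -> W -> Prop).

Definition uplift (d g : W) : Prop :=
  inaccessible m g /\ m d g /\ exists vd vg,
    is_Vlevel m vd d /\ is_Vlevel m vg g /\ elem_sub m vd None vg None.
Definition isolated_uplift (d g : W) : Prop :=
  uplift d g /\ exists b, m b g /\ forall g', m g' g -> uplift d g' -> m g' b.

(* The finitely supported functions from omega to the ordinals, the value 0
   being the default one. *)
Definition fin_supp (s : W) : Prop :=
  exists w n, is_omega m w /\ m n w /\
    (forall p, m p s -> exists i b, m i w /\ ord m b /\ is_pair m p i b) /\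
    (forall i, m i w -> exists b, gr m s i b) /\
    (forall i b b', gr m s i b -> gr m s i b' -> b = b') /\
    (forall i b, gr m s i b -> ~ m i n -> is_empty m b).
Definition fin_supp_lt (s t : W) : Prop :=
  exists i b c, gr m s i b /\ gr m t i c /\ m b c /\
    forall j, m i j -> forall y, gr m s j y <-> gr m t j y.

Definition atom (x : W) : Prop := ord m x \/ fin_supp x.
Definition atom_lt (x y : W) : Prop := ~ ord m y /\ (ord m x \/ fin_supp_lt x y).

(* The codes are the closure of the atoms under pairing. *)
Definition component_closed (t : W) : Prop :=
  forall y, m y t -> atom y \/ exists y1 y2, m y1 t /\ m y2 t /\ is_pair m y y1 y2.
Definition is_code (c : W) : Prop := exists t, m c t /\ component_closed t.

Definition rank_lt (x y : W) : Prop :=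
  exists v a, is_Vlevel m v a /\ m x v /\ ~ m y v.
(* Codes are compared by rank, then atoms precede pairs, then pairs are compared
   lexicographically; L is the order on the sets of smaller rank. *)
Definition code_lt_step (L : W -> W -> Prop) (x y : W) : Prop :=
  rank_lt x y \/
  (~ rank_lt y x /\
   ((atom x /\ (atom y -> atom_lt x y)) \/
    (~ atom x /\ ~ atom y /\ exists x1 x2 y1 y2, is_pair m x x1 x2 /\ is_pair m y y1 y2 /\
      (L x1 y1 \/ (x1 = y1 /\ L x2 y2))))).
Definition is_code_order (A v : W) : Prop :=
  forall x y, m x v -> m y v -> (gr m A x y <-> code_lt_step (gr m A) x y).
Definition code_lt (x y : W) : Prop :=
  exists A v a, is_Vlevel m v a /\ m x v /\ m y v /\ is_code_order A v /\ gr m A x y.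
Definition least_code (P : W -> Prop) (c : W) : Prop :=
  is_code c /\ P c /\ forall c', is_code c' -> P c' -> c' = c \/ code_lt c c'.

Definition next_code_at (f g c : W) : Prop :=
  exists v, is_Vlevel m v g /\
    least_code (fun c' => m c' v /\ ~ exists g', m g' g /\ gr m f g' c') c.
Definition greedy (d f : W) : Prop :=
  forall g c, gr m f g c <-> isolated_uplift d g /\ next_code_at f g c.

(* x is the set defined in V_a by the formula p from the ordinals s(i), where
   c = ((a, (p, s)), eta); the ordinal eta only makes x have a proper class of
   codes. *)
Definition decodes (c x : W) : Prop :=
  exists a p s eta q r v, is_pair m q p s /\ is_pair m r a q /\ is_pair m c r eta /\
    is_Vlevel m v a /\ m x v /\ is_fml m None p /\
    (exists w, is_omega m w /\ is_fun m s w a) /\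
    forall u t, m u v -> assign m v t -> is_scons m t u s ->
      (sat m v None p t <-> u = x).

Context (Q : W -> Prop).
Definition guess (d x : W) : Prop :=
  exists f c, greedy d f /\ least_code (fun c' => ~ exists g, gr m f g c') c /\
    decodes c x /\ Q x.
Definition laver (d x : W) : Prop :=
  ord m d /\ (guess d x \/ (~ (exists y, guess d y) /\ is_empty m x)).

End LaverFormula.

Lemma definable_uplift : definable2 (@uplift _).
Proof. unfold uplift; definability. Qed.
#[local] Hint Resolve definable_uplift : definable.
Lemma definable_isolated_uplift : definable2 (@isolated_uplift _).
Proof. unfold isolated_uplift; definability. Qed.
Lemma definable_atom : definable1 (@atom _).
Proof. unfold atom, fin_supp; definability. Qed.
Lemma definable_atom_lt : definable2 (@atom_lt _).
Proof. unfold atom_lt, fin_supp_lt; definability. Qed.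
#[local] Hint Resolve definable_isolated_uplift definable_atom definable_atom_lt : definable.
Lemma definable_is_code : definable1 (@is_code _).
Proof. unfold is_code, component_closed; definability. Qed.
Lemma definable_code_lt_step : definable3 (fun m A x y => code_lt_step m (gr m A) x y).
Proof. unfold code_lt_step, rank_lt; definability. Qed.
#[local] Hint Resolve definable_is_code definable_code_lt_step : definable.
Lemma definable_code_lt : definable2 (@code_lt _).
Proof. unfold code_lt, is_code_order; definability. Qed.
#[local] Hint Resolve definable_code_lt : definable.
Lemma definable_next_code_at : definable3 (@next_code_at _).
Proof. unfold next_code_at, least_code; definability. Qed.
Lemma definable_decodes : definable2 (@decodes _).
Proof. unfold decodes; definability. Qed.
#[local] Hint Resolve definable_next_code_at definable_decodes : definable.

Section DefinableLaver.

Context (Q : forall W, (W -> W -> Prop) -> W -> Prop).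
Context (definable_Q : definable1 (@Q _)).

Lemma definable_guess : definable2 (fun m d x => guess m (Q m) d x).
Proof. unfold guess, greedy, least_code; definability. Qed.
#[local] Hint Resolve definable_guess : definable.
Lemma definable_laver : definable2 (fun m d x => laver m (Q m) d x).
Proof. unfold laver; definability. Qed.

End DefinableLaver.

Section SetTheory.

Context {V : Type} {mem : V -> V -> Prop} (hZFC : ZFC mem).
Local Notation "x ∈ y" := (mem x y) (at level 70, no associativity).
Local Notation "x ⊆ y" := (sub mem x y) (at level 70, no associativity).
Local Notation model := (fun _ : unit => Structure mem).
Local Notation definableV P := (@definable unit model (fun _ => P)).
Local Notation termV t := (@definable_term unit model (fun _ => t)).

(** * Definable classes of sets *)

Definition definable_pred (P : V -> Prop) : Prop := definableV (fun e => P (e 0)).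
Definition definable_relation (R : V -> V -> Prop) : Prop :=
  definableV (fun e => R (e 0) (e 1)).
Definition definable_fun (F : V -> V) : Prop := termV (fun e => F (e 0)).
Definition definable_fun2 (G : V -> V -> V) : Prop := termV (fun e => G (e 0) (e 1)).

Lemma definable_pred_app P t :
  definable_pred P -> termV t -> definableV (fun e => P (t e)).
Proof. apply (@definable_subst unit model (fun _ x _ => P x)). Qed.
Lemma definable_relation_app R t u :
  definable_relation R -> termV t -> termV u -> definableV (fun e => R (t e) (u e)).
Proof. apply (@definable_subst2 unit model (fun _ x y _ => R x y)). Qed.
Lemma definable_fun_app F t : definable_fun F -> termV t -> termV (fun e => F (t e)).
Proof.
  intros HF Ht; apply (@definable_subst unit model (fun _ x e => e 0 = F x)).
  - revert HF; apply (@definable_rename unit model (fun n => match n with O => 1 | _ => 0 end)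
      (fun _ e => e 0 = F (e 1))).
  - apply (definable_term_rename S), Ht.
Qed.
Lemma definable_fun2_app G t u :
  definable_fun2 G -> termV t -> termV u -> termV (fun e => G (t e) (u e)).
Proof.
  intros HG Ht Hu; apply (@definable_subst2 unit model (fun _ x y e => e 0 = G x y)).
  - revert HG.
    apply (@definable_rename unit model (fun n => match n with O => 2 | 1 => 0 | _ => 1 end)).
  - apply (definable_term_rename S), Ht.
  - apply (definable_term_rename S), Hu.
Qed.

Lemma definable_pred_at (P : (nat -> V) -> V -> Prop) e :
  definableV (fun e => P (fun n => e (S n)) (e 0)) -> definable_pred (P e).
Proof.
  intros HP; apply (@definable_iff unit model
    (fun _ e' => P (fun n => e n) (e' 0))); [tauto|].
  destruct HP as (p & r & Hp).
  exists p, (fun n => match r n with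
    | inl O => inl O | inl (S k) => inr (fun _ => e k) | inr c => inr c end).
  intros i e'; rewrite <- (Hp i (fun n => match n with O => e' 0 | S k => e k end)).
  apply fsat_ext; intros n; unfold interp; destruct (r n) as [[|k]|c]; reflexivity.
Qed.

Lemma definable_term_of_graph (t : (nat -> V) -> V) (R : V -> (nat -> V) -> Prop) :
  (forall y e, y = t e <-> R y e) ->
  definableV (fun e => R (e 0) (fun n => e (S n))) -> termV t.
Proof. intros E; apply definable_iff; intros _ e; symmetry; apply E. Qed.

Hint Extern 0 (definable_pred _) => unfold definable_pred; cbv beta : definable.
Hint Extern 0 (definable_relation _) => unfold definable_relation; cbv beta : definable.
Hint Extern 0 (definable_fun _) => unfold definable_fun; cbv beta : definable.
Hint Extern 0 (definable_fun2 _) => unfold definable_fun2; cbv beta : definable.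
Hint Extern 5 (definable_term (fun _ e => ?t (fun n => e (@?f n)))) =>
  simple apply (@definable_term_rename unit model f (fun _ => t)) : definable.
Hint Extern 4 (definable (fun _ e => ?P (@?t e))) =>
  match goal with H : definable_pred P |- _ => simple apply (definable_pred_app (t := t) H) end
  : definable.
Hint Extern 4 (definable (fun _ e => ?R (@?t e) (@?u e))) =>
  match goal with H : definable_relation R |- _ =>
    simple apply (definable_relation_app (t := t) (u := u) H) end : definable.
Hint Extern 4 (definable_term (fun _ e => ?F (@?t e))) =>
  match goal with H : definable_fun F |- _ => simple apply (definable_fun_app (t := t) H) end
  : definable.
Hint Extern 4 (definable_term (fun _ e => ?G (@?t e) (@?u e))) =>
  match goal with H : definable_fun2 G |- _ =>
    simple apply (definable_fun2_app (t := t) (u := u) H) end : definable.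

(* Applies an induction principle for definable classes, the class being read off
   the goal. *)
Ltac induct_with principle :=
  first [refine (principle _ _ _) | refine (principle _ _ _ _)
        |refine (principle _ _ _ _ _ _ _ _ _)]; cbv beta.

(** * Basic set constructions *)

Lemma set_ext x y : (forall z, z ∈ x <-> z ∈ y) -> x = y.
Proof. apply (zfc_ext hZFC). Qed.

Lemma sub_refl x : x ⊆ x.
Proof. intros z; auto. Qed.
Lemma sub_trans x y z : x ⊆ y -> y ⊆ z -> x ⊆ z.
Proof. intros Hxy Hyz u Hu; auto. Qed.

Lemma inhabited_model : inhabited V.
Proof. destruct (zfc_inf hZFC) as [w _]; exact (inhabits w). Qed.

Definition the (P : V -> Prop) : V := epsilon inhabited_model P.
Lemma the_spec (P : V -> Prop) : (exists x, P x) -> P (the P).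
Proof. apply epsilon_spec. Qed.

Definition sep (a : V) (P : V -> Prop) : V :=
  the (fun b => forall x, x ∈ b <-> x ∈ a /\ P x).
Lemma mem_sep a P x : definable_pred P -> (x ∈ sep a P <-> x ∈ a /\ P x).
Proof.
  intros (p & r & Hp); revert x; unfold sep.
  apply (the_spec (P := fun b => forall x, x ∈ b <-> _)).
  set (f := fun n => match r n with inl _ => O | inr _ => S n end).
  destruct (zfc_sep hZFC (rename f p)
    (fun n => match r n with inl _ => a | inr c => c tt end) a) as [b Hb].
  exists b; intros x; rewrite Hb, fsat_rename, <- (Hp tt (fun _ => x)).
  apply and_iff_compat_l, fsat_ext; intros n; unfold f, interp.
  destruct (r n) eqn:E; simpl; rewrite ?E; reflexivity.
Qed.

Lemma replacement (R : V -> V -> Prop) a :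
  definable_relation R ->
  (forall x y y', x ∈ a -> R x y -> R x y' -> y = y') ->
  exists b, forall y, y ∈ b <-> exists x, x ∈ a /\ R x y.
Proof.
  intros (p & r & Hp) functional.
  set (f := fun n => match r n with inl O => O | inl _ => 1 | inr _ => S (S n) end).
  set (c := fun n => match r n with inl _ => a | inr c => c tt end).
  assert (fsat_R : forall x y, fsat mem (scons x (scons y c)) (rename f p) <-> R x y).
  { intros x y; rewrite fsat_rename.
    rewrite <- (Hp tt (fun n => match n with O => x | _ => y end)); apply fsat_ext.
    intros n; unfold f, c, interp; destruct (r n) as [[|k]|d] eqn:E; simpl; rewrite ?E;
      reflexivity. }
  destruct (zfc_repl hZFC (p := rename f p) (e := c) (a := a)) as [b Hb].
  - intros x y y'; rewrite !fsat_R; apply functional.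
  - exists b; intros y; rewrite Hb.
    split; intros (x & Hx & Hxy); exists x; apply fsat_R in Hxy || rewrite fsat_R; auto.
Qed.

Definition image (a : V) (F : V -> V) : V :=
  the (fun b => forall y, y ∈ b <-> exists x, x ∈ a /\ y = F x).
Lemma mem_image a F y : definable_fun F ->
  (y ∈ image a F <-> exists x, x ∈ a /\ y = F x).
Proof.
  intros HF; revert y; unfold image.
  apply (the_spec (P := fun b => forall y, y ∈ b <-> _)), replacement; [definability|].
  intros x y y' _ -> ->; reflexivity.
Qed.

Definition empty : V := the (is_empty mem).
Lemma is_empty_empty : is_empty mem empty.
Proof.
  unfold empty; apply the_spec; destruct (zfc_inf hZFC) as [w [(z & Hz & _) _]]; eauto.
Qed.
Lemma not_mem_empty x : ~ x ∈ empty.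
Proof. apply is_empty_empty. Qed.
Lemma is_empty_iff x : is_empty mem x <-> x = empty.
Proof.
  split; [|intros ->; apply is_empty_empty].
  intros Hx; apply set_ext; intros z; split; intros Hz;
    [destruct (Hx z Hz)|destruct (not_mem_empty Hz)].
Qed.

Definition upair (x y : V) : V := the (fun p => is_upair mem p x y).
Lemma mem_upair x y z : z ∈ upair x y <-> z = x \/ z = y.
Proof.
  revert z; apply (the_spec (P := fun p => is_upair mem p x y)), (zfc_pair hZFC).
Qed.
Lemma is_upair_iff p x y : is_upair mem p x y <-> p = upair x y.
Proof.
  split; [|intros ->; intros z; apply mem_upair].
  intros Hp; apply set_ext; intros z; rewrite mem_upair; apply Hp.
Qed.
Lemma upair_l x y : x ∈ upair x y.
Proof. apply mem_upair; auto. Qed.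
Lemma upair_r x y : y ∈ upair x y.
Proof. apply mem_upair; auto. Qed.

Definition union (x : V) : V :=
  the (fun u => forall z, z ∈ u <-> exists y, y ∈ x /\ z ∈ y).
Lemma mem_union x z : z ∈ union x <-> exists y, y ∈ x /\ z ∈ y.
Proof.
  revert z; apply (the_spec (P := fun u => forall z, z ∈ u <-> _)), (zfc_union hZFC).
Qed.

Definition powerset (x : V) : V := the (fun p => is_pow mem p x).
Lemma mem_powerset x z : z ∈ powerset x <-> z ⊆ x.
Proof. revert z; apply (the_spec (P := fun p => is_pow mem p x)), (zfc_pow hZFC). Qed.
Lemma is_pow_iff p x : is_pow mem p x <-> p = powerset x.
Proof.
  split; [|intros ->; intros z; apply mem_powerset].
  intros Hp; apply set_ext; intros z; rewrite mem_powerset; apply Hp.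
Qed.

Definition cup (x y : V) : V := union (upair x y).
Lemma mem_cup x y z : z ∈ cup x y <-> z ∈ x \/ z ∈ y.
Proof.
  unfold cup; rewrite mem_union; split.
  - intros (u & Hu & Hz); apply mem_upair in Hu; destruct Hu; subst; auto.
  - intros [Hz|Hz]; eauto using upair_l, upair_r.
Qed.

Definition succ (x : V) : V := cup x (upair x x).
Lemma mem_succ x z : z ∈ succ x <-> z ∈ x \/ z = x.
Proof. unfold succ; rewrite mem_cup, mem_upair; tauto. Qed.
Lemma is_succ_iff y x : is_succ mem y x <-> y = succ x.
Proof.
  split; [|intros ->; intros z; apply mem_succ].
  intros Hy; apply set_ext; intros z; rewrite mem_succ; apply Hy.
Qed.
Lemma mem_succ_self x : x ∈ succ x.
Proof. apply mem_succ; auto. Qed.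
Lemma succ_neq_empty x : succ x <> empty.
Proof. intros E; apply (@not_mem_empty x); rewrite <- E; apply mem_succ_self. Qed.

Definition opair (x y : V) : V := upair (upair x x) (upair x y).
Local Notation "⟨ x , y ⟩" := (opair x y).
Lemma is_pair_iff p x y : is_pair mem p x y <-> p = ⟨x, y⟩.
Proof.
  split.
  - intros (a & b & Ha & Hb & Hp); rewrite is_upair_iff in *; subst; reflexivity.
  - intros ->; exists (upair x x), (upair x y); rewrite !is_upair_iff; auto.
Qed.
Lemma gr_iff r x y : gr mem r x y <-> ⟨x, y⟩ ∈ r.
Proof.
  unfold gr; split; [intros (p & Hp & Hr); apply is_pair_iff in Hp; subst; auto|].
  intros Hr; exists ⟨x, y⟩; rewrite is_pair_iff; auto.
Qed.
Lemma upair_inj_r x y z : upair x y = upair x z -> y = z.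
Proof.
  intros E.
  assert (Hy : y ∈ upair x z) by (rewrite <- E; apply upair_r).
  assert (Hz : z ∈ upair x y) by (rewrite E; apply upair_r).
  rewrite mem_upair in *; destruct Hy, Hz; congruence.
Qed.
Lemma opair_inj x y x' y' : ⟨x, y⟩ = ⟨x', y'⟩ -> x = x' /\ y = y'.
Proof.
  unfold opair; intros E.
  assert (x' = x) as ->.
  { assert (Hx : upair x x ∈ upair (upair x' x') (upair x' y'))
      by (rewrite <- E; apply upair_l).
    assert (Hx' : x' ∈ upair x x)
      by (apply mem_upair in Hx; destruct Hx as [-> | ->]; apply upair_l).
    apply mem_upair in Hx'; tauto. }
  split; [reflexivity|]; exact (upair_inj_r (upair_inj_r E)).
Qed.
Lemma opair_in_union2 x y f : ⟨x, y⟩ ∈ f -> x ∈ union (union f) /\ y ∈ union (union f).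
Proof.
  intros Hf; assert (upair x y ∈ union f) by (apply mem_union; eauto using upair_r).
  split; apply mem_union; eauto using upair_l, upair_r.
Qed.

Ltac opair_injection :=
  repeat match goal with
  | E : ⟨_, _⟩ = ⟨_, _⟩ |- _ => apply opair_inj in E; destruct E
  end.

Lemma definable_term_of_elements (t : (nat -> V) -> V) (R : V -> (nat -> V) -> Prop) :
  (forall z e, z ∈ t e <-> R z e) ->
  definableV (fun e => R (e 0) (fun n => e (S n))) -> termV t.
Proof.
  intros Ht HR; apply (@definable_term_of_graph _ (fun y e => forall z, z ∈ y <-> R z e)).
  - intros y e; split; [intros -> z; apply Ht|].
    intros Hy; apply set_ext; intros z; rewrite Hy; symmetry; apply Ht.
  - apply (@definable_all unit model (fun _ z e => z ∈ e 0 <-> R z (fun n => e (S n)))).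
    apply definable_bi; [definability|].
    exact (@definable_rename unit model (fun n => match n with O => 0 | S k => S (S k) end)
      (fun _ e => R (e 0) (fun n => e (S n))) HR).
Qed.

Section SetTerms.

Context (t u : (nat -> V) -> V) (Ht : termV t) (Hu : termV u).

Lemma definable_term_sep (P : (nat -> V) -> V -> Prop) :
  definableV (fun e => P (fun n => e (S n)) (e 0)) ->
  termV (fun e => sep (t e) (P e)).
Proof.
  intros HP.
  apply (@definable_term_of_elements (fun e => sep (t e) (P e))
    (fun x e => x ∈ t e /\ P e x)).
  - intros; apply mem_sep, (definable_pred_at e HP).
  - apply definable_and; [definability|exact HP].
Qed.
Lemma definable_term_upair : termV (fun e => upair (t e) (u e)).
Proof.
  apply (@definable_term_of_elements (fun e => upair (t e) (u e))
    (fun z e => z = t e \/ z = u e));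
    [intros; apply mem_upair|definability].
Qed.
Lemma definable_term_union : termV (fun e => union (t e)).
Proof.
  apply (@definable_term_of_elements (fun e => union (t e))
    (fun z e => exists y, y ∈ t e /\ z ∈ y));
    [intros; apply mem_union|definability].
Qed.
Lemma definable_term_powerset : termV (fun e => powerset (t e)).
Proof.
  apply (@definable_term_of_elements (fun e => powerset (t e)) (fun z e => z ⊆ t e));
    [intros; apply mem_powerset|definability].
Qed.

End SetTerms.
Hint Resolve definable_term_sep definable_term_upair
  definable_term_union definable_term_powerset : definable.
Lemma definable_term_cup t u : termV t -> termV u -> termV (fun e => cup (t e) (u e)).
Proof. unfold cup; definability. Qed.
Hint Resolve definable_term_cup : definable.
Lemma definable_term_succ t : termV t -> termV (fun e => succ (t e)).
Proof. unfold succ; definability. Qed.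
Lemma definable_term_opair t u : termV t -> termV u -> termV (fun e => ⟨t e, u e⟩).
Proof. unfold opair; definability. Qed.
Hint Resolve definable_term_succ definable_term_opair : definable.

Lemma foundation P x : definable_pred P -> (exists y, y ∈ x /\ P y) ->
  exists y, y ∈ x /\ P y /\ forall z, z ∈ x -> P z -> ~ z ∈ y.
Proof.
  intros HP (y & Hy & Py).
  destruct (zfc_found hZFC (x := sep x P)) as (z & Hz & Hmin).
  - exists y; apply mem_sep; auto.
  - apply mem_sep in Hz; auto; destruct Hz as [Hz Pz].
    exists z; repeat split; auto; intros u Hu Pu; apply Hmin, mem_sep; auto.
Qed.

Lemma mem_irrefl x : ~ x ∈ x.
Proof.
  intros Hx; destruct (zfc_found hZFC (x := upair x x)) as (y & Hy & Hmin).
  - exists x; apply upair_l.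
  - apply mem_upair in Hy; assert (y = x) as -> by tauto.
    exact (Hmin x (upair_l x x) Hx).
Qed.
Lemma mem_asym x y : x ∈ y -> ~ y ∈ x.
Proof.
  intros Hxy Hyx; destruct (zfc_found hZFC (x := upair x y)) as (z & Hz & Hmin).
  - exists x; apply upair_l.
  - apply mem_upair in Hz; destruct Hz as [-> | ->];
      [apply (Hmin y)|apply (Hmin x)]; auto using upair_l, upair_r.
Qed.
Lemma succ_inj x y : succ x = succ y -> x = y.
Proof.
  intros E; assert (Hx : x ∈ succ y) by (rewrite <- E; apply mem_succ_self).
  assert (Hy : y ∈ succ x) by (rewrite E; apply mem_succ_self).
  rewrite mem_succ in *; destruct Hx as [Hx|], Hy as [Hy|]; auto.
  destruct (mem_asym Hx Hy).
Qed.

(** * Ordinals *)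

Lemma ord_mem a b : ord mem a -> b ∈ a -> ord mem b.
Proof.
  intros [trans_a trans_el] Hb; split; [auto|].
  intros y Hy; apply trans_el; apply (trans_a b); auto.
Qed.
Lemma ord_mem_trans a b c : ord mem c -> a ∈ b -> b ∈ c -> a ∈ c.
Proof. intros [trans_c _] Hab Hbc; exact (trans_c b Hbc a Hab). Qed.

Lemma ord_least P a : definable_pred P -> ord mem a -> P a ->
  exists b, ord mem b /\ ole mem b a /\ P b /\ forall c, c ∈ b -> ~ P c.
Proof.
  intros HP Oa Pa; destruct (@foundation P (succ a) HP) as (b & Hb & Pb & Hmin);
    [eauto using mem_succ_self|].
  apply mem_succ in Hb.
  exists b; split; [destruct Hb; subst; eauto using ord_mem|]; split; [exact Hb|].
  split; [exact Pb|]; intros c Hc Pc; apply (Hmin c); auto.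
  apply mem_succ; left; destruct Hb; subst; eauto using ord_mem_trans.
Qed.

Lemma ord_ind P : definable_pred P ->
  (forall a, ord mem a -> (forall b, b ∈ a -> P b) -> P a) ->
  forall a, ord mem a -> P a.
Proof.
  intros HP IH a Oa; apply NNPP; intros Na.
  destruct (@ord_least (fun x => ~ P x) a) as (b & Ob & _ & Nb & Hmin); auto;
    [definability|].
  apply Nb, IH; auto; intros c Hc; apply NNPP; exact (Hmin c Hc).
Qed.

Lemma ord_trichotomy a b : ord mem a -> ord mem b -> a ∈ b \/ a = b \/ b ∈ a.
Proof.
  intros Oa; revert b; revert a Oa.
  induct_with ord_ind; [definability|]; intros a Oa IHa.
  induct_with ord_ind; [definability|]; intros b Ob IHb.
  destruct (classic (a ∈ b)) as [|Nab]; auto; destruct (classic (b ∈ a)) as [|Nba]; auto.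
  right; left; apply set_ext; intros z; split; intros Hz.
  - destruct (IHa z Hz b Ob) as [|[-> |Hbz]]; auto; [tauto|].
    destruct Nba; exact (ord_mem_trans Oa Hbz Hz).
  - destruct (IHb z Hz) as [Haz|[-> |]]; auto; [|tauto].
    destruct Nab; exact (ord_mem_trans Ob Haz Hz).
Qed.

Lemma ord_empty : ord mem empty.
Proof. split; intros y Hy; destruct (not_mem_empty Hy). Qed.
Lemma ord_succ a : ord mem a -> ord mem (succ a).
Proof.
  intros Oa; split.
  - intros y Hy z Hz; apply mem_succ; apply mem_succ in Hy; left; destruct Hy; subst;
      eauto using ord_mem_trans.
  - intros y Hy; apply mem_succ in Hy; destruct Hy as [Hy| ->];
      [exact (proj1 (ord_mem Oa Hy))|exact (proj1 Oa)].
Qed.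
Lemma ord_union a : (forall x, x ∈ a -> ord mem x) -> ord mem (union a).
Proof.
  intros Oa; split; intros y Hy; apply mem_union in Hy; destruct Hy as (x & Hx & Hy).
  - intros z Hz; apply mem_union; exists x; split; auto.
    exact (ord_mem_trans (Oa x Hx) Hz Hy).
  - exact (proj1 (ord_mem (Oa x Hx) Hy)).
Qed.

Lemma ord_mem_or_ole a b : ord mem a -> ord mem b -> a ∈ b \/ ole mem b a.
Proof. intros Oa Ob; unfold ole; destruct (ord_trichotomy Oa Ob) as [|[|]]; auto. Qed.
Lemma ord_sub_iff_ole a b : ord mem a -> ord mem b -> (a ⊆ b <-> ole mem a b).
Proof.
  intros Oa Ob; split.
  - intros Hsub; destruct (ord_mem_or_ole Ob Oa) as [Hba|]; auto.
    destruct (mem_irrefl (Hsub b Hba)).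
  - intros [Hab| ->] z Hz; eauto using ord_mem_trans.
Qed.
Lemma ole_mem_trans a b c : ord mem c -> ole mem a b -> b ∈ c -> a ∈ c.
Proof. intros Oc [Hab| ->] Hbc; eauto using ord_mem_trans. Qed.
Lemma mem_ole_trans a b c : ord mem c -> a ∈ b -> ole mem b c -> a ∈ c.
Proof. intros Oc Hab [Hbc| <-]; eauto using ord_mem_trans. Qed.
Lemma succ_mem_succ a b : ord mem b -> (succ a ∈ succ b <-> a ∈ b).
Proof.
  intros Ob; split; intros Hab.
  - apply mem_succ in Hab; destruct Hab as [Hab| <-]; [|apply mem_succ_self].
    exact (ord_mem_trans Ob (mem_succ_self a) Hab).
  - apply mem_succ, ord_sub_iff_ole; eauto using ord_mem, ord_succ.
    intros z Hz; apply mem_succ in Hz; destruct Hz as [Hz| ->]; eauto using ord_mem_trans.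
Qed.

Lemma ord_bound a : (forall x, x ∈ a -> ord mem x) ->
  exists b, ord mem b /\ forall x, x ∈ a -> x ∈ b.
Proof.
  intros Oa; exists (succ (union a)); split; [apply ord_succ, ord_union, Oa|].
  intros x Hx; apply mem_succ, (ord_sub_iff_ole (Oa x Hx) (ord_union Oa)).
  intros z Hz; apply mem_union; eauto.
Qed.
Lemma ord_not_in_set a : exists b, ord mem b /\ ~ b ∈ a.
Proof.
  destruct (@ord_bound (sep a (ord mem))) as (b & Ob & Hb).
  - intros x Hx; apply mem_sep in Hx; [tauto|definability].
  - exists b; split; auto; intros Hba; apply (@mem_irrefl b), Hb, mem_sep; auto; definability.
Qed.
Lemma ord_cup a b : ord mem a -> ord mem b -> cup a b = a \/ cup a b = b.
Proof.
  intros Oa Ob; destruct (ord_mem_or_ole Oa Ob) as [Hab|Hba]; [right|left];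
    apply set_ext; intros z; rewrite mem_cup; split; auto; intros [Hz|Hz]; auto.
  - exact (ord_mem_trans Ob Hz Hab).
  - exact (mem_ole_trans Oa Hz Hba).
Qed.

Lemma limit_succ a b : limit mem a -> b ∈ a -> succ b ∈ a.
Proof.
  intros (Oa & _ & cofinal) Hb; destruct (cofinal b Hb) as (c & Hc & Hbc).
  apply ole_mem_trans with c; auto; apply mem_succ, succ_mem_succ; eauto using ord_mem.
Qed.
Lemma limit_empty_mem a : limit mem a -> empty ∈ a.
Proof.
  intros (Oa & nonempty & _); destruct (ord_mem_or_ole ord_empty Oa) as [|[Ha| ->]]; auto.
  - destruct (not_mem_empty Ha).
  - destruct (nonempty is_empty_empty).
Qed.

Lemma limit_exists : exists a, limit mem a.
Proof.
  destruct (zfc_inf hZFC) as (w & (z & Hz & Hzw) & Hw).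
  set (o := sep w (ord mem)).
  assert (mem_o : forall x, x ∈ o <-> x ∈ w /\ ord mem x)
    by (intros x; apply mem_sep; definability).
  assert (succ_o : forall x, x ∈ o -> succ x ∈ o).
  { intros x Hx; apply mem_o in Hx; destruct Hx as [Hx Ox].
    destruct (Hw x Hx) as (y & Hy & Hyw); apply is_succ_iff in Hy; subst y.
    apply mem_o; auto using ord_succ. }
  apply is_empty_iff in Hz; subst z.
  assert (He : empty ∈ o) by (apply mem_o; auto using ord_empty).
  exists (union o); split; [apply ord_union; intros x Hx; apply mem_o, Hx|split].
  - intros N; apply (N empty), mem_union; eauto using mem_succ_self.
  - intros y Hy; apply mem_union in Hy; destruct Hy as (x & Hx & Hy).
    exists x; split; auto; apply mem_union; eauto using mem_succ_self.
Qed.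

Definition omega : V := the (is_omega mem).
Lemma is_omega_omega : is_omega mem omega.
Proof.
  unfold omega; apply the_spec; destruct limit_exists as [a La].
  destruct (@ord_least (limit mem) a) as (b & _ & _ & Lb & Hb); auto;
    [definability|apply La|].
  exists b; split; auto.
Qed.
Lemma is_omega_iff w : is_omega mem w <-> w = omega.
Proof.
  split; [|intros ->; apply is_omega_omega].
  intros [Lw Nw]; destruct is_omega_omega as [Lo No].
  destruct (ord_trichotomy (proj1 Lw) (proj1 Lo)) as [Hw|[|Hw]]; auto;
    [destruct (No w)|destruct (Nw omega)]; auto.
Qed.
Lemma limit_omega : limit mem omega.
Proof. apply is_omega_omega. Qed.
Lemma ord_omega : ord mem omega.
Proof. apply limit_omega. Qed.
Lemma ord_nat n : n ∈ omega -> ord mem n.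
Proof. apply ord_mem, ord_omega. Qed.
Lemma empty_in_omega : empty ∈ omega.
Proof. apply limit_empty_mem, limit_omega. Qed.
Lemma succ_in_omega n : n ∈ omega -> succ n ∈ omega.
Proof. apply limit_succ, limit_omega. Qed.
Lemma is_nat_iff n : is_nat mem n <-> n ∈ omega.
Proof.
  split; [intros (w & Hw & Hn); apply is_omega_iff in Hw; subst; auto|].
  intros Hn; exists omega; auto using is_omega_omega.
Qed.
Lemma nat_cases n : n ∈ omega -> n = empty \/ exists k, k ∈ omega /\ n = succ k.
Proof.
  intros Hn; destruct (classic (n = empty)) as [|Ne]; auto; right.
  assert (On := ord_nat Hn).
  assert (exists k, k ∈ n /\ ~ exists z, z ∈ n /\ k ∈ z) as (k & Hk & max_k).
  { apply NNPP; intros no_max; apply (proj2 is_omega_omega n Hn).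
    split; [exact On|]; split; [rewrite is_empty_iff; auto|].
    intros y Hy; apply NNPP; intros Ny; apply no_max; eauto. }
  exists k; split; [exact (ord_mem_trans ord_omega Hk Hn)|].
  apply set_ext; intros z; rewrite mem_succ; split.
  - intros Hz; destruct (ord_trichotomy (ord_mem On Hz) (ord_mem On Hk)) as [|[|Hkz]]; auto.
    destruct max_k; eauto.
  - intros [Hz| ->]; eauto using ord_mem_trans.
Qed.
Lemma nat_ind P : definable_pred P -> P empty ->
  (forall n, n ∈ omega -> P n -> P (succ n)) -> forall n, n ∈ omega -> P n.
Proof.
  intros HP P0 PS n Hn; assert (On := ord_nat Hn); revert n On Hn.
  induct_with ord_ind; [definability|].
  intros n _ IH Hn; destruct (nat_cases Hn) as [-> |(k & Hk & ->)]; auto.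
  apply PS, IH; auto using mem_succ_self.
Qed.

(** * Transfinite recursion *)

Definition restrict (f c : V) : V := sep f (fun p => exists x y, x ∈ c /\ p = ⟨x, y⟩).
Lemma mem_restrict f c p :
  p ∈ restrict f c <-> p ∈ f /\ exists x y, x ∈ c /\ p = ⟨x, y⟩.
Proof. apply mem_sep; definability. Qed.
Lemma definable_term_restrict t u :
  termV t -> termV u -> termV (fun e => restrict (t e) (u e)).
Proof. unfold restrict; definability. Qed.
Hint Resolve definable_term_restrict : definable.

Definition graph (a : V) (F : V -> V) : V := image a (fun x => ⟨x, F x⟩).
Lemma mem_graph a F p : definable_fun F ->
  (p ∈ graph a F <-> exists x, x ∈ a /\ p = ⟨x, F x⟩).
Proof. intros HF; apply mem_image; definability. Qed.
Lemma opair_in_graph a F x y : definable_fun F -> (⟨x, y⟩ ∈ graph a F <-> x ∈ a /\ y = F x).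
Proof.
  intros HF; rewrite mem_graph by exact HF; split; [|intros [Hx ->]; eauto].
  intros (z & Hz & E); opair_injection; subst; auto.
Qed.

Section Recursion.

Context (G : V -> V -> V) (definable_G : definable_fun2 G).

Definition is_recursion (b f : V) : Prop :=
  forall p, p ∈ f <-> exists c, c ∈ b /\ p = ⟨c, G c (restrict f c)⟩.

Lemma is_recursion_restrict b f c :
  ord mem b -> is_recursion b f -> c ∈ b -> is_recursion c (restrict f c).
Proof.
  intros Ob Hf Hc p.
  assert (restrict2 : forall d, d ∈ c -> restrict (restrict f c) d = restrict f d).
  { intros d Hd; apply set_ext; intros q; rewrite !mem_restrict; split; [tauto|].
    intros [Hq (x & y & Hx & ->)]; repeat split; eauto.
    exists x, y; split; auto; exact (ord_mem_trans (ord_mem Ob Hc) Hx Hd). }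
  rewrite mem_restrict, (Hf p); split.
  - intros [(d & Hd & ->) (x & y & Hx & E)]; opair_injection; subst x.
    exists d; rewrite restrict2; auto.
  - intros (d & Hd & ->); rewrite restrict2 by auto.
    split; [exists d; split; eauto using ord_mem_trans|eauto].
Qed.

Lemma is_recursion_unique b f f' :
  ord mem b -> is_recursion b f -> is_recursion b f' -> f = f'.
Proof.
  intros Ob; revert f f'; revert b Ob.
  induct_with ord_ind; [unfold is_recursion; definability|].
  intros b Ob IH f f' Hf Hf'.
  assert (E : forall c, c ∈ b -> restrict f c = restrict f' c)
    by eauto using is_recursion_restrict.
  apply set_ext; intros p; rewrite (Hf p), (Hf' p).
  split; intros (c & Hc & ->); exists c; rewrite E; auto.
Qed.

Lemma is_recursion_exists b : ord mem b -> exists f, is_recursion b f.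
Proof.
  revert b; induct_with ord_ind; [unfold is_recursion; definability|].
  intros b Ob IH.
  destruct (@replacement (fun c p => exists h, is_recursion c h /\ p = ⟨c, G c h⟩) b)
    as [f mem_f].
  { unfold is_recursion; definability. }
  { intros c p p' Hc (h & Hh & ->) (h' & Hh' & ->).
    rewrite (is_recursion_unique (ord_mem Ob Hc) Hh Hh'); reflexivity. }
  assert (restrict_f : forall c h, c ∈ b -> is_recursion c h -> restrict f c = h).
  { intros c h Hc Hh; assert (Oc := ord_mem Ob Hc).
    apply set_ext; intros p; rewrite mem_restrict, mem_f, (Hh p); split.
    - intros [(d & Hd & h' & Hh' & ->) (x & y & Hx & E)]; opair_injection; subst x.
      exists d; split; auto; f_equal; f_equal.
      apply (@is_recursion_unique d); eauto using ord_mem, is_recursion_restrict.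
    - intros (d & Hd & ->); split; [|eauto].
      exists d; split; [exact (ord_mem_trans Ob Hd Hc)|].
      exists (restrict h d); split; [exact (is_recursion_restrict Oc Hh Hd)|reflexivity]. }
  exists f; intros p; rewrite mem_f; split.
  - intros (c & Hc & h & Hh & ->); exists c; rewrite (restrict_f c h); auto.
  - intros (c & Hc & ->); exists c; split; auto.
    destruct (IH c Hc) as [h Hh]; exists h; rewrite (restrict_f c h); auto.
Qed.

(* The value at sets that are not ordinals is irrelevant; it is fixed so that the
   function is definable. *)
Definition is_rec_fun (b f : V) : Prop :=
  (ord mem b /\ is_recursion b f) \/ (~ ord mem b /\ f = empty).
Definition rec_fun (b : V) : V := the (is_rec_fun b).
Definition rec (b : V) : V := G b (rec_fun b).

Lemma eq_rec_fun_iff b f : f = rec_fun b <-> is_rec_fun b f.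
Proof.
  assert (spec : is_rec_fun b (rec_fun b)).
  { apply (the_spec (P := is_rec_fun b)).
    destruct (classic (ord mem b)) as [Ob|Nb]; [|exists empty; right; auto].
    destruct (is_recursion_exists Ob) as [h Hh]; exists h; left; auto. }
  split; [intros ->; exact spec|].
  destruct spec as [[Ob spec]|[Nb ->]]; intros [[Ob' Hf]|[Nb' ->]]; try tauto.
  exact (is_recursion_unique Ob Hf spec).
Qed.

Lemma definable_term_rec t : termV t -> termV (fun e => rec (t e)).
Proof.
  assert (definable_fun rec_fun).
  { apply (@definable_term_of_graph (fun e => rec_fun (e 0)) (fun f e => is_rec_fun (e 0) f)).
    - intros; apply eq_rec_fun_iff.
    - unfold is_rec_fun, is_recursion; definability. }
  unfold rec; definability.
Qed.

Lemma rec_eq b : ord mem b -> rec b = G b (graph b rec).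
Proof.
  intros Ob; unfold rec at 1; f_equal.
  assert (recursion_b : forall c, ord mem c -> is_recursion c (rec_fun c)).
  { intros c Oc; destruct (proj1 (eq_rec_fun_iff c _) eq_refl) as [[_ Hc]|[Nc _]]; tauto. }
  apply set_ext; intros p.
  rewrite mem_graph by (unfold definable_fun; apply definable_term_rec; definability).
  rewrite (recursion_b b Ob p).
  assert (E : forall c, c ∈ b -> restrict (rec_fun b) c = rec_fun c).
  { intros c Hc; apply eq_rec_fun_iff; left; eauto using ord_mem, is_recursion_restrict. }
  split; intros (c & Hc & ->); exists c; split; auto; unfold rec; rewrite E; auto.
Qed.

End Recursion.
Hint Resolve definable_term_rec : definable.

Definition range (f : V) : V := sep (union (union f)) (fun y => exists x, ⟨x, y⟩ ∈ f).
Lemma mem_range f y : y ∈ range f <-> exists x, ⟨x, y⟩ ∈ f.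
Proof.
  unfold range; rewrite mem_sep by definability; split; [tauto|].
  intros [x Hxy]; split; [apply (opair_in_union2 Hxy)|eauto].
Qed.
Lemma definable_term_range t : termV t -> termV (fun e => range (t e)).
Proof. unfold range; definability. Qed.
Hint Resolve definable_term_range : definable.

Lemma range_graph a F : definable_fun F -> range (graph a F) = image a F.
Proof.
  intros HF; apply set_ext; intros y; rewrite mem_range, mem_image by exact HF.
  split; intros [x Hx]; exists x; [apply opair_in_graph in Hx|apply opair_in_graph]; auto.
Qed.

Lemma set_recursion (X : V) (h : V -> V) (Phi : V -> V -> Prop) :
  definable_fun h -> definable_relation Phi -> (forall x, x ∈ X -> ord mem (h x)) ->
  exists A, A ⊆ X /\ forall x, x ∈ X ->
    (x ∈ A <-> Phi (sep A (fun y => h y ∈ h x)) x).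
Proof.
  intros Hh HPhi ord_h.
  set (layer := rec (fun b f => sep X (fun x => h x = b /\ Phi (union (range f)) x))).
  assert (Hlayer : definable_fun layer) by (unfold layer; definability).
  assert (mem_layer : forall b x, ord mem b ->
    (x ∈ layer b <-> x ∈ X /\ h x = b /\ Phi (union (image b layer)) x)).
  { intros b x Ob; unfold layer at 1; rewrite rec_eq by (exact Ob || definability).
    rewrite range_graph by exact Hlayer; apply mem_sep; definability. }
  exists (sep X (fun x => x ∈ layer (h x))); split.
  { intros x Hx; apply mem_sep in Hx; [tauto|definability]. }
  intros x Hx; rewrite mem_sep, mem_layer by (auto || definability).
  replace (union (image (h x) layer))
    with (sep (sep X (fun y => y ∈ layer (h y))) (fun y => h y ∈ h x)); [tauto|].
  apply set_ext; intros y; rewrite !mem_sep, mem_union by definability; split.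
  - intros [[Hy Hly] Hlt]; exists (layer (h y)); rewrite mem_image by exact Hlayer; eauto.
  - intros (w & Hw & Hy); apply mem_image in Hw; [|exact Hlayer].
    destruct Hw as (b & Hb & ->); assert (Ob := ord_mem (ord_h x Hx) Hb).
    assert (Hy' := Hy); apply mem_layer in Hy'; [|exact Ob].
    destruct Hy' as (HyX & -> & _); auto.
Qed.

(** * The cumulative hierarchy *)

Definition Vlevel : V -> V :=
  rec (fun _ f => sep (powerset (union (range f))) (fun x => exists w, w ∈ range f /\ x ⊆ w)).
Lemma definable_term_Vlevel t : termV t -> termV (fun e => Vlevel (t e)).
Proof. unfold Vlevel; definability. Qed.
Hint Resolve definable_term_Vlevel : definable.

Lemma mem_Vlevel a x : ord mem a -> (x ∈ Vlevel a <-> exists c, c ∈ a /\ x ⊆ Vlevel c).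
Proof.
  intros Oa; assert (HV : definable_fun Vlevel) by definability.
  unfold Vlevel at 1; rewrite rec_eq by (exact Oa || definability).
  fold Vlevel; rewrite range_graph, mem_sep by (exact HV || definability); split.
  - intros (_ & w & Hw & Hx); apply mem_image in Hw; [|exact HV].
    destruct Hw as (c & Hc & ->); eauto.
  - intros (c & Hc & Hx).
    assert (Hw : Vlevel c ∈ image a Vlevel) by (apply mem_image; eauto).
    split; [|eauto]; apply mem_powerset; intros z Hz; apply mem_union; eauto.
Qed.

(* The body of is_Vlevel, with its witness f as an argument. *)
Definition is_hierarchy {W : Type} (m : W -> W -> Prop) (f v a : W) : Prop :=
  (forall b, ole m b a <-> exists u, gr m f b u) /\
  (forall b u u', gr m f b u -> gr m f b u' -> u = u') /\
  (forall b u, gr m f b u -> forall x,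
     m x u <-> exists c w, m c b /\ gr m f c w /\ sub m x w) /\
  gr m f a v.

Lemma is_hierarchy_graph a :
  ord mem a -> is_hierarchy mem (graph (succ a) Vlevel) (Vlevel a) a.
Proof.
  intros Oa.
  assert (Hf : forall b u, gr mem (graph (succ a) Vlevel) b u <->
    ole mem b a /\ u = Vlevel b).
  { intros b u; rewrite gr_iff, opair_in_graph, mem_succ by definability; reflexivity. }
  split; [|split; [|split]].
  - intros b; split; [intros Hb; exists (Vlevel b); apply Hf; auto|].
    intros [u Hu]; apply Hf in Hu; tauto.
  - intros b u u' Hu Hu'; apply Hf in Hu, Hu'; destruct Hu, Hu'; congruence.
  - intros b u Hu x; apply Hf in Hu; destruct Hu as [Hb ->].
    assert (Ob : ord mem b) by (destruct Hb; subst; eauto using ord_mem).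
    rewrite (mem_Vlevel x Ob); split.
    + intros (c & Hc & Hx); exists c, (Vlevel c); rewrite Hf; split; [exact Hc|].
      split; [|exact Hx]; split; [left; exact (mem_ole_trans Oa Hc Hb)|reflexivity].
    + intros (c & w & Hc & Hw & Hx); apply Hf in Hw; destruct Hw as [_ ->]; eauto.
  - apply Hf; split; [right|]; reflexivity.
Qed.

Lemma is_Vlevel_iff v a : is_Vlevel mem v a <-> ord mem a /\ v = Vlevel a.
Proof.
  split; [|intros [Oa ->]; split; [exact Oa|]; eexists; apply (is_hierarchy_graph Oa)].
  intros (Oa & f & dom_f & _ & step_f & Hv); split; [exact Oa|].
  assert (val_f : forall b, ord mem b -> forall u, gr mem f b u -> u = Vlevel b); [|auto].
  induct_with ord_ind; [definability|].
  intros b Ob IH u Hu; apply set_ext; intros x.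
  rewrite (step_f b u Hu x), (mem_Vlevel x Ob); split.
  - intros (c & w & Hc & Hw & Hx); rewrite (IH c Hc w Hw) in Hx; eauto.
  - intros (c & Hc & Hx).
    assert (Hca : ole mem c a)
      by (left; apply mem_ole_trans with b; auto; apply dom_f; eauto).
    apply dom_f in Hca; destruct Hca as [w Hw]; exists c, w.
    rewrite (IH c Hc w Hw); rewrite (IH c Hc w Hw) in Hw; auto.
Qed.

Lemma Vlevel_transitive a : ord mem a -> transitive mem (Vlevel a).
Proof.
  revert a; induct_with ord_ind; [definability|].
  intros a Oa IH x Hx y Hy; apply mem_Vlevel in Hx; auto; destruct Hx as (c & Hc & Hx).
  apply (mem_Vlevel _ Oa); exists c; split; auto; apply (IH c Hc), Hx, Hy.
Qed.
Lemma Vlevel_mem a x y : ord mem a -> x ∈ Vlevel a -> y ∈ x -> y ∈ Vlevel a.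
Proof. intros Oa Hx; exact (Vlevel_transitive Oa Hx (z := y)). Qed.
Lemma Vlevel_sub a x y : ord mem a -> x ∈ Vlevel a -> y ⊆ x -> y ∈ Vlevel a.
Proof.
  intros Oa Hx Hy; rewrite mem_Vlevel in * by exact Oa; destruct Hx as (c & Hc & Hx).
  exists c; split; [exact Hc|exact (sub_trans Hy Hx)].
Qed.
Lemma Vlevel_mono a b : ord mem b -> a ∈ b -> Vlevel a ⊆ Vlevel b.
Proof.
  intros Ob Ha x Hx; rewrite mem_Vlevel in * by eauto using ord_mem.
  destruct Hx as (c & Hc & Hx); exists c; split; [exact (ord_mem_trans Ob Hc Ha)|exact Hx].
Qed.
Lemma Vlevel_in_Vlevel a b : ord mem b -> a ∈ b -> Vlevel a ∈ Vlevel b.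
Proof. intros Ob Ha; apply (mem_Vlevel _ Ob); eauto using sub_refl. Qed.

Lemma ord_in_Vlevel a b : ord mem a -> ord mem b -> (b ∈ Vlevel a <-> b ∈ a).
Proof.
  intros Oa; revert b; revert a Oa.
  induct_with ord_ind; [definability|].
  intros a Oa IH b Ob; rewrite (mem_Vlevel _ Oa); split.
  - intros (c & Hc & Hb); apply ole_mem_trans with c; auto.
    apply ord_sub_iff_ole; eauto using ord_mem.
    intros z Hz; apply (IH c Hc); eauto using ord_mem.
  - intros Hb; exists b; split; auto; intros z Hz; apply (IH b Hb); eauto using ord_mem.
Qed.

Lemma transitive_superset x : exists t, transitive mem t /\ x ⊆ t.
Proof.
  set (F := rec (fun _ f => cup x (union (union (range f))))).
  assert (HF : definable_fun F) by (unfold F; definability).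
  assert (F_eq : forall n, ord mem n -> F n = cup x (union (union (image n F)))).
  { intros n On; unfold F at 1; rewrite rec_eq by (exact On || definability).
    fold F; rewrite range_graph by exact HF; reflexivity. }
  exists (union (image omega F)); split.
  - intros y Hy z Hz; apply mem_union in Hy; destruct Hy as (w & Hw & Hy).
    apply mem_image in Hw; [|exact HF]; destruct Hw as (n & Hn & ->).
    apply mem_union; exists (F (succ n)); split;
      [apply mem_image; eauto using succ_in_omega|].
    rewrite F_eq by eauto using ord_succ, ord_nat.
    apply mem_cup; right; apply mem_union; exists y; split; [|exact Hz].
    apply mem_union; exists (F n); split; [apply mem_image; eauto using mem_succ_self|exact Hy].
  - intros z Hz; apply mem_union; exists (F empty); split.
    + apply mem_image; eauto using empty_in_omega.
    + rewrite F_eq by apply ord_empty; apply mem_cup; auto.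
Qed.

Lemma mem_ind P : definable_pred P ->
  (forall x, (forall y, y ∈ x -> P y) -> P x) -> forall x, P x.
Proof.
  intros HP IH x; apply NNPP; intros Nx.
  destruct (transitive_superset (upair x x)) as (t & Tt & Ht).
  destruct (@foundation (fun y => ~ P y) t) as (y & Hy & Ny & Hmin); [definability| |].
  - exists x; split; auto; apply Ht, upair_l.
  - apply Ny, IH; intros z Hz; apply NNPP; intros Nz; apply (Hmin z); auto.
    exact (Tt y Hy z Hz).
Qed.

Lemma tc_exists x : exists t, is_tc mem t x.
Proof.
  destruct (transitive_superset x) as (t & Tt & Ht).
  set (in_all := fun z => forall u, transitive mem u -> x ⊆ u -> z ∈ u).
  assert (mem_tc : forall z, z ∈ sep t in_all <-> z ∈ t /\ in_all z)
    by (intros z; apply mem_sep; unfold in_all; definability).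
  exists (sep t in_all); split; [|split].
  - intros y Hy z Hz; apply mem_tc in Hy; destruct Hy as [Hy all_y].
    apply mem_tc; split; [exact (Tt y Hy z Hz)|].
    intros u Tu Hu; exact (Tu y (all_y u Tu Hu) z Hz).
  - intros z Hz; apply mem_tc; split; auto; intros u _ Hu; auto.
  - intros u Tu Hu z Hz; apply mem_tc in Hz; destruct Hz as [_ all_z]; auto.
Qed.

Definition is_rank (x a : V) : Prop :=
  ord mem a /\ x ⊆ Vlevel a /\ forall b, b ∈ a -> ~ x ⊆ Vlevel b.
Definition rank (x : V) : V := the (is_rank x).

Lemma is_rank_unique x a b : is_rank x a -> is_rank x b -> a = b.
Proof.
  intros (Oa & Ha & min_a) (Ob & Hb & min_b).
  destruct (ord_trichotomy Oa Ob) as [Hab|[|Hba]]; auto;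
    [destruct (min_b a Hab Ha)|destruct (min_a b Hba Hb)].
Qed.
Lemma is_rank_of_sub x a : ord mem a -> x ⊆ Vlevel a -> exists b, is_rank x b.
Proof.
  intros Oa Ha; destruct (@ord_least (fun a => x ⊆ Vlevel a) a) as (b & Ob & _ & Hb & Nb);
    [definability|auto..|].
  exists b; split; auto.
Qed.
Lemma sub_Vlevel_exists x : exists a, ord mem a /\ x ⊆ Vlevel a.
Proof.
  revert x; induct_with mem_ind; [definability|].
  intros x IH.
  destruct (@replacement is_rank x) as [A mem_A]; [unfold is_rank; definability| |].
  { intros y a b _; apply is_rank_unique. }
  destruct (@ord_bound A) as (b & Ob & Hb).
  { intros a Ha; apply mem_A in Ha; destruct Ha as (y & _ & Ha); apply Ha. }
  exists b; split; [exact Ob|]; intros y Hy; destruct (IH y Hy) as (a & Oa & Ha).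
  destruct (is_rank_of_sub Oa Ha) as [c Hc]; apply (mem_Vlevel _ Ob).
  exists c; split; [apply Hb, mem_A; eauto|apply Hc].
Qed.

Lemma is_rank_rank x : is_rank x (rank x).
Proof.
  apply (the_spec (P := is_rank x)); destruct (sub_Vlevel_exists x) as (a & Oa & Ha).
  exact (is_rank_of_sub Oa Ha).
Qed.
Lemma eq_rank_iff x a : a = rank x <-> is_rank x a.
Proof.
  split; [intros ->; apply is_rank_rank|].
  intros Ha; exact (is_rank_unique Ha (is_rank_rank x)).
Qed.
Lemma definable_term_rank t : termV t -> termV (fun e => rank (t e)).
Proof.
  apply (@definable_fun_app rank).
  apply (@definable_term_of_graph (fun e => rank (e 0)) (fun a e => is_rank (e 0) a)).
  - intros; apply eq_rank_iff.
  - unfold is_rank; definability.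
Qed.
Hint Resolve definable_term_rank : definable.

Lemma ord_rank x : ord mem (rank x).
Proof. apply is_rank_rank. Qed.
Lemma sub_Vlevel_rank x : x ⊆ Vlevel (rank x).
Proof. apply is_rank_rank. Qed.
Lemma in_Vlevel_iff_rank x a : ord mem a -> (x ∈ Vlevel a <-> rank x ∈ a).
Proof.
  intros Oa; rewrite (mem_Vlevel _ Oa); split; [|eauto using sub_Vlevel_rank].
  intros (c & Hc & Hx); destruct (is_rank_rank x) as (Or & _ & least).
  destruct (ord_mem_or_ole (ord_mem Oa Hc) Or) as [Hlt|Hle]; [destruct (least c Hlt Hx)|].
  exact (ole_mem_trans Oa Hle Hc).
Qed.
Lemma rank_mem x y : y ∈ x -> rank y ∈ rank x.
Proof. intros Hy; apply (in_Vlevel_iff_rank y (ord_rank x)), sub_Vlevel_rank, Hy. Qed.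
Lemma in_Vlevel_succ_rank x : x ∈ Vlevel (succ (rank x)).
Proof. apply in_Vlevel_iff_rank; eauto using ord_succ, ord_rank, mem_succ_self. Qed.
Lemma rank_ord a : ord mem a -> rank a = a.
Proof.
  intros Oa; symmetry; apply eq_rank_iff; split; [exact Oa|]; split.
  - intros z Hz; apply ord_in_Vlevel; eauto using ord_mem.
  - intros b Hb Hsub; assert (Ob := ord_mem Oa Hb); apply (@mem_irrefl b).
    apply (ord_in_Vlevel Ob Ob), Hsub, Hb.
Qed.
Lemma rank_opair_l x y : rank x ∈ rank ⟨x, y⟩.
Proof.
  apply ord_mem_trans with (rank (upair x y)); auto using ord_rank;
    apply rank_mem; auto using upair_l; apply upair_r.
Qed.
Lemma rank_opair_r x y : rank y ∈ rank ⟨x, y⟩.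
Proof.
  apply ord_mem_trans with (rank (upair x y)); auto using ord_rank;
    apply rank_mem, upair_r.
Qed.

Lemma rank_ind P : definable_pred P ->
  (forall x, (forall y, rank y ∈ rank x -> P y) -> P x) -> forall x, P x.
Proof.
  intros HP IH.
  assert (by_rank : forall r, ord mem r -> forall x, rank x = r -> P x).
  { induct_with ord_ind; [definability|].
    intros r Or IHr x <-; apply IH; intros y Hy; exact (IHr _ Hy y eq_refl). }
  intros x; exact (by_rank _ (ord_rank x) x eq_refl).
Qed.

Section LimitLevel.

Context (lam : V) (limit_lam : limit mem lam).
Let ord_lam : ord mem lam := proj1 limit_lam.

Lemma Vlevel_powerset x : x ∈ Vlevel lam -> powerset x ∈ Vlevel lam.
Proof.
  intros Hx; apply (mem_Vlevel _ ord_lam) in Hx; destruct Hx as (c & Hc & Hx).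
  apply (mem_Vlevel _ ord_lam); exists (succ c); split; [apply limit_succ; auto|].
  intros z Hz; apply mem_powerset in Hz; apply mem_Vlevel; eauto using ord_succ, ord_mem.
  exists c; split; [apply mem_succ_self|exact (sub_trans Hz Hx)].
Qed.
Lemma Vlevel_upair x y : x ∈ Vlevel lam -> y ∈ Vlevel lam -> upair x y ∈ Vlevel lam.
Proof.
  intros Hx Hy; apply (in_Vlevel_iff_rank _ ord_lam) in Hx, Hy.
  assert (exists c, c ∈ lam /\ rank x ∈ c /\ rank y ∈ c) as (c & Hc & Hxc & Hyc).
  { destruct (ord_mem_or_ole (ord_rank x) (ord_rank y)) as [Hlt|Hle].
    - exists (succ (rank y)); split; [apply limit_succ; auto|]; rewrite !mem_succ; auto.
    - exists (succ (rank x)); split; [apply limit_succ; auto|]; rewrite !mem_succ.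
      destruct Hle; auto. }
  apply (mem_Vlevel _ ord_lam); exists c; split; auto; intros z Hz; apply mem_upair in Hz.
  destruct Hz as [-> | ->]; apply in_Vlevel_iff_rank; eauto using ord_mem.
Qed.
Lemma Vlevel_opair x y : x ∈ Vlevel lam -> y ∈ Vlevel lam -> ⟨x, y⟩ ∈ Vlevel lam.
Proof. unfold opair; auto using Vlevel_upair. Qed.
Lemma Vlevel_union x : x ∈ Vlevel lam -> union x ∈ Vlevel lam.
Proof.
  intros Hx; apply (mem_Vlevel _ ord_lam) in Hx; destruct Hx as (c & Hc & Hx).
  apply (mem_Vlevel _ ord_lam); exists c; split; auto; intros z Hz.
  apply mem_union in Hz; destruct Hz as (y & Hy & Hz).
  exact (Vlevel_mem (ord_mem ord_lam Hc) (Hx y Hy) Hz).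
Qed.
Lemma Vlevel_cup x y : x ∈ Vlevel lam -> y ∈ Vlevel lam -> cup x y ∈ Vlevel lam.
Proof. unfold cup; auto using Vlevel_union, Vlevel_upair. Qed.
Lemma Vlevel_succ x : x ∈ Vlevel lam -> succ x ∈ Vlevel lam.
Proof. unfold succ; auto using Vlevel_cup, Vlevel_upair. Qed.
Lemma Vlevel_empty : empty ∈ Vlevel lam.
Proof. apply (ord_in_Vlevel ord_lam ord_empty), limit_empty_mem, limit_lam. Qed.
Lemma Vlevel_opair_inv x y : ⟨x, y⟩ ∈ Vlevel lam -> x ∈ Vlevel lam /\ y ∈ Vlevel lam.
Proof.
  intros Hxy; assert (Hu := Vlevel_mem ord_lam Hxy (upair_r _ _)).
  split; apply (Vlevel_mem ord_lam Hu); auto using upair_l, upair_r.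
Qed.

End LimitLevel.

(** * Functions and cardinality *)

Definition cart (a b : V) : V :=
  sep (powerset (powerset (cup a b))) (fun p => exists x y, x ∈ a /\ y ∈ b /\ p = ⟨x, y⟩).
Lemma mem_cart a b p : p ∈ cart a b <-> exists x y, x ∈ a /\ y ∈ b /\ p = ⟨x, y⟩.
Proof.
  unfold cart; rewrite mem_sep by definability; split; [tauto|].
  intros (x & y & Hx & Hy & ->); split; [|eauto 6].
  apply mem_powerset; intros u Hu; apply mem_powerset; intros z Hz; apply mem_cup.
  apply mem_upair in Hu; destruct Hu as [-> | ->]; apply mem_upair in Hz;
    destruct Hz as [-> | ->]; auto.
Qed.
Lemma definable_term_cart t u : termV t -> termV u -> termV (fun e => cart (t e) (u e)).
Proof. unfold cart; definability. Qed.
Hint Resolve definable_term_cart : definable.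
Lemma opair_in_cart a b x y : ⟨x, y⟩ ∈ cart a b <-> x ∈ a /\ y ∈ b.
Proof.
  rewrite mem_cart; split; [|intros []; eauto 6].
  intros (x' & y' & Hx & Hy & E); opair_injection; subst; auto.
Qed.
Lemma cart_sub a b : cart a b ⊆ powerset (powerset (cup a b)).
Proof. intros p Hp; apply mem_sep in Hp; [tauto|definability]. Qed.

Lemma is_pfun_iff f a b : is_pfun mem f a b <->
  f ⊆ cart a b /\ forall x y y', ⟨x, y⟩ ∈ f -> ⟨x, y'⟩ ∈ f -> y = y'.
Proof.
  unfold is_pfun; split; intros [Hcart functional]; split.
  - intros p Hp; apply mem_cart; destruct (Hcart p Hp) as (x & y & Hx & Hy & Hxy).
    apply is_pair_iff in Hxy; eauto 6.
  - intros x y y' Hy Hy'; apply (functional x); apply gr_iff; auto.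
  - intros p Hp; apply Hcart, mem_cart in Hp; destruct Hp as (x & y & Hx & Hy & ->).
    exists x, y; rewrite is_pair_iff; auto.
  - intros x y y' Hy Hy'; apply (functional x); apply gr_iff; auto.
Qed.
Lemma is_fun_iff f a b : is_fun mem f a b <-> f ⊆ cart a b /\
  (forall x y y', ⟨x, y⟩ ∈ f -> ⟨x, y'⟩ ∈ f -> y = y') /\
  forall x, x ∈ a -> exists y, ⟨x, y⟩ ∈ f.
Proof.
  unfold is_fun; rewrite is_pfun_iff, and_assoc; do 2 apply and_iff_compat_l.
  split; intros total x Hx; destruct (total x Hx) as [y Hy]; exists y; apply gr_iff; auto.
Qed.

Lemma pfun_sub_cart f a b : is_pfun mem f a b -> f ⊆ cart a b.
Proof. intros Hf; apply is_pfun_iff, Hf. Qed.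
Lemma pfun_opair f a b x y : is_pfun mem f a b -> ⟨x, y⟩ ∈ f -> x ∈ a /\ y ∈ b.
Proof. intros Hf Hxy; apply opair_in_cart, (pfun_sub_cart Hf), Hxy. Qed.
Lemma pfun_functional f a b x y y' :
  is_pfun mem f a b -> ⟨x, y⟩ ∈ f -> ⟨x, y'⟩ ∈ f -> y = y'.
Proof. intros Hf; apply is_pfun_iff in Hf; apply Hf. Qed.
Lemma fun_total f a b x : is_fun mem f a b -> x ∈ a -> exists y, y ∈ b /\ ⟨x, y⟩ ∈ f.
Proof.
  intros [Hf total] Hx; destruct (total x Hx) as [y Hy]; apply gr_iff in Hy.
  exists y; split; [apply (pfun_opair Hf Hy)|exact Hy].
Qed.
Lemma inj_injective f a b x x' y :
  is_inj mem f a b -> ⟨x, y⟩ ∈ f -> ⟨x', y⟩ ∈ f -> x = x'.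
Proof. intros [_ injective] Hx Hx'; apply (injective x x' y); apply gr_iff; auto. Qed.

Lemma relation_exists a b R : definable_relation R ->
  exists f, f ⊆ cart a b /\ forall x y, ⟨x, y⟩ ∈ f <-> x ∈ a /\ y ∈ b /\ R x y.
Proof.
  intros HR; exists (sep (cart a b) (fun p => exists x y, p = ⟨x, y⟩ /\ R x y)).
  split; [intros p Hp; apply mem_sep in Hp; [tauto|definability]|].
  intros x y; rewrite mem_sep, opair_in_cart by definability; split.
  - intros [[Hx Hy] (x' & y' & E & Hxy)]; opair_injection; subst; auto.
  - intros (Hx & Hy & Hxy); eauto 6.
Qed.
Lemma fun_exists a b R : definable_relation R ->
  (forall x, x ∈ a -> exists y, y ∈ b /\ R x y) ->
  (forall x y y', x ∈ a -> R x y -> R x y' -> y = y') ->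
  exists f, is_fun mem f a b /\ forall x y, ⟨x, y⟩ ∈ f <-> x ∈ a /\ y ∈ b /\ R x y.
Proof.
  intros HR total functional; destruct (relation_exists a b HR) as (f & Hcart & mem_f).
  exists f; split; [|exact mem_f]; apply is_fun_iff; split; [exact Hcart|split].
  - intros x y y' Hy Hy'; apply mem_f in Hy, Hy'; apply (functional x); tauto.
  - intros x Hx; destruct (total x Hx) as (y & Hy & Hxy); exists y; apply mem_f; auto.
Qed.
Lemma choice_fun a b R : definable_relation R ->
  (forall x, x ∈ a -> exists y, y ∈ b /\ R x y) ->
  exists f, is_fun mem f a b /\ forall x y, ⟨x, y⟩ ∈ f -> R x y.
Proof.
  intros HR total.
  set (J := fun x => sep (cart (upair x x) b) (fun p => exists y, p = ⟨x, y⟩ /\ R x y)).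
  assert (HJ : definable_fun J) by (unfold J; definability).
  assert (mem_J : forall x p, p ∈ J x <-> exists y, y ∈ b /\ R x y /\ p = ⟨x, y⟩).
  { intros x p; unfold J; rewrite mem_sep by definability; split.
    - intros (Hp & y & -> & Hxy); apply opair_in_cart in Hp; destruct Hp; eauto.
    - intros (y & Hy & Hxy & ->); rewrite opair_in_cart; eauto using upair_l. }
  destruct (zfc_choice hZFC (a := image a J)) as [c Hc].
  { intros z Hz; apply mem_image in Hz; [|exact HJ]; destruct Hz as (x & Hx & ->).
    destruct (total x Hx) as (y & Hy & Hxy); exists ⟨x, y⟩; apply mem_J; eauto. }
  { intros z z' p Hz Hz' Hp Hp'; apply mem_image in Hz, Hz'; auto.
    destruct Hz as (x & Hx & ->), Hz' as (x' & Hx' & ->); apply mem_J in Hp, Hp'.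
    destruct Hp as (y & _ & _ & ->), Hp' as (y' & _ & _ & E); opair_injection; subst; auto. }
  assert (chosen : forall x, x ∈ a -> exists y, y ∈ b /\ R x y /\ ⟨x, y⟩ ∈ c /\
    forall y', R x y' -> y' ∈ b -> ⟨x, y'⟩ ∈ c -> y' = y).
  { intros x Hx; destruct (Hc (J x)) as (p & [Hpc Hp] & unique); [apply mem_image; eauto|].
    apply mem_J in Hp; destruct Hp as (y & Hy & Hxy & ->); exists y; repeat split; auto.
    intros y' Hxy' Hy' Hc'; assert (E : ⟨x, y'⟩ = ⟨x, y⟩); [|opair_injection; auto].
    apply unique; split; [exact Hc'|apply mem_J; eauto]. }
  destruct (@fun_exists a b (fun x y => R x y /\ y ∈ b /\ ⟨x, y⟩ ∈ c)) as (f & Hf & mem_f).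
  - definability.
  - intros x Hx; destruct (chosen x Hx) as (y & Hy & Hxy & Hyc & _); eauto.
  - intros x y y' Hx (Hxy & Hy & Hyc) (Hxy' & Hy' & Hyc').
    destruct (chosen x Hx) as (z & _ & _ & _ & unique).
    rewrite (unique y), (unique y'); auto.
  - exists f; split; [exact Hf|]; intros x y Hxy; apply mem_f in Hxy; tauto.
Qed.

Lemma injects_by a b R : definable_relation R ->
  (forall x, x ∈ a -> exists y, y ∈ b /\ R x y) ->
  (forall x y y', x ∈ a -> R x y -> R x y' -> y = y') ->
  (forall x x' y, x ∈ a -> x' ∈ a -> R x y -> R x' y -> x = x') -> injects mem a b.
Proof.
  intros HR total functional injective.
  destruct (fun_exists HR total functional) as (f & Hf & mem_f).
  exists f; split; [exact Hf|]; intros x x' y Hx Hx'; rewrite gr_iff, mem_f in Hx, Hx'.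
  apply (injective x x' y); tauto.
Qed.
Lemma injects_sub a b : a ⊆ b -> injects mem a b.
Proof.
  intros Hab; apply (@injects_by a b (fun x y => x = y)); [definability| | |];
    try congruence; eauto.
Qed.
Lemma injects_trans a b c : injects mem a b -> injects mem b c -> injects mem a c.
Proof.
  intros [f inj_f] [g inj_g]; assert (Hf := proj1 inj_f); assert (Hg := proj1 inj_g).
  apply (@injects_by a c (fun x z => exists y, ⟨x, y⟩ ∈ f /\ ⟨y, z⟩ ∈ g)); [definability| | |].
  - intros x Hx; destruct (fun_total Hf Hx) as (y & Hy & Hxy).
    destruct (fun_total Hg Hy) as (z & Hz & Hyz); eauto.
  - intros x z z' _ (y & Hxy & Hyz) (y' & Hxy' & Hyz').
    rewrite (pfun_functional (proj1 Hf) Hxy' Hxy) in Hyz'.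
    exact (pfun_functional (proj1 Hg) Hyz Hyz').
  - intros x x' z _ _ (y & Hxy & Hyz) (y' & Hxy' & Hyz').
    rewrite (inj_injective inj_g Hyz' Hyz) in Hxy'; exact (inj_injective inj_f Hxy Hxy').
Qed.
Lemma injects_powerset a b : injects mem a b -> injects mem (powerset a) (powerset b).
Proof.
  intros [f inj_f]; assert (Hf := proj1 inj_f).
  set (direct_image := fun X Y => forall y, y ∈ Y <-> exists x, x ∈ X /\ ⟨x, y⟩ ∈ f).
  apply (@injects_by _ _ direct_image); [unfold direct_image; definability| | |].
  - intros X HX; exists (sep b (fun y => exists x, x ∈ X /\ ⟨x, y⟩ ∈ f)); split.
    + apply mem_powerset; intros y Hy; apply mem_sep in Hy; [tauto|definability].
    + intros y; rewrite mem_sep by definability; split; [tauto|].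
      intros (x & Hx & Hxy); split; [apply (pfun_opair (proj1 Hf) Hxy)|eauto].
  - intros X Y Y' _ HY HY'; apply set_ext; intros y; rewrite (HY y), (HY' y); reflexivity.
  - assert (Hsub : forall X X' Y, X ∈ powerset a ->
      direct_image X Y -> direct_image X' Y -> X ⊆ X').
    { intros X X' Y HX HY HY' x Hx; rewrite mem_powerset in HX.
      destruct (fun_total Hf (HX x Hx)) as (y & _ & Hxy).
      destruct (proj1 (HY' y) (proj2 (HY y) (ex_intro _ x (conj Hx Hxy)))) as (x' & Hx' & Hxy').
      rewrite (inj_injective inj_f Hxy Hxy'); exact Hx'. }
    intros X X' Y HX HX' HY HY'; apply set_ext; intros z; split;
      [apply (Hsub X X' Y)|apply (Hsub X' X Y)]; auto.
Qed.
Lemma injects_union b mu F : ord mem b -> definable_fun F ->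
  (forall c, c ∈ b -> injects mem (F c) mu) ->
  injects mem (union (image b F)) (cart b mu).
Proof.
  intros Ob HF Hinj.
  destruct (@choice_fun b (powerset (cart (union (image b F)) mu))
    (fun c g => is_inj mem g (F c) mu)) as (ch & Hch & inj_ch); [definability| |].
  { intros c Hc; destruct (Hinj c Hc) as [g Hg]; exists g; split; [|exact Hg].
    apply mem_powerset; intros p Hp; apply (pfun_sub_cart (proj1 (proj1 Hg))) in Hp.
    rewrite mem_cart in *; destruct Hp as (x & y & Hx & Hy & ->).
    exists x, y; repeat split; auto; apply mem_union; exists (F c); split; [|exact Hx].
    apply mem_image; eauto. }
  set (first := fun x c => c ∈ b /\ x ∈ F c /\ forall c', c' ∈ c -> ~ x ∈ F c').
  assert (first_unique : forall x c c', first x c -> first x c' -> c = c').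
  { intros x c c' (Hc & Hx & least) (Hc' & Hx' & least').
    destruct (ord_trichotomy (ord_mem Ob Hc) (ord_mem Ob Hc')) as [Hlt|[|Hlt]]; auto;
      [destruct (least' c Hlt Hx)|destruct (least c' Hlt Hx')]. }
  apply (@injects_by _ _ (fun x p => exists c g y,
    first x c /\ ⟨c, g⟩ ∈ ch /\ ⟨x, y⟩ ∈ g /\ p = ⟨c, y⟩)); [unfold first; definability| | |].
  - intros x Hx; apply mem_union in Hx; destruct Hx as (w & Hw & Hx).
    apply mem_image in Hw; [|exact HF]; destruct Hw as (c0 & Hc0 & ->).
    destruct (@ord_least (fun c => x ∈ F c) c0) as (c & Oc & Hle & Hxc & least);
      [definability|eauto using ord_mem|exact Hx|].
    assert (Hc := ole_mem_trans Ob Hle Hc0).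
    destruct (fun_total Hch Hc) as (g & _ & Hg).
    destruct (fun_total (proj1 (inj_ch c g Hg)) Hxc) as (y & Hy & Hxy).
    exists ⟨c, y⟩; rewrite opair_in_cart; split; [auto|]; exists c, g, y; unfold first; auto.
  - intros x p p' _ (c & g & y & Hc & Hg & Hxy & ->) (c' & g' & y' & Hc' & Hg' & Hxy' & ->).
    rewrite (first_unique x c' c Hc' Hc) in *.
    rewrite (pfun_functional (proj1 Hch) Hg' Hg) in Hxy'.
    rewrite (pfun_functional (proj1 (proj1 (inj_ch c g Hg))) Hxy Hxy'); reflexivity.
  - intros x x' p _ _ (c & g & y & Hc & Hg & Hxy & ->) (c' & g' & y' & Hc' & Hg' & Hxy' & E).
    opair_injection; subst c' y'; rewrite (pfun_functional (proj1 Hch) Hg' Hg) in Hxy'.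
    exact (inj_injective (inj_ch c g Hg) Hxy Hxy').
Qed.

(** * Inaccessible levels *)

Section Inaccessible.

Context (k : V) (inacc_k : inaccessible mem k).

Lemma inacc_ord : ord mem k.
Proof. apply inacc_k. Qed.
Lemma inacc_limit : limit mem k.
Proof. apply inacc_k. Qed.
Lemma inacc_omega : omega ∈ k.
Proof.
  destruct inacc_k as (_ & (w & Hw & Hwk) & _); apply is_omega_iff in Hw; subst; auto.
Qed.

Lemma inacc_bound b R : b ∈ k -> definable_relation R ->
  (forall c, c ∈ b -> exists n, n ∈ k /\ R c n) ->
  exists mu, mu ∈ k /\ forall c, c ∈ b -> exists n, n ∈ mu /\ R c n.
Proof.
  intros Hb HR Hn; destruct (choice_fun HR Hn) as (f & Hf & R_f).
  destruct inacc_k as (_ & _ & [_ regular_k] & _).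
  destruct (regular_k b f Hb Hf) as (mu & Hmu & Hbd).
  exists mu; split; [exact Hmu|]; intros c Hc; destruct (fun_total Hf Hc) as (n & _ & Hcn).
  exists n; split; [apply (Hbd c), gr_iff|]; auto.
Qed.

Lemma card_lt_injects a b : injects mem a b -> card_lt mem b k -> card_lt mem a k.
Proof. intros Hab (c & Hc & Hbc); exists c; eauto using injects_trans. Qed.
Lemma card_lt_powerset a : card_lt mem a k -> card_lt mem (powerset a) k.
Proof.
  intros (b & Hb & Hab); apply card_lt_injects with (powerset b);
    [apply injects_powerset, Hab|].
  destruct inacc_k as (_ & _ & _ & strong); apply (strong b); auto.
  apply is_pow_iff; reflexivity.
Qed.
Lemma card_lt_cart a b : a ∈ k -> b ∈ k -> card_lt mem (cart a b) k.
Proof.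
  intros Ha Hb; apply card_lt_injects with (powerset (powerset (cup a b)));
    [apply injects_sub, cart_sub|].
  apply card_lt_powerset, card_lt_powerset; exists (cup a b).
  split; [|apply injects_sub, sub_refl].
  destruct (ord_cup (ord_mem inacc_ord Ha) (ord_mem inacc_ord Hb)) as [-> | ->]; auto.
Qed.

Lemma card_lt_Vlevel b : b ∈ k -> card_lt mem (Vlevel b) k.
Proof.
  intros Hb; assert (Ob := ord_mem inacc_ord Hb); revert b Ob Hb.
  induct_with ord_ind; [definability|].
  intros b Ob IH Hb; assert (HF : definable_fun (fun c => powerset (Vlevel c))) by definability.
  destruct (@inacc_bound b (fun c n => injects mem (powerset (Vlevel c)) n))
    as (mu & Hmu & Hbd); [exact Hb|definability| |].
  { intros c Hc; apply card_lt_powerset, IH; auto; exact (ord_mem_trans inacc_ord Hc Hb). }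
  apply card_lt_injects with (union (image b (fun c => powerset (Vlevel c)))).
  - apply injects_sub; intros x Hx; apply (mem_Vlevel _ Ob) in Hx; destruct Hx as (c & Hc & Hx).
    apply mem_union; exists (powerset (Vlevel c)).
    rewrite mem_image, mem_powerset by exact HF; eauto.
  - apply card_lt_injects with (cart b mu); [|apply card_lt_cart; auto].
    apply injects_union; auto; intros c Hc; destruct (Hbd c Hc) as (n & Hn & Hinj).
    apply injects_trans with n; [exact Hinj|].
    apply injects_sub; intros z Hz; exact (ord_mem_trans (ord_mem inacc_ord Hmu) Hz Hn).
Qed.

Lemma card_lt_sub_Vlevel x : x ⊆ Vlevel k -> card_lt mem x k -> x ∈ Vlevel k.
Proof.
  intros Hx (mu & Hmu & f & inj_f).
  destruct (@inacc_bound mu (fun i r => forall z, ⟨z, i⟩ ∈ f -> rank z = r))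
    as (b & Hb & Hbd); [exact Hmu|definability| |].
  { intros i Hi; destruct (classic (exists z, ⟨z, i⟩ ∈ f)) as [[z Hz]|N].
    - exists (rank z); split.
      + apply (in_Vlevel_iff_rank z inacc_ord), Hx, (pfun_opair (proj1 (proj1 inj_f)) Hz).
      + intros z' Hz'; rewrite (inj_injective inj_f Hz Hz'); reflexivity.
    - exists empty; split; [apply limit_empty_mem, inacc_limit|].
      intros z Hz; destruct N; eauto. }
  apply (mem_Vlevel _ inacc_ord); exists b; split; [exact Hb|]; intros z Hz.
  destruct (fun_total (proj1 inj_f) Hz) as (i & Hi & Hzi).
  destruct (Hbd i Hi) as (r & Hr & E); apply (in_Vlevel_iff_rank _ (ord_mem inacc_ord Hb)).
  rewrite (E z Hzi); exact Hr.
Qed.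

Lemma in_Vlevel_iff_card_tc x :
  x ∈ Vlevel k <-> exists t, is_tc mem t x /\ card_lt mem t k.
Proof.
  split.
  - intros Hx; destruct (tc_exists x) as [t Ht]; exists t; split; auto.
    apply (mem_Vlevel _ inacc_ord) in Hx; destruct Hx as (c & Hc & Hx).
    apply card_lt_injects with (Vlevel c); [|apply card_lt_Vlevel; auto].
    apply injects_sub, Ht; auto; apply Vlevel_transitive, (ord_mem inacc_ord Hc).
  - intros (t & (Tt & Hxt & _) & card_t).
    assert (sub_in_level : forall y, y ⊆ t -> y ⊆ Vlevel k -> y ∈ Vlevel k).
    { intros y Hyt Hy; apply card_lt_sub_Vlevel; auto.
      apply card_lt_injects with t; auto; apply injects_sub, Hyt. }
    assert (t_sub : forall y, y ∈ t -> y ∈ Vlevel k).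
    { induct_with mem_ind; [definability|].
      intros y IH Hy; apply sub_in_level; [exact (Tt y Hy)|].
      intros z Hz; apply IH; auto; exact (Tt y Hy z Hz). }
    apply sub_in_level; auto; intros z Hz; auto.
Qed.

Lemma is_H_iff h : is_H mem h k <-> h = Vlevel k.
Proof.
  split; [|intros -> x; apply in_Vlevel_iff_card_tc].
  intros Hh; apply set_ext; intros x; rewrite in_Vlevel_iff_card_tc; apply Hh.
Qed.

End Inaccessible.

(** * Internal syntax and satisfaction *)

Create HintDb fml.

Fixpoint num (n : nat) : V := match n with O => empty | S k => succ (num k) end.
Lemma is_num_iff n x : is_num mem n x <-> x = num n.
Proof.
  revert x; induction n as [|n IH]; intros x; simpl; [apply is_empty_iff|].
  split.
  - intros (y & Hy & Hx); apply IH in Hy; apply is_succ_iff in Hx; subst; reflexivity.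
  - intros ->; exists (num n); rewrite IH, is_succ_iff; auto.
Qed.
Lemma num_in_omega n : num n ∈ omega.
Proof. induction n; simpl; auto using empty_in_omega, succ_in_omega. Qed.
Lemma num_inj i j : num i = num j -> i = j.
Proof.
  revert j; induction i as [|i IH]; intros [|j]; simpl; intros E; auto.
  - destruct (succ_neq_empty (eq_sym E)).
  - destruct (succ_neq_empty E).
  - f_equal; apply IH, succ_inj, E.
Qed.

Definition cMem (i j : V) : V := ⟨num 0, ⟨i, j⟩⟩.
Definition cEq (i j : V) : V := ⟨num 1, ⟨i, j⟩⟩.
Definition cFun (i j : V) : V := ⟨num 2, ⟨i, j⟩⟩.
Definition cNeg (f : V) : V := ⟨num 3, f⟩.
Definition cAnd (f g : V) : V := ⟨num 4, ⟨f, g⟩⟩.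
Definition cEx (f : V) : V := ⟨num 5, f⟩.

Lemma code1_iff n p x : code1 mem n p x <-> p = ⟨num n, x⟩.
Proof.
  unfold code1; split.
  - intros (t & Ht & Hp); apply is_num_iff in Ht; apply is_pair_iff in Hp; subst; auto.
  - intros ->; exists (num n); rewrite is_num_iff, is_pair_iff; auto.
Qed.
Lemma code2_iff n p x y : code2 mem n p x y <-> p = ⟨num n, ⟨x, y⟩⟩.
Proof.
  unfold code2; split.
  - intros (q & Hq & Hp); apply is_pair_iff in Hq; apply code1_iff in Hp; subst; auto.
  - intros ->; exists ⟨x, y⟩; rewrite is_pair_iff, code1_iff; auto.
Qed.

Section DefinableConnectives.

Context (t u : (nat -> V) -> V) (Ht : termV t) (Hu : termV u).

Lemma definable_term_cMem : termV (fun e => cMem (t e) (u e)).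
Proof. unfold cMem; definability. Qed.
Lemma definable_term_cEq : termV (fun e => cEq (t e) (u e)).
Proof. unfold cEq; definability. Qed.
Lemma definable_term_cFun : termV (fun e => cFun (t e) (u e)).
Proof. unfold cFun; definability. Qed.
Lemma definable_term_cNeg : termV (fun e => cNeg (t e)).
Proof. unfold cNeg; definability. Qed.
Lemma definable_term_cAnd : termV (fun e => cAnd (t e) (u e)).
Proof. unfold cAnd; definability. Qed.
Lemma definable_term_cEx : termV (fun e => cEx (t e)).
Proof. unfold cEx; definability. Qed.

End DefinableConnectives.
Hint Resolve definable_term_cMem definable_term_cEq definable_term_cFun definable_term_cNeg
  definable_term_cAnd definable_term_cEx : definable.

Lemma fml_closed_iff F X : fml_closed mem F X <->
  (forall i j, i ∈ omega -> j ∈ omega ->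
     cMem i j ∈ X /\ cEq i j ∈ X /\ (F <> None -> cFun i j ∈ X)) /\
  (forall f, f ∈ X -> cNeg f ∈ X /\ cEx f ∈ X) /\
  (forall f g, f ∈ X -> g ∈ X -> cAnd f g ∈ X).
Proof.
  unfold fml_closed, is_cMem, is_cEq, is_cFun, is_cNeg, is_cAnd, is_cEx; split.
  - intros (closed_Mem & closed_Eq & closed_Fun & closed_Neg & closed_And & closed_Ex).
    split; [|split].
    + intros i j Hi Hj; rewrite <- is_nat_iff in Hi, Hj; split; [|split].
      * apply (closed_Mem _ i j); auto; apply code2_iff; reflexivity.
      * apply (closed_Eq _ i j); auto; apply code2_iff; reflexivity.
      * destruct F; [intros _|tauto].
        apply (closed_Fun _ i j); auto; apply code2_iff; reflexivity.
    + intros f Hf; split; [apply (closed_Neg _ f)|apply (closed_Ex _ f)]; auto;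
        apply code1_iff; reflexivity.
    + intros f g Hf Hg; apply (closed_And _ f g); auto; apply code2_iff; reflexivity.
  - intros (closed_atom & closed_un & closed_And); repeat split.
    + intros p i j Hi Hj E; rewrite is_nat_iff in Hi, Hj; apply code2_iff in E; subst.
      apply (closed_atom i j); auto.
    + intros p i j Hi Hj E; rewrite is_nat_iff in Hi, Hj; apply code2_iff in E; subst.
      apply (closed_atom i j); auto.
    + destruct F; auto.
      intros p i j Hi Hj E; rewrite is_nat_iff in Hi, Hj; apply code2_iff in E; subst.
      apply (closed_atom i j); auto; discriminate.
    + intros p f Hf E; apply code1_iff in E; subst; apply (closed_un f Hf).
    + intros p f g Hf Hg E; apply code2_iff in E; subst; apply (closed_And f g); auto.
    + intros p f Hf E; apply code1_iff in E; subst; apply (closed_un f Hf).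
Qed.

Section Formulas.

Context (F : option V).

Lemma fml_closed_Vlevel_omega : fml_closed mem F (Vlevel omega).
Proof.
  assert (Hnat : forall n, n ∈ omega -> n ∈ Vlevel omega)
    by (intros n Hn; apply ord_in_Vlevel; auto using ord_omega, ord_nat).
  apply fml_closed_iff; unfold cMem, cEq, cFun, cNeg, cAnd, cEx.
  repeat split; intros; repeat (apply (Vlevel_opair limit_omega)); auto using num_in_omega.
Qed.
Lemma fml_in_Vlevel_omega p : is_fml mem F p -> p ∈ Vlevel omega.
Proof. intros Hp; apply Hp, fml_closed_Vlevel_omega. Qed.

Lemma definable_is_fml : definable_pred (is_fml mem F).
Proof. destruct F; definability. Qed.

Lemma fml_cMem i j : i ∈ omega -> j ∈ omega -> is_fml mem F (cMem i j).
Proof. intros Hi Hj X HX; apply fml_closed_iff in HX; apply HX; auto. Qed.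
Lemma fml_cEq i j : i ∈ omega -> j ∈ omega -> is_fml mem F (cEq i j).
Proof. intros Hi Hj X HX; apply fml_closed_iff in HX; apply HX; auto. Qed.
Lemma fml_cFun i j : F <> None -> i ∈ omega -> j ∈ omega -> is_fml mem F (cFun i j).
Proof.
  intros HF Hi Hj X HX; apply fml_closed_iff in HX; destruct HX as [closed_atom _].
  apply (closed_atom i j); auto.
Qed.
Lemma fml_cNeg f : is_fml mem F f -> is_fml mem F (cNeg f).
Proof.
  intros Hf X HX; assert (HfX := Hf X HX); apply fml_closed_iff in HX.
  destruct HX as (_ & closed_un & _); apply (closed_un f HfX).
Qed.
Lemma fml_cEx f : is_fml mem F f -> is_fml mem F (cEx f).
Proof.
  intros Hf X HX; assert (HfX := Hf X HX); apply fml_closed_iff in HX.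
  destruct HX as (_ & closed_un & _); apply (closed_un f HfX).
Qed.
Lemma fml_cAnd f g : is_fml mem F f -> is_fml mem F g -> is_fml mem F (cAnd f g).
Proof.
  intros Hf Hg X HX; assert (HfX := Hf X HX); assert (HgX := Hg X HX).
  apply fml_closed_iff in HX; apply HX; auto.
Qed.

Lemma fml_ind P : definable_pred P ->
  (forall i j, i ∈ omega -> j ∈ omega -> P (cMem i j)) ->
  (forall i j, i ∈ omega -> j ∈ omega -> P (cEq i j)) ->
  (F <> None -> forall i j, i ∈ omega -> j ∈ omega -> P (cFun i j)) ->
  (forall f, is_fml mem F f -> P f -> P (cNeg f)) ->
  (forall f g, is_fml mem F f -> P f -> is_fml mem F g -> P g -> P (cAnd f g)) ->
  (forall f, is_fml mem F f -> P f -> P (cEx f)) ->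
  forall p, is_fml mem F p -> P p.
Proof.
  intros HP PMem PEq PFun PNeg PAnd PEx p Hp; assert (Hfml := definable_is_fml).
  set (X := sep (Vlevel omega) (fun p => is_fml mem F p /\ P p)).
  assert (mem_X : forall q, q ∈ X <-> is_fml mem F q /\ P q).
  { intros q; unfold X; rewrite mem_sep by definability; split; [tauto|].
    intros [Hq Pq]; auto using fml_in_Vlevel_omega. }
  apply mem_X, Hp, fml_closed_iff; split; [|split].
  - intros i j Hi Hj; rewrite !mem_X; auto 10 using fml_cMem, fml_cEq, fml_cFun.
  - intros f Hf; rewrite !mem_X in *; destruct Hf; auto using fml_cNeg, fml_cEx.
  - intros f g Hf Hg; rewrite !mem_X in *; destruct Hf, Hg; auto using fml_cAnd.
Qed.

End Formulas.
Hint Resolve fml_cMem fml_cEq fml_cFun fml_cNeg fml_cAnd fml_cEx num_in_omega succ_in_omega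
  : fml.

Lemma assign_iff M s : assign mem M s <-> is_fun mem s omega M.
Proof.
  unfold assign; split; [intros (w & Hw & Hs); apply is_omega_iff in Hw; subst; auto|].
  intros Hs; exists omega; auto using is_omega_omega.
Qed.
Lemma assign_total M s i : assign mem M s -> i ∈ omega -> exists a, a ∈ M /\ ⟨i, a⟩ ∈ s.
Proof. intros Hs; apply assign_iff in Hs; exact (fun_total Hs). Qed.
Lemma assign_functional M s i a b : assign mem M s -> ⟨i, a⟩ ∈ s -> ⟨i, b⟩ ∈ s -> a = b.
Proof. intros Hs; apply assign_iff in Hs; exact (pfun_functional (proj1 Hs)). Qed.
Lemma assign_opair M s i a : assign mem M s -> ⟨i, a⟩ ∈ s -> i ∈ omega /\ a ∈ M.
Proof. intros Hs; apply assign_iff in Hs; exact (pfun_opair (proj1 Hs)). Qed.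
Lemma assign_sub_cart M s : assign mem M s -> s ⊆ cart omega M.
Proof. intros Hs; apply assign_iff in Hs; exact (pfun_sub_cart (proj1 Hs)). Qed.
Lemma assign_mono M N s : M ⊆ N -> assign mem M s -> assign mem N s.
Proof.
  intros HMN; rewrite !assign_iff, !is_fun_iff; intros [Hcart Hs]; split; [|exact Hs].
  intros p Hp; apply Hcart in Hp; rewrite mem_cart in *.
  destruct Hp as (x & y & Hx & Hy & ->); eauto 6.
Qed.

Lemma is_scons_iff t a s : is_scons mem t a s <->
  ⟨num 0, a⟩ ∈ t /\ forall i b, ⟨i, b⟩ ∈ s -> ⟨succ i, b⟩ ∈ t.
Proof.
  unfold is_scons; split; intros [H0 HS]; split.
  - apply gr_iff, H0, is_empty_empty.
  - intros i b Hi; apply gr_iff, (HS i (succ i) b); [apply is_succ_iff; auto|].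
    apply gr_iff, Hi.
  - intros z Hz; apply is_empty_iff in Hz; subst; apply gr_iff, H0.
  - intros i j b Hj Hi; apply is_succ_iff in Hj; subst; apply gr_iff, HS, gr_iff, Hi.
Qed.
Lemma scons_exists M s a : assign mem M s -> a ∈ M ->
  exists t, assign mem M t /\ is_scons mem t a s.
Proof.
  intros Hs Ha.
  destruct (@fun_exists omega M
    (fun i b => (i = empty /\ b = a) \/ exists k, i = succ k /\ ⟨k, b⟩ ∈ s))
    as (t & Ht & mem_t); [definability| | |].
  - intros i Hi; destruct (nat_cases Hi) as [-> |(k & Hk & ->)]; [eauto|].
    destruct (assign_total Hs Hk) as (b & Hb & Hkb); eauto 6.
  - intros i b b' _ [[Hi ->]|(k & Hi & Hb)] [[Hi' ->]|(k' & Hi' & Hb')]; auto; subst.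
    + destruct (succ_neq_empty (eq_sym Hi')).
    + destruct (succ_neq_empty Hi').
    + apply succ_inj in Hi'; subst; exact (assign_functional Hs Hb Hb').
  - exists t; split; [apply assign_iff, Ht|]; apply is_scons_iff; split.
    + apply mem_t; auto using empty_in_omega.
    + intros i b Hi; destruct (assign_opair Hs Hi) as [Hi' Hb]; apply mem_t.
      split; [apply succ_in_omega, Hi'|eauto].
Qed.

Definition pr1 (x : V) : V := union (sep (union x) (fun p => exists y, x = ⟨p, y⟩)).
Lemma pr1_opair x y : pr1 ⟨x, y⟩ = x.
Proof.
  apply set_ext; intros z; unfold pr1; rewrite mem_union; split.
  - intros (p & Hp & Hz); apply mem_sep in Hp; [|definability].
    destruct Hp as [_ [w E]]; opair_injection; subst; auto.
  - intros Hz; exists x; rewrite mem_sep, mem_union by definability; split; [|exact Hz].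
    split; [|eauto]; exists (upair x x); split; apply upair_l.
Qed.
Lemma definable_term_pr1 t : termV t -> termV (fun e => pr1 (t e)).
Proof. unfold pr1; definability. Qed.
Hint Resolve definable_term_pr1 : definable.

Definition fun_atom (F : option V) (a b : V) : Prop :=
  match F with None => False | Some l => ⟨a, b⟩ ∈ l end.
(* S need only be correct about the immediate subformulas of p. *)
Definition tarski_step (M : V) (F : option V) (S p s : V) : Prop :=
  (exists i j a b, p = cMem i j /\ ⟨i, a⟩ ∈ s /\ ⟨j, b⟩ ∈ s /\ a ∈ b) \/
  (exists i j a, p = cEq i j /\ ⟨i, a⟩ ∈ s /\ ⟨j, a⟩ ∈ s) \/
  (exists i j a b, p = cFun i j /\ ⟨i, a⟩ ∈ s /\ ⟨j, b⟩ ∈ s /\ fun_atom F a b) \/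
  (exists f, p = cNeg f /\ ~ ⟨f, s⟩ ∈ S) \/
  (exists f g, p = cAnd f g /\ ⟨f, s⟩ ∈ S /\ ⟨g, s⟩ ∈ S) \/
  (exists f a t, p = cEx f /\ a ∈ M /\ assign mem M t /\ is_scons mem t a s /\ ⟨f, t⟩ ∈ S).

Section TarskiStep.

Context (M : V) (F : option V).

Ltac tarski_case disjunct :=
  unfold tarski_step, cMem, cEq, cFun, cNeg, cAnd, cEx; split;
  [intros Hstep; repeat (destruct Hstep as [Hstep|Hstep]); decompose record Hstep;
   clear Hstep; opair_injection;
   try (match goal with E : num _ = num _ |- _ => apply num_inj in E; discriminate end);
   subst; eauto 8
  |intros Hcase; disjunct; decompose record Hcase; eauto 10].

Lemma tarski_step_cMem S i j s : tarski_step M F S (cMem i j) s <->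
  exists a b, ⟨i, a⟩ ∈ s /\ ⟨j, b⟩ ∈ s /\ a ∈ b.
Proof. tarski_case ltac:(left). Qed.
Lemma tarski_step_cEq S i j s : tarski_step M F S (cEq i j) s <->
  exists a, ⟨i, a⟩ ∈ s /\ ⟨j, a⟩ ∈ s.
Proof. tarski_case ltac:(right; left). Qed.
Lemma tarski_step_cFun S i j s : tarski_step M F S (cFun i j) s <->
  exists a b, ⟨i, a⟩ ∈ s /\ ⟨j, b⟩ ∈ s /\ fun_atom F a b.
Proof. tarski_case ltac:(do 2 right; left). Qed.
Lemma tarski_step_cNeg S f s : tarski_step M F S (cNeg f) s <-> ~ ⟨f, s⟩ ∈ S.
Proof. tarski_case ltac:(do 3 right; left). Qed.
Lemma tarski_step_cAnd S f g s :
  tarski_step M F S (cAnd f g) s <-> ⟨f, s⟩ ∈ S /\ ⟨g, s⟩ ∈ S.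
Proof. tarski_case ltac:(do 4 right; left). Qed.
Lemma tarski_step_cEx S f s : tarski_step M F S (cEx f) s <->
  exists a t, a ∈ M /\ assign mem M t /\ is_scons mem t a s /\ ⟨f, t⟩ ∈ S.
Proof. tarski_case ltac:(do 5 right). Qed.

End TarskiStep.

Lemma definable_tarski_step M F S : definable_relation (tarski_step M F S).
Proof. destruct F; unfold tarski_step, fun_atom; definability. Qed.

Lemma truth_step M F S : is_truth mem M F S -> forall p, is_fml mem F p ->
  forall s, assign mem M s -> (⟨p, s⟩ ∈ S <-> tarski_step M F S p s).
Proof.
  intros HS; assert (Hstep := definable_tarski_step M F S).
  induct_with fml_ind; [definability| | | | | |].
  - intros i j Hi Hj s Hs; destruct (HS _ s (fml_cMem (F := F) Hi Hj) Hs) as (clause & _).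
    rewrite tarski_step_cMem; setoid_rewrite <- gr_iff.
    apply clause, code2_iff; reflexivity.
  - intros i j Hi Hj s Hs; destruct (HS _ s (fml_cEq (F := F) Hi Hj) Hs) as (_ & clause & _).
    rewrite tarski_step_cEq; setoid_rewrite <- gr_iff.
    apply clause, code2_iff; reflexivity.
  - intros HF i j Hi Hj s Hs; destruct (HS _ s (fml_cFun HF Hi Hj) Hs) as (_ & _ & clause & _).
    destruct F as [l|]; [|congruence].
    rewrite tarski_step_cFun; cbn [fun_atom]; setoid_rewrite <- gr_iff.
    apply clause, code2_iff; reflexivity.
  - intros f Hf _ s Hs; destruct (HS _ s (fml_cNeg Hf) Hs) as (_ & _ & _ & clause & _).
    rewrite tarski_step_cNeg, <- !gr_iff; apply clause, code1_iff; reflexivity.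
  - intros f g Hf _ Hg _ s Hs.
    destruct (HS _ s (fml_cAnd Hf Hg) Hs) as (_ & _ & _ & _ & clause & _).
    rewrite tarski_step_cAnd, <- !gr_iff; apply clause, code2_iff; reflexivity.
  - intros f Hf _ s Hs; destruct (HS _ s (fml_cEx Hf) Hs) as (_ & _ & _ & _ & _ & clause).
    rewrite tarski_step_cEx; setoid_rewrite <- gr_iff.
    apply clause, code1_iff; reflexivity.
Qed.

Lemma truth_of_step M F S :
  (forall p s, is_fml mem F p -> assign mem M s -> (⟨p, s⟩ ∈ S <-> tarski_step M F S p s)) ->
  is_truth mem M F S.
Proof.
  intros HS p s Hp Hs; specialize (HS p s Hp Hs).
  unfold is_cMem, is_cEq, is_cFun, is_cNeg, is_cAnd, is_cEx.
  setoid_rewrite code1_iff; setoid_rewrite code2_iff; setoid_rewrite gr_iff.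
  split; [|split; [|split; [|split; [|split]]]].
  - intros i j ->; rewrite HS; apply tarski_step_cMem.
  - intros i j ->; rewrite HS; apply tarski_step_cEq.
  - destruct F; [|exact I].
    setoid_rewrite code2_iff; setoid_rewrite gr_iff.
    intros i j ->; rewrite HS; apply tarski_step_cFun.
  - intros f ->; rewrite HS; apply tarski_step_cNeg.
  - intros f g ->; rewrite HS; apply tarski_step_cAnd.
  - intros f ->; rewrite HS; apply tarski_step_cEx.
Qed.

Lemma rank_cNeg f : rank f ∈ rank (cNeg f).
Proof. apply rank_opair_r. Qed.
Lemma rank_cEx f : rank f ∈ rank (cEx f).
Proof. apply rank_opair_r. Qed.
Lemma rank_cAnd_l f g : rank f ∈ rank (cAnd f g).
Proof. exact (ord_mem_trans (ord_rank _) (rank_opair_l f g) (rank_opair_r _ _)). Qed.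
Lemma rank_cAnd_r f g : rank g ∈ rank (cAnd f g).
Proof. exact (ord_mem_trans (ord_rank _) (rank_opair_r f g) (rank_opair_r _ _)). Qed.

Lemma tarski_step_mono_rank M F S S' p s :
  (forall f t, rank f ∈ rank p -> (⟨f, t⟩ ∈ S <-> ⟨f, t⟩ ∈ S')) ->
  tarski_step M F S p s -> tarski_step M F S' p s.
Proof.
  intros agree [Hstep|[Hstep|[Hstep|[(f & -> & Hf)|[(f & g & -> & Hf & Hg)
    |(f & a & t & -> & Ha & Ht & Hts & Hf)]]]]]; unfold tarski_step; auto.
  - rewrite agree in Hf by apply rank_cNeg; do 3 right; left; eauto.
  - rewrite agree in Hf by apply rank_cAnd_l; rewrite agree in Hg by apply rank_cAnd_r.
    do 4 right; left; eauto.
  - rewrite agree in Hf by apply rank_cEx; do 5 right; eauto 8.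
Qed.

Lemma truth_exists M F : exists S,
  S ⊆ cart (Vlevel omega) (powerset (cart omega M)) /\ is_truth mem M F S.
Proof.
  set (assigns := sep (powerset (cart omega M)) (assign mem M)).
  assert (mem_assigns : forall s, s ∈ assigns <-> assign mem M s).
  { intros s; unfold assigns; rewrite mem_sep by definability; split; [tauto|].
    intros Hs; split; [apply mem_powerset, (assign_sub_cart Hs)|exact Hs]. }
  destruct (@set_recursion (cart (Vlevel omega) assigns) (fun x => rank (pr1 x))
    (fun S x => exists p s, x = ⟨p, s⟩ /\ tarski_step M F S p s)) as (S & HSX & HS).
  - definability.
  - destruct F; unfold tarski_step, fun_atom; definability.
  - intros; apply ord_rank.
  - exists S; split.
    { intros x Hx; apply HSX, mem_cart in Hx; destruct Hx as (p & s & Hp & Hs & ->).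
      apply opair_in_cart; split; auto; apply mem_powerset, assign_sub_cart, mem_assigns, Hs. }
    apply truth_of_step; intros p s Hp Hs.
    rewrite HS by (apply opair_in_cart; rewrite mem_assigns; eauto using fml_in_Vlevel_omega).
    split; [intros (p' & s' & E & Hstep); opair_injection; subst p' s'|intros Hstep; exists p, s];
      [|split; [reflexivity|]]; revert Hstep; apply tarski_step_mono_rank; intros f t Hf;
      rewrite mem_sep, !pr1_opair by definability; tauto.
Qed.

Lemma truth_unique M F S S' : is_truth mem M F S -> is_truth mem M F S' ->
  forall p, is_fml mem F p -> forall s, assign mem M s -> (⟨p, s⟩ ∈ S <-> ⟨p, s⟩ ∈ S').
Proof.
  intros HS HS'; assert (step := truth_step HS); assert (step' := truth_step HS').
  induct_with fml_ind; [definability| | | | | |].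
  - intros i j Hi Hj s Hs.
    rewrite step, step', !tarski_step_cMem by auto with fml; reflexivity.
  - intros i j Hi Hj s Hs.
    rewrite step, step', !tarski_step_cEq by auto with fml; reflexivity.
  - intros HF i j Hi Hj s Hs.
    rewrite step, step', !tarski_step_cFun by auto with fml; reflexivity.
  - intros f Hf IHf s Hs.
    rewrite step, step', !tarski_step_cNeg, IHf by auto with fml; reflexivity.
  - intros f g Hf IHf Hg IHg s Hs.
    rewrite step, step', !tarski_step_cAnd, IHf, IHg by auto with fml; reflexivity.
  - intros f Hf IHf s Hs; rewrite step, step', !tarski_step_cEx by auto with fml.
    split; intros (a & t & Ha & Ht & Hts & Hft); exists a, t; apply IHf in Hft; auto.
Qed.

Lemma sat_iff_truth M F S p s : is_truth mem M F S -> is_fml mem F p -> assign mem M s ->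
  (sat mem M F p s <-> ⟨p, s⟩ ∈ S).
Proof.
  intros HS Hp Hs; unfold sat; split.
  - intros (S' & HS' & Hps); apply gr_iff in Hps; apply (truth_unique HS' HS Hp Hs), Hps.
  - intros Hps; exists S; rewrite gr_iff; auto.
Qed.

Section Satisfaction.

Context (M : V) (F : option V) (s : V) (assign_s : assign mem M s).

Lemma sat_step p : is_fml mem F p -> exists S, is_truth mem M F S /\
  (sat mem M F p s <-> tarski_step M F S p s).
Proof.
  intros Hp; destruct (truth_exists M F) as (S & _ & HS); exists S; split; [exact HS|].
  rewrite (sat_iff_truth HS Hp assign_s); exact (truth_step HS Hp assign_s).
Qed.

Lemma sat_cMem i j : i ∈ omega -> j ∈ omega ->
  (sat mem M F (cMem i j) s <-> exists a b, ⟨i, a⟩ ∈ s /\ ⟨j, b⟩ ∈ s /\ a ∈ b).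
Proof.
  intros Hi Hj; destruct (sat_step (fml_cMem (F := F) Hi Hj)) as (S & _ & ->).
  apply tarski_step_cMem.
Qed.
Lemma sat_cEq i j : i ∈ omega -> j ∈ omega ->
  (sat mem M F (cEq i j) s <-> exists a, ⟨i, a⟩ ∈ s /\ ⟨j, a⟩ ∈ s).
Proof.
  intros Hi Hj; destruct (sat_step (fml_cEq (F := F) Hi Hj)) as (S & _ & ->).
  apply tarski_step_cEq.
Qed.
Lemma sat_cFun i j : F <> None -> i ∈ omega -> j ∈ omega ->
  (sat mem M F (cFun i j) s <-> exists a b, ⟨i, a⟩ ∈ s /\ ⟨j, b⟩ ∈ s /\ fun_atom F a b).
Proof.
  intros HF Hi Hj; destruct (sat_step (fml_cFun HF Hi Hj)) as (S & _ & ->).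
  apply tarski_step_cFun.
Qed.
Lemma sat_cNeg f : is_fml mem F f -> (sat mem M F (cNeg f) s <-> ~ sat mem M F f s).
Proof.
  intros Hf; destruct (sat_step (fml_cNeg Hf)) as (S & HS & ->).
  rewrite (sat_iff_truth HS Hf assign_s); apply tarski_step_cNeg.
Qed.
Lemma sat_cAnd f g : is_fml mem F f -> is_fml mem F g ->
  (sat mem M F (cAnd f g) s <-> sat mem M F f s /\ sat mem M F g s).
Proof.
  intros Hf Hg; destruct (sat_step (fml_cAnd Hf Hg)) as (S & HS & ->).
  rewrite (sat_iff_truth HS Hf assign_s), (sat_iff_truth HS Hg assign_s).
  apply tarski_step_cAnd.
Qed.
Lemma sat_cEx f : is_fml mem F f -> (sat mem M F (cEx f) s <->
  exists a t, a ∈ M /\ assign mem M t /\ is_scons mem t a s /\ sat mem M F f t).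
Proof.
  intros Hf; destruct (sat_step (fml_cEx Hf)) as (S & HS & ->); rewrite tarski_step_cEx.
  split; intros (a & t & Ha & Ht & Hts & Hft); exists a, t;
    apply (sat_iff_truth HS Hf Ht) in Hft; auto.
Qed.

Lemma sat_cEq_of_value i j a : ⟨i, a⟩ ∈ s -> j ∈ omega ->
  (sat mem M F (cEq i j) s <-> ⟨j, a⟩ ∈ s).
Proof.
  intros Ha Hj; rewrite sat_cEq; [|apply (assign_opair assign_s Ha)|exact Hj].
  split; [|eauto]; intros (b & Hb & Hjb).
  rewrite (assign_functional assign_s Ha Hb); exact Hjb.
Qed.

End Satisfaction.

Fixpoint quote (p : form) : V :=
  match p with
  | FMem i j => cMem (num i) (num j)
  | FEq i j => cEq (num i) (num j)
  | FNeg q => cNeg (quote q)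
  | FAnd q r => cAnd (quote q) (quote r)
  | FEx q => cEx (quote q)
  end.
Lemma fml_quote F p : is_fml mem F (quote p).
Proof. induction p; simpl; auto with fml. Qed.
Hint Resolve fml_quote : fml.

Definition carrier (M : V) : Type := {x : V | x ∈ M}.
Definition cmem (M : V) (x y : carrier M) : Prop := proj1_sig x ∈ proj1_sig y.

Lemma carrier_eq M (x y : carrier M) : x = y <-> proj1_sig x = proj1_sig y.
Proof.
  split; [congruence|]; intros E; apply eq_sig_hprop; [|exact E].
  intros; apply proof_irrelevance.
Qed.

Definition valuation (M s : V) (e : nat -> carrier M) : Prop :=
  forall n, ⟨num n, proj1_sig (e n)⟩ ∈ s.
Lemma valuation_exists M s : assign mem M s -> exists e : nat -> carrier M, valuation s e.
Proof.
  intros Hs.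
  assert (value : forall n, {x : carrier M | ⟨num n, proj1_sig x⟩ ∈ s}).
  { intros n; apply constructive_indefinite_description.
    destruct (assign_total Hs (num_in_omega n)) as (a & Ha & Hna).
    exists (exist _ a Ha); exact Hna. }
  exists (fun n => proj1_sig (value n)); intros n; apply (proj2_sig (value n)).
Qed.
Lemma valuation_scons M s t e (x : carrier M) :
  valuation s e -> is_scons mem t (proj1_sig x) s -> valuation t (scons x e).
Proof.
  intros Hs Ht; apply is_scons_iff in Ht; destruct Ht as [Ht0 HtS].
  intros [|n]; [exact Ht0|apply HtS, Hs].
Qed.

Lemma sat_quote M F p : forall s (e : nat -> carrier M), assign mem M s -> valuation s e ->
  (sat mem M F (quote p) s <-> fsat (@cmem M) e p).
Proof.
  induction p as [i j|i j|p IH|p IHp q IHq|p IH]; intros s e Hs He; simpl.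
  - rewrite sat_cMem by auto with fml; unfold cmem; split; [|eauto].
    intros (a & b & Ha & Hb & Hab).
    rewrite (assign_functional Hs (He i) Ha), (assign_functional Hs (He j) Hb); exact Hab.
  - rewrite (sat_cEq_of_value F Hs (He i)), carrier_eq by auto with fml; split.
    + intros Hj; exact (assign_functional Hs Hj (He j)).
    + intros ->; apply He.
  - rewrite sat_cNeg, (IH s e Hs He) by auto with fml; reflexivity.
  - rewrite sat_cAnd, (IHp s e Hs He), (IHq s e Hs He) by auto with fml; reflexivity.
  - rewrite sat_cEx by auto with fml; split.
    + intros (a & t & Ha & Ht & Hts & Hp); exists (exist _ a Ha).
      apply (IH t); auto; exact (@valuation_scons M s t e (exist _ a Ha) He Hts).
    + intros [[a Ha] Hp]; destruct (scons_exists Hs Ha) as (t & Ht & Hts).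
      exists a, t; repeat split; auto; try apply Hts.
      refine (proj2 (IH t _ Ht _) Hp).
      exact (@valuation_scons M s t e (exist _ a Ha) He Hts).
Qed.

Definition defines (M l P : V) : Prop :=
  forall s, assign mem M s -> forall a b, ⟨num 0, a⟩ ∈ s -> ⟨num 1, b⟩ ∈ s ->
  (sat mem M None P s <-> ⟨a, b⟩ ∈ l).

Lemma definable_in_of_defines M l P :
  is_fml mem None P -> defines M l P -> definable_in mem M l.
Proof.
  intros fml_P HP; exists P; split; [exact fml_P|]; intros s Hs.
  destruct (assign_total Hs (num_in_omega 0)) as (a & _ & Ha).
  destruct (assign_total Hs (num_in_omega 1)) as (b & _ & Hb).
  rewrite (HP s Hs a b Ha Hb); setoid_rewrite is_num_iff; setoid_rewrite gr_iff.
  split; [eauto 10|].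
  intros (i & j & a' & b' & -> & -> & Ha' & Hb' & Hl).
  rewrite (assign_functional Hs Ha Ha'), (assign_functional Hs Hb Hb'); exact Hl.
Qed.

Lemma assign_exists M a b : a ∈ M -> b ∈ M ->
  exists s, assign mem M s /\ ⟨num 0, a⟩ ∈ s /\ ⟨num 1, b⟩ ∈ s.
Proof.
  intros Ha Hb.
  destruct (@fun_exists omega M (fun _ y => y = b)) as (s & Hs & mem_s);
    [definability|eauto|congruence|].
  apply assign_iff in Hs; destruct (scons_exists Hs Ha) as (t & Ht & Hts).
  apply is_scons_iff in Hts; destruct Hts as [Ht0 HtS]; exists t; split; [exact Ht|].
  split; [exact Ht0|apply HtS, mem_s; auto using empty_in_omega].
Qed.
Lemma defined_relation_exists M p (R : carrier M -> carrier M -> Prop) :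
  (forall e, fsat (@cmem M) e p <-> R (e 0) (e 1)) ->
  exists l, defines M l (quote p) /\ l ⊆ cart M M /\
    forall a b, ⟨a, b⟩ ∈ l <-> exists Ha Hb, R (exist _ a Ha) (exist _ b Hb).
Proof.
  intros HR.
  assert (sat_p : forall s, assign mem M s -> forall a b, ⟨num 0, a⟩ ∈ s -> ⟨num 1, b⟩ ∈ s ->
    (sat mem M None (quote p) s <-> exists Ha Hb, R (exist _ a Ha) (exist _ b Hb))).
  { intros s Hs a b Ha Hb; destruct (valuation_exists Hs) as [e He].
    rewrite (sat_quote None p Hs He), HR.
    assert (Ea := assign_functional Hs (He 0) Ha); assert (Eb := assign_functional Hs (He 1) Hb).
    destruct (e 0) as [a' Ha'], (e 1) as [b' Hb']; simpl in Ea, Eb; subst a' b'.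
    split; [eauto|]; intros (Ha'' & Hb'' & Hab).
    rewrite (proof_irrelevance _ Ha' Ha''), (proof_irrelevance _ Hb' Hb''); exact Hab. }
  destruct (@relation_exists M M (fun a b => exists s, assign mem M s /\
    ⟨num 0, a⟩ ∈ s /\ ⟨num 1, b⟩ ∈ s /\ sat mem M None (quote p) s)) as (l & l_sub & mem_l);
    [definability|].
  assert (mem_l' : forall a b, ⟨a, b⟩ ∈ l <->
    exists Ha Hb, R (exist (fun x => x ∈ M) a Ha) (exist (fun x => x ∈ M) b Hb)).
  { intros a b; rewrite mem_l; split.
    - intros (_ & _ & s & Hs & Ha & Hb & Hsat); exact (proj1 (sat_p s Hs a b Ha Hb) Hsat).
    - intros (Ha & Hb & Hab); destruct (assign_exists Ha Hb) as (s & Hs & Hsa & Hsb).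
      split; [exact Ha|]; split; [exact Hb|]; exists s; split; [exact Hs|].
      split; [exact Hsa|]; split; [exact Hsb|]; apply (sat_p s Hs a b Hsa Hsb); eauto. }
  exists l; split; [|split; [exact l_sub|exact mem_l']].
  intros s Hs a b Ha Hb; rewrite mem_l'; exact (sat_p s Hs a b Ha Hb).
Qed.

(* The atom l(x_i) = x_j becomes: some v and u satisfy u = x_i, v = x_j and
   P(u, v). *)
Definition unfold_atom (P i j : V) : V :=
  cEx (cEx (cAnd (cEq (num 0) (succ (succ i))) (cAnd (cEq (num 1) (succ (succ j))) P))).

Lemma fml_unfold_atom P i j : is_fml mem None P -> i ∈ omega -> j ∈ omega ->
  is_fml mem None (unfold_atom P i j).
Proof. unfold unfold_atom; auto 10 with fml. Qed.

Lemma scons_succ M s t a i c : assign mem M s -> assign mem M t -> is_scons mem t a s ->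
  i ∈ omega -> (⟨succ i, c⟩ ∈ t <-> ⟨i, c⟩ ∈ s).
Proof.
  intros Hs Ht Hts Hi; apply is_scons_iff in Hts; destruct Hts as [_ HtS]; split; [|auto].
  intros Hc; destruct (assign_total Hs Hi) as (c' & _ & Hc').
  rewrite (assign_functional Ht Hc (HtS _ _ Hc')); exact Hc'.
Qed.

Lemma sat_unfold_atom M l P i j s : defines M l P -> is_fml mem None P ->
  i ∈ omega -> j ∈ omega -> assign mem M s ->
  (sat mem M None (unfold_atom P i j) s <-> exists a b, ⟨i, a⟩ ∈ s /\ ⟨j, b⟩ ∈ s /\ ⟨a, b⟩ ∈ l).
Proof.
  intros HP fml_P Hi Hj Hs.
  assert (sat_body : forall b t a u, assign mem M t -> is_scons mem t b s ->
    assign mem M u -> is_scons mem u a t ->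
    (sat mem M None (cAnd (cEq (num 0) (succ (succ i))) (cAnd (cEq (num 1) (succ (succ j))) P)) u
     <-> ⟨i, a⟩ ∈ s /\ ⟨j, b⟩ ∈ s /\ ⟨a, b⟩ ∈ l)).
  { intros b t a u Ht Hts Hu Hut.
    assert (Ha : ⟨num 0, a⟩ ∈ u) by (apply is_scons_iff in Hut; apply Hut).
    assert (Hb : ⟨num 1, b⟩ ∈ u)
      by (apply is_scons_iff in Hut, Hts; apply Hut, Hts).
    rewrite !sat_cAnd, (sat_cEq_of_value None Hu Ha), (sat_cEq_of_value None Hu Hb),
      (HP u Hu a b Ha Hb) by auto with fml.
    rewrite !(scons_succ _ Ht Hu Hut), !(scons_succ _ Hs Ht Hts) by auto with fml.
    reflexivity. }
  unfold unfold_atom; rewrite sat_cEx by auto 10 with fml; split.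
  - intros (b & t & _ & Ht & Hts & Hex); rewrite sat_cEx in Hex by auto 10 with fml.
    destruct Hex as (a & u & _ & Hu & Hut & Hbody).
    exists a, b; exact (proj1 (sat_body b t a u Ht Hts Hu Hut) Hbody).
  - intros (a & b & Ha & Hb & Hab).
    destruct (assign_opair Hs Ha) as [_ HaM], (assign_opair Hs Hb) as [_ HbM].
    destruct (scons_exists Hs HbM) as (t & Ht & Hts).
    destruct (scons_exists Ht HaM) as (u & Hu & Hut).
    exists b, t; split; [exact HbM|]; split; [exact Ht|]; split; [exact Hts|].
    rewrite sat_cEx by auto 10 with fml; exists a, u; split; [exact HaM|].
    split; [exact Hu|]; split; [exact Hut|]; apply (sat_body b t a u); auto.
Qed.

Definition translates (M l p q : V) : Prop :=
  forall s, assign mem M s -> (sat mem M (Some l) p s <-> sat mem M None q s).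

Lemma translation_exists l P : is_fml mem None P -> forall p, is_fml mem (Some l) p ->
  exists q, is_fml mem None q /\ forall M l', defines M l' P -> translates M l' p q.
Proof.
  intros HP.
  induct_with fml_ind; [unfold defines, translates; definability| | | | | |].
  - intros i j Hi Hj; exists (cMem i j); split; [auto with fml|]; intros M l' _ s Hs.
    rewrite !sat_cMem by auto; reflexivity.
  - intros i j Hi Hj; exists (cEq i j); split; [auto with fml|]; intros M l' _ s Hs.
    rewrite !sat_cEq by auto; reflexivity.
  - intros _ i j Hi Hj; exists (unfold_atom P i j); split; [auto using fml_unfold_atom|].
    intros M l' HM s Hs; rewrite (sat_unfold_atom HM HP Hi Hj Hs).
    apply sat_cFun; auto; discriminate.
  - intros f Hf (q & Hq & trans_q); exists (cNeg q); split; [auto with fml|].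
    intros M l' HM s Hs; rewrite !sat_cNeg, (trans_q M l' HM s Hs) by auto; reflexivity.
  - intros f g Hf (q & Hq & trans_q) Hg (r & Hr & trans_r); exists (cAnd q r).
    split; [auto with fml|]; intros M l' HM s Hs.
    rewrite !sat_cAnd, (trans_q M l' HM s Hs), (trans_r M l' HM s Hs) by auto; reflexivity.
  - intros f Hf (q & Hq & trans_q); exists (cEx q); split; [auto with fml|].
    intros M l' HM s Hs; rewrite !sat_cEx by auto.
    split; intros (a & t & Ha & Ht & Hts & Hft); exists a, t;
      apply (trans_q M l' HM t Ht) in Hft; auto.
Qed.

Lemma elem_sub_expand M N l l' P : is_fml mem None P -> defines M l P -> defines N l' P ->
  elem_sub mem M None N None -> elem_sub mem M (Some l) N (Some l').
Proof.
  intros HP HM HN [Hsub Hel]; split; [exact Hsub|]; intros p s Hp Hs.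
  destruct (translation_exists HP Hp) as (q & Hq & trans_q).
  rewrite (trans_q M l HM s Hs), (trans_q N l' HN s (assign_mono Hsub Hs)).
  exact (Hel q s Hq Hs).
Qed.

(** * Codes and their well-order *)

Definition has_least (L : V -> V -> Prop) (X : V) : Prop :=
  exists x, x ∈ X /\ forall y, y ∈ X -> y = x \/ L x y.

Definition supported (n s : V) : Prop := forall i b, ⟨i, b⟩ ∈ s -> ~ i ∈ n -> b = empty.
Definition ord_seq (s : V) : Prop :=
  (forall p, p ∈ s -> exists i b, i ∈ omega /\ ord mem b /\ p = ⟨i, b⟩) /\
  (forall i, i ∈ omega -> exists b, ⟨i, b⟩ ∈ s) /\
  (forall i b b', ⟨i, b⟩ ∈ s -> ⟨i, b'⟩ ∈ s -> b = b').

Lemma fin_supp_iff s :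
  fin_supp mem s <-> ord_seq s /\ exists n, n ∈ omega /\ supported n s.
Proof.
  unfold fin_supp, ord_seq, supported.
  setoid_rewrite is_pair_iff; setoid_rewrite gr_iff; setoid_rewrite is_empty_iff.
  split.
  - intros (w & n & Hw & Hn & Hs); apply is_omega_iff in Hw; subst w.
    destruct Hs as (pairs & total & functional & supp); eauto 8.
  - intros ((pairs & total & functional) & n & Hn & supp).
    exists omega, n; auto 7 using is_omega_omega.
Qed.
Lemma fin_supp_lt_iff s t : fin_supp_lt mem s t <-> exists i b c,
  ⟨i, b⟩ ∈ s /\ ⟨i, c⟩ ∈ t /\ b ∈ c /\ forall j, i ∈ j -> forall y, ⟨j, y⟩ ∈ s <-> ⟨j, y⟩ ∈ t.
Proof. unfold fin_supp_lt; setoid_rewrite gr_iff; reflexivity. Qed.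

Lemma ord_seq_opair s i b : ord_seq s -> ⟨i, b⟩ ∈ s -> i ∈ omega /\ ord mem b.
Proof.
  intros [pairs _] Hi; destruct (pairs _ Hi) as (i' & b' & Hi' & Ob & E).
  opair_injection; subst; auto.
Qed.
Lemma ord_seq_total s i : ord_seq s -> i ∈ omega -> exists b, ⟨i, b⟩ ∈ s.
Proof. intros (_ & total & _); apply total. Qed.
Lemma ord_seq_functional s i b b' : ord_seq s -> ⟨i, b⟩ ∈ s -> ⟨i, b'⟩ ∈ s -> b = b'.
Proof. intros (_ & _ & functional); apply functional. Qed.
Lemma ord_seq_ext s t : ord_seq s -> ord_seq t ->
  (forall i b, ⟨i, b⟩ ∈ s <-> ⟨i, b⟩ ∈ t) -> s = t.
Proof.
  intros [pairs_s _] [pairs_t _] E; apply set_ext; intros p; split; intros Hp;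
    [destruct (pairs_s p Hp) as (i & b & _ & _ & ->)
    |destruct (pairs_t p Hp) as (i & b & _ & _ & ->)]; apply E, Hp.
Qed.

Lemma fin_supp_lt_asym s t : ord_seq s -> ord_seq t ->
  fin_supp_lt mem s t -> ~ fin_supp_lt mem t s.
Proof.
  intros Hs Ht Hst Hts; apply fin_supp_lt_iff in Hst, Hts.
  destruct Hst as (i & b & c & Hb & Hc & Hbc & agree).
  destruct Hts as (j & c' & b' & Hc' & Hb' & Hcb & agree').
  assert (Oi := ord_nat (proj1 (ord_seq_opair Hs Hb))).
  assert (Oj := ord_nat (proj1 (ord_seq_opair Hs Hb'))).
  destruct (ord_trichotomy Oi Oj) as [Hij|[<- |Hji]].
  - apply (agree j Hij) in Hb'; rewrite (ord_seq_functional Ht Hb' Hc') in Hcb.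
    exact (mem_irrefl Hcb).
  - rewrite (ord_seq_functional Hs Hb' Hb), (ord_seq_functional Ht Hc' Hc) in Hcb.
    exact (mem_asym Hbc Hcb).
  - apply (agree' i Hji) in Hc; rewrite (ord_seq_functional Hs Hc Hb) in Hbc.
    exact (mem_irrefl Hbc).
Qed.

Lemma last_nonzero t n m : ord_seq t -> n ∈ omega -> m ∈ omega ->
  supported m t -> ~ supported n t ->
  exists i b, ⟨i, b⟩ ∈ t /\ ~ i ∈ n /\ b <> empty /\
    forall j c, i ∈ j -> ⟨j, c⟩ ∈ t -> c = empty.
Proof.
  intros Ht Hn Hm; revert m Hm.
  induct_with nat_ind; [unfold supported; definability| |].
  - intros supp_t N; destruct N; intros i b Hi _; exact (supp_t i b Hi (@not_mem_empty i)).
  - intros k Hk IH supp_t N; destruct (ord_seq_total Ht Hk) as [b Hb].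
    destruct (classic (b = empty)) as [-> |Hb0].
    + apply IH; [|exact N]; intros i c Hi Nik; destruct (classic (i = k)) as [-> |Hik].
      * exact (ord_seq_functional Ht Hi Hb).
      * apply (supp_t i c Hi); rewrite mem_succ; tauto.
    + exists k, b; split; [exact Hb|]; split; [|split; [exact Hb0|]].
      * intros Hkn; apply N; intros i c Hi Nin; apply (supp_t i c Hi); rewrite mem_succ.
        intros [Hik| ->]; [|tauto].
        exact (Nin (ord_mem_trans (ord_nat Hn) Hik Hkn)).
      * intros j c Hkj Hj; apply (supp_t j c Hj); rewrite mem_succ.
        intros [Hjk| ->]; [exact (mem_asym Hkj Hjk)|exact (mem_irrefl Hkj)].
Qed.

Definition agree_off (n s t : V) : Prop :=
  forall i, ~ i ∈ n -> forall b, ⟨i, b⟩ ∈ s <-> ⟨i, b⟩ ∈ t.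

Lemma fin_supp_least_agree_off n : n ∈ omega -> forall X, (forall s, s ∈ X -> ord_seq s) ->
  (forall s t, s ∈ X -> t ∈ X -> agree_off n s t) -> (exists s, s ∈ X) ->
  has_least (fin_supp_lt mem) X.
Proof.
  revert n.
  induct_with nat_ind; [unfold ord_seq, agree_off, has_least, fin_supp_lt; definability| |].
  - intros X HX agree [s Hs]; exists s; split; [exact Hs|]; intros t Ht; left.
    apply ord_seq_ext; auto; intros i; apply (agree t s Ht Hs i), not_mem_empty.
  - intros n Hn IH X HX agree [s0 Hs0].
    destruct (ord_seq_total (HX s0 Hs0) Hn) as [b0 Hb0].
    destruct (@ord_least (fun b => exists s, s ∈ X /\ ⟨n, b⟩ ∈ s) b0)
      as (b & Ob & _ & (s1 & Hs1 & Hb) & least); [definability| |eauto|].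
    { exact (proj2 (ord_seq_opair (HX s0 Hs0) Hb0)). }
    set (Y := sep X (fun s => ⟨n, b⟩ ∈ s)).
    assert (mem_Y : forall s, s ∈ Y <-> s ∈ X /\ ⟨n, b⟩ ∈ s)
      by (intros s; apply mem_sep; definability).
    destruct (IH Y) as (s & Hs & min_s).
    + intros s Hs; apply HX, mem_Y, Hs.
    + intros s t Hs Ht i Hi c; apply mem_Y in Hs, Ht; destruct Hs as [Hs Hsb], Ht as [Ht Htb].
      destruct (classic (i = n)) as [-> |Hin].
      * split; intros Hc; [rewrite (ord_seq_functional (HX s Hs) Hc Hsb)
          |rewrite (ord_seq_functional (HX t Ht) Hc Htb)]; assumption.
      * apply agree; auto; rewrite mem_succ; tauto.
    + exists s1; apply mem_Y; auto.
    + apply mem_Y in Hs; destruct Hs as [Hs Hsb]; exists s; split; [exact Hs|]; intros t Ht.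
      destruct (ord_seq_total (HX t Ht) Hn) as [c Hc].
      destruct (ord_mem_or_ole Ob (proj2 (ord_seq_opair (HX t Ht) Hc))) as [Hbc|[Hcb| ->]].
      * right; apply fin_supp_lt_iff; exists n, b, c; do 3 (split; [assumption|]).
        intros j Hnj; apply agree; auto; rewrite mem_succ; intros [Hjn| ->];
          [exact (mem_asym Hnj Hjn)|exact (mem_irrefl Hnj)].
      * destruct (least c Hcb); eauto.
      * apply min_s, mem_Y; auto.
Qed.

Lemma ord_seq_null_at s j y : ord_seq s -> (forall c, ⟨j, c⟩ ∈ s -> c = empty) ->
  (⟨j, y⟩ ∈ s <-> j ∈ omega /\ y = empty).
Proof.
  intros Hs null; split.
  - intros Hy; split; [apply (ord_seq_opair Hs Hy)|exact (null y Hy)].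
  - intros [Hj ->]; destruct (ord_seq_total Hs Hj) as [c Hc]; rewrite (null c Hc) in Hc; exact Hc.
Qed.

Lemma fin_supp_least X : (forall s, s ∈ X -> fin_supp mem s) -> (exists s, s ∈ X) ->
  has_least (fin_supp_lt mem) X.
Proof.
  intros HX [s0 Hs0].
  assert (seq_X : forall s, s ∈ X -> ord_seq s)
    by (intros s Hs; apply fin_supp_iff, HX, Hs).
  destruct (proj1 (fin_supp_iff s0) (HX s0 Hs0)) as (_ & n & Hn & supp_s0).
  set (Y := sep X (supported n)).
  assert (mem_Y : forall s, s ∈ Y <-> s ∈ X /\ supported n s)
    by (intros s; apply mem_sep; unfold supported; definability).
  assert (null_off : forall s, s ∈ Y -> forall i, ~ i ∈ n -> forall c,
    ⟨i, c⟩ ∈ s <-> i ∈ omega /\ c = empty).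
  { intros s Hs i Hi c; apply mem_Y in Hs; destruct Hs as [Hs supp_s].
    apply ord_seq_null_at; auto; intros d Hd; exact (supp_s i d Hd Hi). }
  destruct (@fin_supp_least_agree_off n Hn Y) as (s & Hs & min_s).
  - intros s Hs; apply seq_X, mem_Y, Hs.
  - intros s t Hs Ht i Hi c; rewrite (null_off s Hs i Hi c), (null_off t Ht i Hi c); reflexivity.
  - exists s0; apply mem_Y; auto.
  - exists s; split; [apply mem_Y, Hs|]; intros t Ht.
    destruct (classic (supported n t)) as [supp_t|N]; [apply min_s, mem_Y; auto|].
    right; destruct (proj1 (fin_supp_iff t) (HX t Ht)) as (seq_t & m & Hm & supp_t).
    destruct (last_nonzero seq_t Hn Hm supp_t N) as (i & b & Hb & Nin & Hb0 & null_above).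
    destruct (ord_seq_opair seq_t Hb) as [Hi Ob].
    apply fin_supp_lt_iff; exists i, empty, b.
    split; [apply (null_off s Hs i Nin); auto|]; split; [exact Hb|]; split.
    + destruct (ord_mem_or_ole ord_empty Ob) as [|[Hbe|]]; auto; [|congruence].
      destruct (not_mem_empty Hbe).
    + intros j Hij y; rewrite (@ord_seq_null_at t j y seq_t) by (intros c; apply null_above, Hij).
      apply null_off; [exact Hs|]; intros Hjn; exact (Nin (ord_mem_trans (ord_nat Hn) Hij Hjn)).
Qed.

Lemma atom_lt_asym x y : atom mem x -> atom mem y -> atom_lt mem x y -> ~ atom_lt mem y x.
Proof.
  unfold atom, atom_lt; intros Hx Hy [Noy Hxy] [Nox Hyx].
  apply (@fin_supp_lt_asym x y); [apply fin_supp_iff; tauto..|tauto|tauto].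
Qed.

Lemma atom_least X r : (forall x, x ∈ X -> atom mem x /\ rank x = r) -> (exists x, x ∈ X) ->
  has_least (atom_lt mem) X.
Proof.
  intros HX nonempty; unfold atom_lt.
  destruct (classic (exists o, o ∈ X /\ ord mem o)) as [(o & Ho & Oo)|N].
  - exists o; split; [exact Ho|]; intros y Hy.
    destruct (classic (ord mem y)) as [Oy|]; [left|auto].
    rewrite <- (rank_ord Oy), <- (rank_ord Oo), (proj2 (HX y Hy)), (proj2 (HX o Ho)); reflexivity.
  - assert (not_ord : forall x, x ∈ X -> ~ ord mem x) by eauto.
    destruct (@fin_supp_least X) as (s & Hs & min_s); [|exact nonempty|].
    + intros x Hx; destruct (HX x Hx) as [[Ox|] _]; [destruct (not_ord x Hx Ox)|assumption].
    + exists s; split; [exact Hs|]; intros y Hy; destruct (min_s y Hy); auto.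
Qed.

Lemma code_atom x : atom mem x -> is_code mem x.
Proof.
  intros Hx; exists (upair x x); split; [apply upair_l|].
  intros y Hy; apply mem_upair in Hy; left; destruct Hy; subst; exact Hx.
Qed.
Lemma code_ord a : ord mem a -> is_code mem a.
Proof. intros Oa; apply code_atom; left; exact Oa. Qed.
Lemma code_opair x y : is_code mem x -> is_code mem y -> is_code mem ⟨x, y⟩.
Proof.
  intros (t & Hx & Ht) (u & Hy & Hu).
  exists (cup (cup t u) (upair ⟨x, y⟩ ⟨x, y⟩)); split; [apply mem_cup; auto using upair_l|].
  intros z Hz; rewrite !mem_cup, mem_upair in Hz; destruct Hz as [[Hz|Hz]|Hz].
  - destruct (Ht z Hz) as [Az|(z1 & z2 & Hz1 & Hz2 & E)]; auto.
    right; exists z1, z2; rewrite !mem_cup; auto.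
  - destruct (Hu z Hz) as [Az|(z1 & z2 & Hz1 & Hz2 & E)]; auto.
    right; exists z1, z2; rewrite !mem_cup; auto.
  - right; exists x, y; rewrite !mem_cup, is_pair_iff; tauto.
Qed.
Lemma code_cases c : is_code mem c ->
  atom mem c \/ exists x y, c = ⟨x, y⟩ /\ is_code mem x /\ is_code mem y.
Proof.
  intros (t & Hc & Ht); destruct (Ht c Hc) as [|(x & y & Hx & Hy & E)]; auto.
  apply is_pair_iff in E; right; exists x, y; split; [exact E|split; exists t; auto].
Qed.
Lemma code_fml p : is_fml mem None p -> is_code mem p.
Proof.
  assert (code_nat : forall i, i ∈ omega -> is_code mem i)
    by (intros i Hi; apply code_ord, ord_nat, Hi).
  revert p; induct_with fml_ind; [definability| | |congruence| | |];
    intros; repeat apply code_opair; auto using num_in_omega.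
Qed.

Lemma rank_lt_iff x y : rank_lt mem x y <-> rank x ∈ rank y.
Proof.
  split.
  - intros (v & a & Hv & Hx & Hy); apply is_Vlevel_iff in Hv; destruct Hv as [Oa ->].
    rewrite in_Vlevel_iff_rank in Hx, Hy by exact Oa.
    destruct (ord_mem_or_ole (ord_rank y) Oa) as [|Hle]; [tauto|].
    exact (mem_ole_trans (ord_rank y) Hx Hle).
  - intros Hlt; exists (Vlevel (rank y)), (rank y).
    rewrite is_Vlevel_iff, !in_Vlevel_iff_rank by apply ord_rank.
    auto using ord_rank, mem_irrefl.
Qed.

Lemma code_lt_step_iff L x y : code_lt_step mem L x y <-> rank x ∈ rank y \/
  (~ rank y ∈ rank x /\ ((atom mem x /\ (atom mem y -> atom_lt mem x y)) \/
    (~ atom mem x /\ ~ atom mem y /\ exists x1 x2 y1 y2, x = ⟨x1, x2⟩ /\ y = ⟨y1, y2⟩ /\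
      (L x1 y1 \/ (x1 = y1 /\ L x2 y2))))).
Proof.
  unfold code_lt_step; setoid_rewrite is_pair_iff; rewrite !rank_lt_iff; reflexivity.
Qed.

Lemma code_lt_step_congr L L' x y :
  (forall u v, rank u ∈ rank x -> rank v ∈ rank y -> (L u v <-> L' u v)) ->
  (code_lt_step mem L x y <-> code_lt_step mem L' x y).
Proof.
  intros agree; rewrite !code_lt_step_iff; apply or_iff_compat_l, and_iff_compat_l.
  apply or_iff_compat_l, and_iff_compat_l, and_iff_compat_l.
  split; intros (x1 & x2 & y1 & y2 & -> & -> & Hlt); exists x1, x2, y1, y2;
    rewrite !agree in * by auto using rank_opair_l, rank_opair_r; auto.
Qed.

Lemma code_order_exists a : ord mem a ->
  exists A, A ⊆ cart (Vlevel a) (Vlevel a) /\ is_code_order mem A (Vlevel a).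
Proof.
  intros Oa.
  destruct (@set_recursion (cart (Vlevel a) (Vlevel a)) (fun z => rank (pr1 z))
    (fun A z => exists x y, z = ⟨x, y⟩ /\ code_lt_step mem (gr mem A) x y)) as (A & HA & step);
    [definability|definability|intros; apply ord_rank|].
  exists A; split; [exact HA|]; intros x y Hx Hy.
  rewrite gr_iff, step by (apply opair_in_cart; auto).
  rewrite (@code_lt_step_congr _ (gr mem (sep A (fun z => rank (pr1 z) ∈ rank (pr1 ⟨x, y⟩))))).
  - split; [|eauto]; intros (x' & y' & E & Hlt); opair_injection; subst; exact Hlt.
  - intros u v Hu _; rewrite !gr_iff, mem_sep, !pr1_opair by definability; tauto.
Qed.

Lemma code_order_agree a b A B : ord mem a -> ord mem b ->
  is_code_order mem A (Vlevel a) -> is_code_order mem B (Vlevel b) ->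
  forall x y, x ∈ Vlevel a -> y ∈ Vlevel a -> x ∈ Vlevel b -> y ∈ Vlevel b ->
    (gr mem A x y <-> gr mem B x y).
Proof.
  intros Oa Ob HA HB.
  induct_with rank_ind; [definability|].
  intros x IH y Hxa Hya Hxb Hyb; rewrite (HA x y), (HB x y) by assumption.
  apply code_lt_step_congr; intros u v Hu Hv.
  rewrite in_Vlevel_iff_rank in Hxa, Hya, Hxb, Hyb by assumption.
  apply IH; auto; apply in_Vlevel_iff_rank; eauto using ord_mem_trans.
Qed.

Lemma code_lt_iff_order a A x y : ord mem a -> is_code_order mem A (Vlevel a) ->
  x ∈ Vlevel a -> y ∈ Vlevel a -> (code_lt mem x y <-> gr mem A x y).
Proof.
  intros Oa HA Hx Hy; split.
  - intros (B & v & b & Hv & Hxv & Hyv & HB & Hlt); apply is_Vlevel_iff in Hv.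
    destruct Hv as [Ob ->]; exact (proj1 (code_order_agree Ob Oa HB HA Hxv Hyv Hx Hy) Hlt).
  - intros Hlt; exists A, (Vlevel a), a; rewrite is_Vlevel_iff; auto 7.
Qed.

Lemma common_level x y : exists a, ord mem a /\ x ∈ Vlevel a /\ y ∈ Vlevel a.
Proof.
  exists (succ (rank (upair x y))); assert (Hxy := in_Vlevel_succ_rank (upair x y)).
  assert (O := ord_succ (ord_rank (upair x y))).
  split; [exact O|]; split; apply (Vlevel_mem O Hxy); [apply upair_l|apply upair_r].
Qed.

Lemma code_lt_iff_step x y : code_lt mem x y <-> code_lt_step mem (code_lt mem) x y.
Proof.
  destruct (common_level x y) as (a & Oa & Hx & Hy).
  destruct (code_order_exists Oa) as (A & _ & HA).
  rewrite (code_lt_iff_order Oa HA Hx Hy), (HA x y Hx Hy).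
  apply code_lt_step_congr; intros u v Hu Hv; symmetry.
  rewrite in_Vlevel_iff_rank in Hx, Hy by exact Oa.
  apply (code_lt_iff_order Oa HA); apply in_Vlevel_iff_rank; eauto using ord_mem_trans.
Qed.

Lemma code_lt_asym x y : code_lt mem x y -> ~ code_lt mem y x.
Proof.
  revert x y; induct_with rank_ind; [definability|].
  intros x IH y Hxy Hyx; rewrite code_lt_iff_step, code_lt_step_iff in Hxy, Hyx.
  destruct Hxy as [Hxy|[Nyx Hxy]], Hyx as [Hyx|[Nxy Hyx]]; try tauto.
  { exact (mem_asym Hxy Hyx). }
  destruct Hxy as [[Ax Hxy]|(Nx & Ny & x1 & x2 & y1 & y2 & -> & -> & Hxy)];
    destruct Hyx as [[Ay Hyx]|(Ny' & Nx' & z1 & z2 & w1 & w2 & E & E' & Hyx)]; try tauto.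
  { exact (atom_lt_asym Ax Ay (Hxy Ay) (Hyx Ax)). }
  opair_injection; subst z1 z2 w1 w2; assert (R := rank_opair_l x1 x2).
  destruct Hxy as [Hxy|[<- Hxy]], Hyx as [Hyx|[E' Hyx]].
  - exact (IH x1 R y1 Hxy Hyx).
  - rewrite E' in Hxy; exact (IH x1 R x1 Hxy Hxy).
  - exact (IH x1 R x1 Hyx Hyx).
  - exact (IH x2 (rank_opair_r x1 x2) y2 Hxy Hyx).
Qed.

Definition domain (f : V) : V := sep (union (union f)) (fun x => exists y, ⟨x, y⟩ ∈ f).
Lemma mem_domain f x : x ∈ domain f <-> exists y, ⟨x, y⟩ ∈ f.
Proof.
  unfold domain; rewrite mem_sep by definability; split; [tauto|].
  intros [y Hxy]; split; [apply (opair_in_union2 Hxy)|eauto].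
Qed.
Definition fiber (f x : V) : V := sep (union (union f)) (fun y => ⟨x, y⟩ ∈ f).
Lemma mem_fiber f x y : y ∈ fiber f x <-> ⟨x, y⟩ ∈ f.
Proof.
  unfold fiber; rewrite mem_sep by definability; split; [tauto|].
  intros Hxy; split; [apply (opair_in_union2 Hxy)|exact Hxy].
Qed.

Lemma code_lt_of_rank x y : rank x ∈ rank y -> code_lt mem x y.
Proof. intros Hlt; apply code_lt_iff_step, code_lt_step_iff; auto. Qed.
Lemma code_lt_of_atom x y : rank x = rank y -> atom mem x ->
  (atom mem y -> atom_lt mem x y) -> code_lt mem x y.
Proof.
  intros E Ax Hlt; apply code_lt_iff_step, code_lt_step_iff; right.
  rewrite E; auto using mem_irrefl.
Qed.
Lemma code_lt_of_opair x1 x2 y1 y2 :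
  rank ⟨x1, x2⟩ = rank ⟨y1, y2⟩ -> ~ atom mem ⟨x1, x2⟩ -> ~ atom mem ⟨y1, y2⟩ ->
  code_lt mem x1 y1 \/ (x1 = y1 /\ code_lt mem x2 y2) -> code_lt mem ⟨x1, x2⟩ ⟨y1, y2⟩.
Proof.
  intros E Nx Ny Hlt; apply code_lt_iff_step, code_lt_step_iff; right.
  rewrite E; split; [apply mem_irrefl|eauto 10].
Qed.

Lemma code_least_of_opairs Y r :
  (forall c, c ∈ Y -> is_code mem c /\ ~ atom mem c /\ rank c = r) -> (exists c, c ∈ Y) ->
  (forall Z, (forall c, c ∈ Z -> is_code mem c) -> (exists c, c ∈ Z /\ rank c ∈ r) ->
     has_least (code_lt mem) Z) ->
  has_least (code_lt mem) Y.
Proof.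
  intros HY [c0 Hc0] IH.
  assert (pair_Y : forall c, c ∈ Y -> exists x y,
    c = ⟨x, y⟩ /\ is_code mem x /\ is_code mem y /\ rank x ∈ r /\ rank y ∈ r).
  { intros c Hc; destruct (HY c Hc) as (Cc & Nc & <-).
    destruct (code_cases Cc) as [|(x & y & -> & Cx & Cy)]; [tauto|].
    exists x, y; auto using rank_opair_l, rank_opair_r. }
  assert (comp_Y : forall x y, ⟨x, y⟩ ∈ Y ->
    is_code mem x /\ is_code mem y /\ rank x ∈ r /\ rank y ∈ r).
  { intros x y Hxy; destruct (pair_Y _ Hxy) as (x' & y' & E & Hcomp).
    opair_injection; subst; auto. }
  destruct (IH (domain Y)) as (x & Hx & min_x).
  { intros x Hx; apply mem_domain in Hx; destruct Hx as [y Hxy]; apply (comp_Y x y Hxy). }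
  { destruct (pair_Y c0 Hc0) as (x0 & y0 & -> & _ & _ & Hr & _).
    exists x0; split; [apply mem_domain; eauto|exact Hr]. }
  destruct (IH (fiber Y x)) as (y & Hy & min_y).
  { intros y Hy; apply mem_fiber in Hy; apply (comp_Y x y Hy). }
  { apply mem_domain in Hx; destruct Hx as [y Hxy]; exists y.
    split; [apply mem_fiber, Hxy|apply (comp_Y x y Hxy)]. }
  apply mem_fiber in Hy; exists ⟨x, y⟩; split; [exact Hy|]; intros c Hc.
  destruct (pair_Y c Hc) as (x' & y' & -> & _).
  destruct (HY _ Hy) as (_ & Nxy & Exy), (HY _ Hc) as (_ & Nxy' & Exy').
  assert (E : rank ⟨x, y⟩ = rank ⟨x', y'⟩) by congruence.
  destruct (min_x x') as [-> |Hlt]; [apply mem_domain; eauto| |].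
  - destruct (min_y y') as [-> |Hlt]; [apply mem_fiber, Hc|auto|].
    right; apply code_lt_of_opair; auto.
  - right; apply code_lt_of_opair; auto.
Qed.

Lemma code_least_of_atom Y r : (forall c, c ∈ Y -> rank c = r) ->
  (exists a, a ∈ Y /\ atom mem a) -> has_least (code_lt mem) Y.
Proof.
  intros rank_Y (a0 & Ha0 & Aa0).
  assert (mem_atoms : forall a, a ∈ sep Y (atom mem) <-> a ∈ Y /\ atom mem a)
    by (intros a; apply mem_sep; definability).
  destruct (@atom_least (sep Y (atom mem)) r) as (a & Ha & min_a).
  - intros a Ha; apply mem_atoms in Ha; destruct Ha; auto.
  - exists a0; apply mem_atoms; auto.
  - apply mem_atoms in Ha; destruct Ha as [Ha Aa]; exists a; split; [exact Ha|]; intros c Hc.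
    destruct (classic (c = a)) as [|Nca]; [auto|right].
    apply code_lt_of_atom; [rewrite (rank_Y a Ha), (rank_Y c Hc); reflexivity|exact Aa|].
    intros Ac; destruct (min_a c) as [|]; [apply mem_atoms; auto|congruence|assumption].
Qed.

Lemma code_least_of_min_rank X r : (forall c, c ∈ X -> rank c = r \/ r ∈ rank c) ->
  has_least (code_lt mem) (sep X (fun c => rank c = r)) -> has_least (code_lt mem) X.
Proof.
  intros rank_X (c & Hc & min_c); apply mem_sep in Hc; [|definability].
  destruct Hc as [Hc Ec]; exists c; split; [exact Hc|]; intros d Hd.
  destruct (rank_X d Hd) as [Ed|Hlt].
  - apply min_c, mem_sep; [definability|auto].
  - right; apply code_lt_of_rank; rewrite Ec; exact Hlt.
Qed.

Lemma code_least X : (forall c, c ∈ X -> is_code mem c) -> (exists c, c ∈ X) ->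
  has_least (code_lt mem) X.
Proof.
  intros HX [c0 Hc0].
  assert (by_rank : forall r, ord mem r -> forall X, (forall c, c ∈ X -> is_code mem c) ->
    (exists c, c ∈ X /\ rank c = r) -> has_least (code_lt mem) X);
    [|apply (by_rank _ (ord_rank c0) X HX); eauto].
  clear X HX c0 Hc0.
  induct_with ord_ind; [unfold has_least; definability|].
  intros r Or IH X HX (c0 & Hc0 & Ec0).
  destruct (classic (exists c, c ∈ X /\ rank c ∈ r)) as [(c & Hc & Hr)|N];
    [exact (IH _ Hr X HX (ex_intro _ c (conj Hc eq_refl)))|].
  apply (@code_least_of_min_rank X r).
  { intros c Hc; destruct (ord_trichotomy (ord_rank c) Or) as [Hlt|]; [|auto].
    destruct N; eauto. }
  assert (mem_Y : forall c, c ∈ sep X (fun c => rank c = r) <-> c ∈ X /\ rank c = r)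
    by (intros c; apply (@mem_sep X (fun c => rank c = r)); definability).
  destruct (classic (exists a, a ∈ sep X (fun c => rank c = r) /\ atom mem a)) as [Hatom|Natom].
  - apply (@code_least_of_atom _ r); [intros c Hc; apply mem_Y, Hc|exact Hatom].
  - apply (@code_least_of_opairs _ r).
    + intros c Hc; split; [|split]; [apply HX, mem_Y, Hc|eauto|apply mem_Y, Hc].
    + exists c0; apply mem_Y; auto.
    + intros Z HZ (c & Hc & Hr); apply (IH (rank c) Hr Z HZ); eauto.
Qed.

Lemma least_code_unique P c c' : least_code mem P c -> least_code mem P c' -> c = c'.
Proof.
  intros (Cc & Pc & least) (Cc' & Pc' & least').
  destruct (least c' Cc' Pc') as [|Hlt]; [auto|].
  destruct (least' c Cc Pc) as [|Hlt']; [auto|destruct (code_lt_asym Hlt Hlt')].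
Qed.
Lemma least_code_congr P P' c : (forall d, P d <-> P' d) ->
  (least_code mem P c <-> least_code mem P' c).
Proof.
  intros E; unfold least_code; rewrite E; setoid_rewrite E; reflexivity.
Qed.
Lemma least_code_exists P c0 : definable_pred P -> is_code mem c0 -> P c0 ->
  exists c, least_code mem P c /\ ole mem (rank c) (rank c0).
Proof.
  intros HP Cc0 Pc0; assert (O := ord_succ (ord_rank c0)).
  set (X := sep (Vlevel (succ (rank c0))) (fun c => is_code mem c /\ P c)).
  assert (mem_X : forall c, c ∈ X <-> ole mem (rank c) (rank c0) /\ is_code mem c /\ P c).
  { intros c; unfold X; rewrite mem_sep, in_Vlevel_iff_rank, mem_succ by (auto || definability).
    reflexivity. }
  destruct (@code_least X) as (c & Hc & min_c).
  - intros c Hc; apply mem_X, Hc.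
  - exists c0; apply mem_X; split; [right; reflexivity|auto].
  - apply mem_X in Hc; destruct Hc as (Hr & Cc & Pc); exists c; split; [|exact Hr].
    split; [exact Cc|]; split; [exact Pc|]; intros d Cd Pd.
    destruct (ord_mem_or_ole (ord_rank c0) (ord_rank d)) as [Hlt|Hle].
    + right; apply code_lt_of_rank, (ole_mem_trans (ord_rank d) Hr Hlt).
    + apply min_c, mem_X; auto.
Qed.

(** * Codes of ordinal definable sets *)

Lemma decodes_iff c x : decodes mem c x <-> exists a p s eta, c = ⟨⟨a, ⟨p, s⟩⟩, eta⟩ /\
  ord mem a /\ x ∈ Vlevel a /\ is_fml mem None p /\ is_fun mem s omega a /\
  forall u t, u ∈ Vlevel a -> assign mem (Vlevel a) t -> is_scons mem t u s ->
    (sat mem (Vlevel a) None p t <-> u = x).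
Proof.
  unfold decodes; split.
  - intros (a & p & s & eta & q & r & v & Hq & Hr & Hc & Hv & Hx & Hp & (w & Hw & Hs) & Hdef).
    apply is_pair_iff in Hq, Hr, Hc; apply is_Vlevel_iff in Hv; apply is_omega_iff in Hw.
    destruct Hv as [Oa ->]; subst; exists a, p, s, eta; auto 7.
  - intros (a & p & s & eta & -> & Oa & Hx & Hp & Hs & Hdef).
    exists a, p, s, eta, ⟨p, s⟩, ⟨a, ⟨p, s⟩⟩, (Vlevel a).
    rewrite !is_pair_iff, is_Vlevel_iff; do 6 (split; [auto|]).
    split; [exists omega; auto using is_omega_omega|exact Hdef].
Qed.

Lemma assign_Vlevel s a : ord mem a -> is_fun mem s omega a -> assign mem (Vlevel a) s.
Proof.
  intros Oa Hs; apply assign_mono with a; [|apply assign_iff, Hs].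
  intros z Hz; apply ord_in_Vlevel; eauto using ord_mem.
Qed.

Lemma decodes_unique c x x' : decodes mem c x -> decodes mem c x' -> x = x'.
Proof.
  intros Hx Hx'; apply decodes_iff in Hx, Hx'.
  destruct Hx as (a & p & s & eta & -> & Oa & Hx & Hp & Hs & Hdef).
  destruct Hx' as (a' & p' & s' & eta' & E & _ & _ & _ & _ & Hdef').
  opair_injection; subst a' p' s'.
  destruct (scons_exists (assign_Vlevel Oa Hs) Hx) as (t & Ht & Hts).
  apply (Hdef' x t Hx Ht Hts), (Hdef x t Hx Ht Hts); reflexivity.
Qed.

Lemma OD_decodes x : OD mem x -> exists r, forall eta, ord mem eta ->
  is_code mem ⟨r, eta⟩ /\ decodes mem ⟨r, eta⟩ x.
Proof.
  intros (a & v & p & s & Hv & Hx & Hp & (w & Hw & Hs) & (n & Hn & Hsupp) & Hdef).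
  apply is_Vlevel_iff in Hv; destruct Hv as [Oa ->]; apply is_omega_iff in Hw; subst w.
  apply is_nat_iff in Hn.
  assert (code_s : is_code mem s).
  { apply code_atom; right; apply fin_supp_iff; split; [split; [|split]|].
    - intros q Hq; apply (pfun_sub_cart (proj1 Hs)), mem_cart in Hq.
      destruct Hq as (i & b & Hi & Hb & ->); eauto 7 using ord_mem.
    - intros i Hi; destruct (fun_total Hs Hi) as (b & _ & Hib); eauto.
    - intros i b b'; apply (pfun_functional (proj1 Hs)).
    - exists n; split; [exact Hn|]; intros i b Hi Nin.
      apply is_empty_iff, (Hsupp i b); [apply gr_iff|]; assumption. }
  exists ⟨a, ⟨p, s⟩⟩; intros eta Oeta; split.
  - auto using code_opair, code_ord, code_fml.
  - apply decodes_iff; exists a, p, s, eta; auto 7.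
Qed.

Lemma HOD_OD x : HOD mem x -> OD mem x.
Proof.
  intros (u & t & Hu & (_ & Ht & _) & OD_t); apply OD_t, Ht.
  apply is_upair_iff in Hu; subst; apply upair_l.
Qed.

(* x is the set u with V_(x + 1) |= u = x_1. *)
Lemma ord_OD x : ord mem x -> OD mem x.
Proof.
  intros Ox; assert (Oa := ord_succ Ox).
  destruct (@fun_exists omega (succ x)
    (fun i b => (i = empty /\ b = x) \/ (i <> empty /\ b = empty))) as (s & Hs & mem_s).
  { definability. }
  { intros i _; destruct (classic (i = empty)); [exists x|exists empty]; split; auto;
      apply mem_succ, ord_sub_iff_ole; auto using ord_empty, sub_refl.
    intros z Hz; destruct (not_mem_empty Hz). }
  { intros i b b' _ [[]|[]] [[]|[]]; congruence. }
  exists (succ x), (Vlevel (succ x)), (cEq (num 0) (num 1)), s.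
  split; [apply is_Vlevel_iff; auto|].
  split; [apply ord_in_Vlevel; auto using mem_succ_self|].
  split; [auto with fml|]; split; [exists omega; auto using is_omega_omega|]; split.
  - exists (num 1); split; [apply is_nat_iff, num_in_omega|].
    intros i b Hi N; apply gr_iff, mem_s in Hi; apply is_empty_iff.
    destruct Hi as (_ & _ & [[-> _]|[_ Hb]]); [destruct N; apply mem_succ_self|exact Hb].
  - intros u t Hu Ht Hts; apply is_scons_iff in Hts; destruct Hts as [Ht0 HtS].
    assert (Ht1 : ⟨num 1, x⟩ ∈ t)
      by (apply HtS, mem_s; auto using empty_in_omega, mem_succ_self).
    rewrite (sat_cEq_of_value None Ht Ht0) by auto with fml; split; [|intros ->; exact Ht1].
    intros Hu1; exact (assign_functional Ht Hu1 Ht1).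
Qed.

(** * Absoluteness of limit levels *)

Create HintDb absolute discriminated.

Section Absoluteness.

Context (lam : V) (limit_lam : limit mem lam) (omega_lam : omega ∈ lam).
Let ord_lam : ord mem lam := proj1 limit_lam.
Local Notation W := (carrier (Vlevel lam)).
Local Notation memW := (@cmem (Vlevel lam)).
Local Notation "! x" := (proj1_sig x) (at level 1).

Lemma carrier_in (x : W) : !x ∈ Vlevel lam.
Proof. apply proj2_sig. Qed.
Lemma abs_all (P : W -> Prop) (Q : V -> Prop) :
  (forall z : W, P z <-> Q !z) -> (forall z, ~ Q z -> z ∈ Vlevel lam) ->
  ((forall z, P z) <-> (forall z, Q z)).
Proof.
  intros E HQ; split; intros Hall z; [|apply E, Hall].
  apply NNPP; intros N; apply N; apply (E (exist _ z (HQ z N))), Hall.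
Qed.
Lemma abs_ex (P : W -> Prop) (Q : V -> Prop) :
  (forall z : W, P z <-> Q !z) -> (forall z, Q z -> z ∈ Vlevel lam) ->
  ((exists z, P z) <-> (exists z, Q z)).
Proof.
  intros E HQ; split; intros [z Hz]; [exists !z; apply E, Hz|].
  exists (exist _ z (HQ z Hz)); apply E, Hz.
Qed.
Lemma and_congr (A A' B B' : Prop) :
  (A <-> A') -> (A' -> (B <-> B')) -> (A /\ B <-> A' /\ B').
Proof. tauto. Qed.
Lemma imp_congr (A A' B B' : Prop) :
  (A <-> A') -> (A' -> (B <-> B')) -> ((A -> B) <-> (A' -> B')).
Proof. tauto. Qed.
Lemma or_congr (A A' B B' : Prop) : (A <-> A') -> (B <-> B') -> (A \/ B <-> A' \/ B').
Proof. tauto. Qed.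
Lemma iff_congr (A A' B B' : Prop) :
  (A <-> A') -> (B <-> B') -> ((A <-> B) <-> (A' <-> B')).
Proof. tauto. Qed.

Lemma el_in_level x y : x ∈ Vlevel lam -> y ∈ x -> y ∈ Vlevel lam.
Proof. exact (Vlevel_mem ord_lam). Qed.
Lemma sub_in_level x y : x ∈ Vlevel lam -> y ⊆ x -> y ∈ Vlevel lam.
Proof. exact (Vlevel_sub ord_lam). Qed.
Lemma omega_in_level : omega ∈ Vlevel lam.
Proof. apply ord_in_Vlevel; auto using ord_omega. Qed.
Lemma num_in_level n : num n ∈ Vlevel lam.
Proof. exact (el_in_level omega_in_level (num_in_omega n)). Qed.
Lemma fml_in_level p : is_fml mem None p -> p ∈ Vlevel lam.
Proof.
  intros Hp; apply (el_in_level (Vlevel_in_Vlevel ord_lam omega_lam)).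
  exact (fml_in_Vlevel_omega Hp).
Qed.
Lemma cart_in_level a b : a ∈ Vlevel lam -> b ∈ Vlevel lam -> cart a b ∈ Vlevel lam.
Proof.
  intros Ha Hb; apply sub_in_level with (powerset (powerset (cup a b))); [|apply cart_sub].
  auto using Vlevel_powerset, Vlevel_cup.
Qed.
Lemma dom_in_level f x y : f ∈ Vlevel lam -> ⟨x, y⟩ ∈ f -> x ∈ Vlevel lam.
Proof. intros Hf Hxy; apply (Vlevel_opair_inv limit_lam (el_in_level Hf Hxy)). Qed.
Lemma cod_in_level f x y : f ∈ Vlevel lam -> ⟨x, y⟩ ∈ f -> y ∈ Vlevel lam.
Proof. intros Hf Hxy; apply (Vlevel_opair_inv limit_lam (el_in_level Hf Hxy)). Qed.
Lemma pfun_in_level f a b : is_pfun mem f a b -> a ∈ Vlevel lam -> b ∈ Vlevel lam ->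
  f ∈ Vlevel lam.
Proof. intros Hf Ha Hb; exact (sub_in_level (cart_in_level Ha Hb) (pfun_sub_cart Hf)). Qed.
Lemma assign_in_level M s : assign mem M s -> M ∈ Vlevel lam -> s ∈ Vlevel lam.
Proof.
  intros Hs HM; apply assign_iff in Hs.
  exact (pfun_in_level (proj1 Hs) omega_in_level HM).
Qed.
Lemma Vlevel_in_level a : a ∈ Vlevel lam -> ord mem a -> Vlevel a ∈ Vlevel lam.
Proof. intros Ha Oa; apply (Vlevel_in_Vlevel ord_lam), (ord_in_Vlevel ord_lam Oa), Ha. Qed.

(* The two side conditions of abs_all and abs_ex: a witness of the body lies in
   V_lam, because it is an element, a subset, a component or a value of a
   definable operation of sets in V_lam. *)
Ltac normalize_notions :=
  repeat match goal with
  | H : _ /\ _ |- _ => destruct H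
  | H : exists _, _ |- _ => destruct H
  | H : _ \/ _ |- _ => destruct H
  | H : ole _ _ _ |- _ => destruct H
  | H : is_empty mem _ |- _ => apply is_empty_iff in H
  | H : is_upair mem _ _ _ |- _ => apply is_upair_iff in H
  | H : is_pair mem _ _ _ |- _ => apply is_pair_iff in H
  | H : gr mem _ _ _ |- _ => apply gr_iff in H
  | H : is_succ mem _ _ |- _ => apply is_succ_iff in H
  | H : is_pow mem _ _ |- _ => apply is_pow_iff in H
  | H : is_omega mem _ |- _ => apply is_omega_iff in H
  | H : is_nat mem _ |- _ => apply is_nat_iff in H
  | H : is_num mem _ _ |- _ => apply is_num_iff in H
  | H : code1 mem _ _ _ |- _ => apply code1_iff in H
  | H : code2 mem _ _ _ _ |- _ => apply code2_iff in H
  | H : is_Vlevel mem _ _ |- _ => apply is_Vlevel_iff in H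
  | H : injects mem _ _ |- _ => destruct H
  end; subst;
  repeat match goal with
  | H : !?x = ⟨?a, ?b⟩ |- _ =>
      assert (⟨a, b⟩ ∈ Vlevel lam) by (rewrite <- H; apply carrier_in); clear H
  | H : ⟨_, _⟩ ∈ Vlevel lam |- _ => apply (Vlevel_opair_inv limit_lam) in H; destruct H
  end.
Ltac in_level :=
  match goal with
  | |- !_ ∈ _ => apply carrier_in
  | |- empty ∈ _ => exact (Vlevel_empty limit_lam)
  | |- omega ∈ _ => exact omega_in_level
  | |- num _ ∈ _ => apply num_in_level
  | H : ?x ∈ Vlevel lam |- ?x ∈ Vlevel lam => exact H
  | |- upair _ _ ∈ _ => apply (Vlevel_upair limit_lam); in_level
  | |- ⟨_, _⟩ ∈ _ => apply (Vlevel_opair limit_lam); in_level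
  | |- succ _ ∈ _ => apply (Vlevel_succ limit_lam); in_level
  | |- powerset _ ∈ _ => apply (Vlevel_powerset limit_lam); in_level
  | |- Vlevel _ ∈ _ => apply Vlevel_in_level; [in_level|assumption]
  | H : ?x ∈ ?y |- ?x ∈ Vlevel lam => apply (@el_in_level y); [in_level|exact H]
  | H : ⟨?x, _⟩ ∈ ?f |- ?x ∈ Vlevel lam => refine (dom_in_level _ H); in_level
  | H : ⟨_, ?x⟩ ∈ ?f |- ?x ∈ Vlevel lam => refine (cod_in_level _ H); in_level
  | H : ?x ⊆ ?y |- ?x ∈ Vlevel lam => apply (@sub_in_level y); [in_level|exact H]
  | H : is_pfun mem ?x _ _ |- ?x ∈ Vlevel lam => apply (pfun_in_level H); in_level
  | H : is_fun mem ?x _ _ |- ?x ∈ Vlevel lam => apply (pfun_in_level (proj1 H)); in_level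
  | H : is_inj mem ?x _ _ |- ?x ∈ Vlevel lam =>
      apply (pfun_in_level (proj1 (proj1 H))); in_level
  | H : assign mem _ ?x |- ?x ∈ Vlevel lam => apply (assign_in_level H); in_level
  | H : is_fml mem None ?x |- ?x ∈ Vlevel lam => apply (fml_in_level H)
  end.
Ltac witness_in_level := intros; normalize_notions; in_level.
Ltac counterexample_in_level :=
  let z := fresh "z" in let N := fresh in let Nz := fresh in
  intros z N; apply NNPP; intros Nz; apply N; clear N;
  repeat lazymatch goal with
    | |- _ /\ _ => split
    | |- _ <-> _ => split
    | |- forall _, _ => intro
    | |- ~ _ => intro
    end; exfalso; apply Nz; clear Nz; normalize_notions; in_level.
Ltac absoluteness := intros; cbv beta;
  lazymatch goal with
  | |- (_ /\ _) <-> (_ /\ _) => apply and_congr; [absoluteness|intro; absoluteness]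
  | |- (_ \/ _) <-> (_ \/ _) => apply or_congr; absoluteness
  | |- (_ <-> _) <-> (_ <-> _) => apply iff_congr; absoluteness
  | |- (~ _) <-> (~ _) => apply not_iff_compat; absoluteness
  | |- True <-> True => reflexivity
  | |- (forall x : carrier _, @?P x) <-> (forall z, @?Q z) =>
      apply (@abs_all P Q); [intro; absoluteness|try solve [counterexample_in_level]]
  | |- (exists x : carrier _, @?P x) <-> (exists z, @?Q z) =>
      apply (@abs_ex P Q); [intro; absoluteness|try solve [witness_in_level]]
  | |- (_ -> _) <-> (_ -> _) => apply imp_congr; [absoluteness|intro; absoluteness]
  | |- ?x = ?y <-> _ => apply (carrier_eq x y)
  | |- cmem _ _ <-> mem _ _ => reflexivity
  | |- _ => first [solve [auto 1 with absolute nocore] | idtac]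
  end.

Local Notation absolute1 R := (forall x, R memW x <-> R mem !x).
Local Notation absolute2 R := (forall x y, R memW x y <-> R mem !x !y).
Local Notation absolute3 R := (forall x y z, R memW x y z <-> R mem !x !y !z).

Lemma absolute_sub : absolute2 (@sub _).
Proof. unfold sub; absoluteness. Qed.
Lemma absolute_is_empty : absolute1 (@is_empty _).
Proof. unfold is_empty; absoluteness. Qed.
Lemma absolute_is_upair : absolute3 (@is_upair _).
Proof. unfold is_upair; absoluteness. Qed.
Lemma absolute_is_succ : absolute2 (@is_succ _).
Proof. unfold is_succ; absoluteness. Qed.
Lemma absolute_ole : absolute2 (@ole _).
Proof. unfold ole; absoluteness. Qed.
Lemma absolute_transitive : absolute1 (@transitive _).
Proof. unfold transitive, sub; absoluteness. Qed.
Hint Resolve absolute_sub absolute_is_empty absolute_is_upair absolute_is_succ absolute_ole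
  absolute_transitive : absolute.
Lemma absolute_is_pow : absolute2 (@is_pow _).
Proof. unfold is_pow; absoluteness. Qed.
Lemma absolute_is_pair : absolute3 (@is_pair _).
Proof. unfold is_pair; absoluteness. Qed.
Lemma absolute_ord : absolute1 (@ord _).
Proof. unfold ord; absoluteness. Qed.
Hint Resolve absolute_is_pow absolute_is_pair absolute_ord : absolute.
Lemma absolute_gr : absolute3 (@gr _).
Proof. unfold gr; absoluteness. Qed.
Lemma absolute_limit : absolute1 (@limit _).
Proof. unfold limit; absoluteness. Qed.
Hint Resolve absolute_gr absolute_limit : absolute.
Lemma absolute_is_pfun : absolute3 (@is_pfun _).
Proof. unfold is_pfun; absoluteness. Qed.
Lemma absolute_is_omega : absolute1 (@is_omega _).
Proof. unfold is_omega; absoluteness. Qed.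
Lemma absolute_is_hierarchy : absolute3 (@is_hierarchy _).
Proof. unfold is_hierarchy; absoluteness. Qed.
Lemma absolute_is_scons : absolute3 (@is_scons _).
Proof. unfold is_scons; absoluteness. Qed.
Hint Resolve absolute_is_pfun absolute_is_omega absolute_is_hierarchy absolute_is_scons
  : absolute.
Lemma absolute_is_fun : absolute3 (@is_fun _).
Proof. unfold is_fun; absoluteness. Qed.
Lemma absolute_is_nat : absolute1 (@is_nat _).
Proof. unfold is_nat; absoluteness. Qed.
Hint Resolve absolute_is_fun absolute_is_nat : absolute.
Lemma absolute_is_inj : absolute3 (@is_inj _).
Proof. unfold is_inj; absoluteness. Qed.
Lemma absolute_assign : absolute2 (@assign _).
Proof. unfold assign; absoluteness. Qed.
Hint Resolve absolute_is_inj absolute_assign : absolute.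
Lemma absolute_injects : absolute2 (@injects _).
Proof. unfold injects; absoluteness. Qed.
Hint Resolve absolute_injects : absolute.
Lemma absolute_card_lt : absolute2 (@card_lt _).
Proof. unfold card_lt; absoluteness. Qed.
Hint Resolve absolute_card_lt : absolute.
Lemma absolute_inaccessible : absolute1 (@inaccessible _).
Proof. unfold inaccessible, cardinal, regular, strong_limit; absoluteness. Qed.
Hint Resolve absolute_inaccessible : absolute.

Lemma absolute_is_num n x : is_num memW n x <-> is_num mem n !x.
Proof.
  revert x; induction n as [|n IH]; intros x; cbn [is_num]; [apply absolute_is_empty|].
  apply (@abs_ex (fun y => is_num memW n y /\ is_succ memW x y)
    (fun y => is_num mem n y /\ is_succ mem !x y)); [|witness_in_level].
  intros y; apply and_congr; [apply IH|intros; apply absolute_is_succ].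
Qed.
Hint Resolve absolute_is_num : absolute.
Lemma absolute_code1 n x y : code1 memW n x y <-> code1 mem n !x !y.
Proof. unfold code1; absoluteness. Qed.
Hint Resolve absolute_code1 : absolute.
Lemma absolute_code2 n x y z : code2 memW n x y z <-> code2 mem n !x !y !z.
Proof. unfold code2; absoluteness. Qed.
Hint Resolve absolute_code2 : absolute.

Lemma absolute_is_Vlevel : absolute2 (@is_Vlevel _).
Proof.
  intros v a; split.
  - intros (Oa & f & Hf); split; [apply absolute_ord, Oa|].
    exists !f; exact (proj1 (absolute_is_hierarchy f v a) Hf).
  - intros Hv; apply is_Vlevel_iff in Hv; destruct Hv as [Oa E].
    split; [apply absolute_ord, Oa|].
    set (f := graph (succ !a) Vlevel).
    assert (Hf : f ∈ Vlevel lam).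
    { apply (sub_in_level (cart_in_level (Vlevel_succ limit_lam (carrier_in a))
        (Vlevel_powerset limit_lam (carrier_in v)))).
      intros p Hp; apply mem_graph in Hp; [|definability]; destruct Hp as (b & Hb & ->).
      apply opair_in_cart; split; auto; apply mem_powerset; rewrite E; apply mem_succ in Hb.
      destruct Hb as [Hb| ->]; [apply Vlevel_mono; auto|apply sub_refl]. }
    exists (exist _ f Hf); apply (absolute_is_hierarchy (exist _ f Hf) v a).
    simpl; rewrite E; apply is_hierarchy_graph, Oa.
Qed.
Hint Resolve absolute_is_Vlevel : absolute.

Lemma absolute_fml_closed X : fml_closed memW None X <-> fml_closed mem None !X.
Proof.
  unfold fml_closed, is_cMem, is_cEq, is_cNeg, is_cAnd, is_cEx; absoluteness.
Qed.
Lemma absolute_is_fml p : is_fml memW None p <-> is_fml mem None !p.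
Proof.
  split; intros Hp X HX; [|apply Hp, absolute_fml_closed, HX].
  set (Y := sep (Vlevel omega) (fun q => q ∈ X)).
  assert (mem_Y : forall q, q ∈ Y <-> q ∈ Vlevel omega /\ q ∈ X)
    by (intros q; apply (@mem_sep _ (fun q => q ∈ X)); definability).
  assert (HY : Y ∈ Vlevel lam).
  { apply (sub_in_level (Vlevel_in_Vlevel ord_lam omega_lam)); intros q Hq; apply mem_Y, Hq. }
  assert (closed_Y : fml_closed mem None Y).
  { assert (HV := fml_closed_Vlevel_omega None); rewrite fml_closed_iff in HX, HV |- *.
    setoid_rewrite mem_Y; split; [|split].
    - intros i j Hi Hj; destruct (proj1 HX i j Hi Hj), (proj1 HV i j Hi Hj); tauto.
    - intros f [HfV HfX]; destruct (proj1 (proj2 HX) f HfX), (proj1 (proj2 HV) f HfV); tauto.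
    - intros f g [HfV HfX] [HgV HgX]; split; [apply HV|apply HX]; assumption. }
  apply (mem_Y !p); apply (Hp (exist _ Y HY)), absolute_fml_closed, closed_Y.
Qed.
Hint Resolve absolute_is_fml : absolute.
Lemma absolute_is_truth M S : is_truth memW M None S <-> is_truth mem !M None !S.
Proof.
  unfold is_truth, is_cMem, is_cEq, is_cNeg, is_cAnd, is_cEx; absoluteness.
Qed.
Lemma absolute_sat M p s : is_fml mem None !p -> assign mem !M !s ->
  (sat memW M None p s <-> sat mem !M None !p !s).
Proof.
  intros Hp Hs; split.
  - intros (S & HS & Hps); exists !S; rewrite <- absolute_is_truth, <- absolute_gr; auto.
  - destruct (truth_exists !M None) as (S & Hbound & HS).
    rewrite (sat_iff_truth HS Hp Hs); intros Hps.
    assert (HSl : S ∈ Vlevel lam).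
    { refine (sub_in_level _ Hbound); apply cart_in_level.
      - exact (Vlevel_in_Vlevel ord_lam omega_lam).
      - exact (Vlevel_powerset limit_lam (cart_in_level omega_in_level (carrier_in M))). }
    exists (exist _ S HSl); rewrite absolute_is_truth, absolute_gr, gr_iff; auto.
Qed.
Lemma absolute_elem_sub M N : elem_sub memW M None N None <-> elem_sub mem !M None !N None.
Proof.
  unfold elem_sub; absoluteness; apply absolute_sat; eauto using assign_mono.
Qed.
Hint Resolve absolute_elem_sub : absolute.

Lemma absolute_uplift : absolute2 (@uplift _).
Proof. unfold uplift; absoluteness. Qed.
Hint Resolve absolute_uplift : absolute.
Lemma absolute_isolated_uplift : absolute2 (@isolated_uplift _).
Proof. unfold isolated_uplift; absoluteness. Qed.
Lemma absolute_fin_supp : absolute1 (@fin_supp _).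
Proof. unfold fin_supp; absoluteness. Qed.
Lemma absolute_fin_supp_lt : absolute2 (@fin_supp_lt _).
Proof. unfold fin_supp_lt; absoluteness. Qed.
Hint Resolve absolute_isolated_uplift absolute_fin_supp absolute_fin_supp_lt : absolute.
Lemma absolute_atom : absolute1 (@atom _).
Proof. unfold atom; absoluteness. Qed.
Lemma absolute_atom_lt : absolute2 (@atom_lt _).
Proof. unfold atom_lt; absoluteness. Qed.
Hint Resolve absolute_atom absolute_atom_lt : absolute.

Lemma absolute_component_closed : absolute1 (@component_closed _).
Proof. unfold component_closed; absoluteness. Qed.
Lemma absolute_is_code : absolute1 (@is_code _).
Proof.
  intros c; split.
  { intros (t & Hc & Ht); exists !t; split; [exact Hc|apply absolute_component_closed, Ht]. }
  intros (t & Hc & Ht).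
  set (r := succ (rank !c)); assert (Or : ord mem r) by apply ord_succ, ord_rank.
  set (u := sep t (fun y => y ∈ Vlevel r)).
  assert (mem_u : forall y, y ∈ u <-> y ∈ t /\ rank y ∈ r).
  { intros y; unfold u; rewrite (@mem_sep t (fun y => y ∈ Vlevel r)) by definability.
    rewrite (in_Vlevel_iff_rank y Or); reflexivity. }
  assert (Hu : u ∈ Vlevel lam).
  { assert (Hr := carrier_in c).
    apply (in_Vlevel_iff_rank _ ord_lam), (limit_succ limit_lam) in Hr.
    apply (sub_in_level (Vlevel_in_Vlevel ord_lam Hr)).
    intros y Hy; apply in_Vlevel_iff_rank, mem_u, Hy; exact Or. }
  exists (exist _ u Hu); split; [apply mem_u; auto using mem_succ_self|].
  apply (absolute_component_closed (exist _ u Hu)); intros y Hy; apply mem_u in Hy.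
  destruct Hy as [Hy Hyr]; destruct (Ht y Hy) as [|(y1 & y2 & Hy1 & Hy2 & E)]; [auto|right].
  exists y1, y2; rewrite !mem_u; apply is_pair_iff in E; subst y.
  rewrite is_pair_iff; eauto 7 using ord_mem_trans, rank_opair_l, rank_opair_r.
Qed.

Lemma absolute_rank_lt : absolute2 (@rank_lt _).
Proof.
  intros x y; split.
  - intros (v & a & Hv & Hx & Hy); exists !v, !a; rewrite <- absolute_is_Vlevel; auto.
  - rewrite rank_lt_iff; intros Hlt.
    set (a := rank !y); assert (Oa : ord mem a) by apply ord_rank.
    assert (Ha : a ∈ Vlevel lam)
      by (apply ord_in_Vlevel, in_Vlevel_iff_rank, carrier_in; auto).
    set (v := Vlevel a); assert (Hv : v ∈ Vlevel lam) by exact (Vlevel_in_level Ha Oa).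
    exists (exist _ v Hv), (exist _ a Ha); rewrite absolute_is_Vlevel; unfold cmem; simpl.
    unfold v; rewrite is_Vlevel_iff, !in_Vlevel_iff_rank by exact Oa.
    auto using mem_irrefl.
Qed.
Hint Resolve absolute_is_code absolute_rank_lt : absolute.
Lemma absolute_code_lt_step A x y :
  code_lt_step memW (gr memW A) x y <-> code_lt_step mem (gr mem !A) !x !y.
Proof. unfold code_lt_step; absoluteness. Qed.
Hint Resolve absolute_code_lt_step : absolute.
Lemma absolute_is_code_order : absolute2 (@is_code_order _).
Proof. unfold is_code_order; absoluteness. Qed.
Lemma absolute_code_lt : absolute2 (@code_lt _).
Proof.
  intros x y; split.
  - intros (A & v & a & Hv & Hx & Hy & HA & Hlt); exists !A, !v, !a.
    rewrite <- absolute_is_Vlevel, <- absolute_is_code_order, <- absolute_gr; auto 6.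
  - intros Hlt.
    destruct (proj1 (mem_Vlevel _ ord_lam) (Vlevel_upair limit_lam (carrier_in x) (carrier_in y)))
      as (a & Ha & Hxy).
    assert (Oa := ord_mem ord_lam Ha).
    assert (Hx : !x ∈ Vlevel a) by apply Hxy, upair_l.
    assert (Hy : !y ∈ Vlevel a) by apply Hxy, upair_r.
    destruct (code_order_exists Oa) as (A & A_sub & HA).
    apply (code_lt_iff_order Oa HA Hx Hy) in Hlt.
    assert (Ha' : a ∈ Vlevel lam) by (apply ord_in_Vlevel; auto).
    set (v := Vlevel a); assert (Hv : v ∈ Vlevel lam) by exact (Vlevel_in_level Ha' Oa).
    assert (HA' : A ∈ Vlevel lam) by exact (sub_in_level (cart_in_level Hv Hv) A_sub).
    exists (exist _ A HA'), (exist _ v Hv), (exist _ a Ha').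
    rewrite absolute_is_Vlevel, absolute_is_code_order, absolute_gr, is_Vlevel_iff; auto 7.
Qed.
Hint Resolve absolute_code_lt : absolute.
Lemma absolute_next_code_at : absolute3 (@next_code_at _).
Proof. unfold next_code_at, least_code; absoluteness. Qed.
Lemma absolute_decodes : absolute2 (@decodes _).
Proof. unfold decodes; absoluteness; apply absolute_sat; assumption. Qed.

End Absoluteness.

(** * The greedy assignment of codes *)

Lemma uplift_inaccessible d g : uplift mem d g -> inaccessible mem g.
Proof. intros [Hg _]; exact Hg. Qed.
Lemma isolated_uplift_ord d g : isolated_uplift mem d g -> ord mem g.
Proof. intros [Hg _]; exact (inacc_ord (uplift_inaccessible Hg)). Qed.

Definition free_code (f g c : V) : Prop :=
  c ∈ Vlevel g /\ forall g', g' ∈ g -> ~ ⟨g', c⟩ ∈ f.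

Lemma next_code_at_iff f g c :
  next_code_at mem f g c <-> ord mem g /\ least_code mem (free_code f g) c.
Proof.
  assert (E : forall c', (c' ∈ Vlevel g /\ ~ exists g', g' ∈ g /\ gr mem f g' c') <->
    free_code f g c').
  { intros c'; unfold free_code; setoid_rewrite gr_iff; apply and_iff_compat_l.
    split; [intros N g' Hg' Hc; apply N; eauto|intros N (g' & Hg' & Hc); exact (N g' Hg' Hc)]. }
  unfold next_code_at; split.
  - intros (v & Hv & Hc); apply is_Vlevel_iff in Hv; destruct Hv as [Og ->].
    split; [exact Og|exact (proj1 (least_code_congr c E) Hc)].
  - intros [Og Hc]; exists (Vlevel g); split; [apply is_Vlevel_iff; auto|].
    exact (proj2 (least_code_congr c E) Hc).
Qed.
Lemma next_code_in_Vlevel f g c : next_code_at mem f g c -> c ∈ Vlevel g.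
Proof. intros Hc; apply next_code_at_iff in Hc; destruct Hc as (_ & _ & Hc & _); apply Hc. Qed.
Lemma next_code_unique f g c c' : next_code_at mem f g c -> next_code_at mem f g c' -> c = c'.
Proof.
  rewrite !next_code_at_iff; intros [_ Hc] [_ Hc']; exact (least_code_unique Hc Hc').
Qed.
Lemma next_code_congr f f' g c : (forall g' b, g' ∈ g -> (⟨g', b⟩ ∈ f <-> ⟨g', b⟩ ∈ f')) ->
  (next_code_at mem f g c <-> next_code_at mem f' g c).
Proof.
  intros agree; rewrite !next_code_at_iff; apply and_iff_compat_l, least_code_congr.
  intros c'; unfold free_code; apply and_iff_compat_l.
  split; intros N g' Hg' Hc; apply (N g' Hg'), agree; auto.
Qed.

Definition greedy_below (d th f : V) : Prop :=
  forall g c, ⟨g, c⟩ ∈ f <-> g ∈ th /\ isolated_uplift mem d g /\ next_code_at mem f g c.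

Lemma greedy_below_exists d th : ord mem th ->
  exists f, f ⊆ cart th (Vlevel th) /\ greedy_below d th f.
Proof.
  intros Oth.
  destruct (@set_recursion (cart th (Vlevel th)) pr1 (fun f z =>
    exists g c, z = ⟨g, c⟩ /\ isolated_uplift mem d g /\ next_code_at mem f g c))
    as (f & f_sub & step); [definability|definability| |].
  { intros z Hz; apply mem_cart in Hz; destruct Hz as (g & c & Hg & _ & ->).
    rewrite pr1_opair; exact (ord_mem Oth Hg). }
  exists f; split; [exact f_sub|]; intros g c.
  assert (mem_f : g ∈ th -> c ∈ Vlevel th ->
    (⟨g, c⟩ ∈ f <-> isolated_uplift mem d g /\ next_code_at mem f g c)).
  { intros Hg Hc; rewrite step by (apply opair_in_cart; auto).
    rewrite (@next_code_congr f (sep f (fun z => pr1 z ∈ pr1 ⟨g, c⟩))).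
    - split; [|eauto]; intros (g' & c' & E & Hiso); opair_injection; subst; exact Hiso.
    - intros g' b Hg'; rewrite mem_sep, !pr1_opair by definability; tauto. }
  split.
  - intros Hgc; destruct (proj1 (opair_in_cart _ _ _ _) (f_sub _ Hgc)) as [Hg Hc].
    split; [exact Hg|apply mem_f; assumption].
  - intros (Hg & Hiso & Hc); apply mem_f; auto.
    exact (Vlevel_mono Oth Hg (next_code_in_Vlevel Hc)).
Qed.

Lemma greedy_below_agree d th th' f f' : ord mem th -> ord mem th' ->
  greedy_below d th f -> greedy_below d th' f' ->
  forall g c, g ∈ th -> g ∈ th' -> (⟨g, c⟩ ∈ f <-> ⟨g, c⟩ ∈ f').
Proof.
  intros Oth Oth' Hf Hf'.
  assert (by_ind : forall g, ord mem g -> g ∈ th -> g ∈ th' ->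
    forall c, ⟨g, c⟩ ∈ f <-> ⟨g, c⟩ ∈ f').
  { induct_with ord_ind; [definability|].
    intros g Og IH Hg Hg' c; rewrite (Hf g c), (Hf' g c), (@next_code_congr f f'); [tauto|].
    intros h b Hh; apply IH; eauto using ord_mem_trans. }
  intros g c Hg Hg'; exact (by_ind g (ord_mem Oth Hg) Hg Hg' c).
Qed.

Definition assigned (d g c : V) : Prop :=
  isolated_uplift mem d g /\ exists f, greedy_below d g f /\ next_code_at mem f g c.

Lemma assigned_iff_next_code d th f g c : ord mem th -> greedy_below d th f -> ole mem g th ->
  (assigned d g c <-> isolated_uplift mem d g /\ next_code_at mem f g c).
Proof.
  intros Oth Hf Hle; unfold assigned; apply and_iff_compat_l.
  assert (Og : ord mem g) by (destruct Hle; subst; eauto using ord_mem).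
  assert (below : forall f', greedy_below d g f' ->
    (next_code_at mem f' g c <-> next_code_at mem f g c)).
  { intros f' Hf'; apply next_code_congr; intros g' b Hg'.
    apply (greedy_below_agree Og Oth Hf' Hf); eauto using mem_ole_trans. }
  split; [intros (f' & Hf' & Hc); apply (below f' Hf'), Hc|].
  destruct (greedy_below_exists d Og) as (f' & _ & Hf'); intros Hc.
  exists f'; split; [exact Hf'|apply (below f' Hf'), Hc].
Qed.
Lemma greedy_below_assigned d th f g c : ord mem th -> greedy_below d th f ->
  (⟨g, c⟩ ∈ f <-> g ∈ th /\ assigned d g c).
Proof.
  intros Oth Hf; rewrite (Hf g c); apply and_congr; [reflexivity|]; intros Hg.
  symmetry; apply (assigned_iff_next_code _ Oth Hf); left; exact Hg.
Qed.
Lemma assigned_unique d g c c' : assigned d g c -> assigned d g c' -> c = c'.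
Proof.
  intros (Hg & f & Hf & Hc) Hc'; assert (Og := isolated_uplift_ord Hg).
  apply (assigned_iff_next_code _ Og Hf) in Hc'; [|right; reflexivity].
  exact (next_code_unique Hc (proj2 Hc')).
Qed.
Lemma assigned_inj d g g' c : assigned d g c -> assigned d g' c -> g = g'.
Proof.
  assert (not_lt : forall g g', assigned d g c -> assigned d g' c -> ~ g ∈ g').
  { clear g g'; intros g g' Hc (Hg' & f & Hf & Hc') Hlt.
    apply next_code_at_iff in Hc'; destruct Hc' as (Og' & _ & [_ free_c] & _).
    apply (free_c g Hlt), (greedy_below_assigned _ _ Og' Hf); auto. }
  intros Hc Hc'.
  destruct (ord_trichotomy (isolated_uplift_ord (proj1 Hc)) (isolated_uplift_ord (proj1 Hc')))
    as [Hlt|[|Hlt]]; auto; [destruct (not_lt g g')|destruct (not_lt g' g)]; auto.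
Qed.

Lemma assigned_below_free d a c g : is_code mem c -> ord mem a -> c ∈ Vlevel a ->
  (forall g, ~ assigned d g c) -> isolated_uplift mem d g -> a ∈ g ->
  exists b, b ∈ Vlevel a /\ assigned d g b.
Proof.
  intros Cc Oa Hca never Hg Hag; assert (Og := isolated_uplift_ord Hg).
  destruct (greedy_below_exists d Og) as (f & _ & Hf).
  destruct (@least_code_exists (free_code f g) c) as (b & Hb & Hle).
  - unfold free_code; definability.
  - exact Cc.
  - split; [exact (Vlevel_mono Og Hag Hca)|]; intros g' _ Hgc.
    apply (greedy_below_assigned _ _ Og Hf) in Hgc; exact (never g' (proj2 Hgc)).
  - exists b; split.
    + rewrite in_Vlevel_iff_rank in * by exact Oa; exact (ole_mem_trans Oa Hle Hca).
    + split; [exact Hg|]; exists f; split; [exact Hf|apply next_code_at_iff; auto].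
Qed.

Section Unbounded.

Context (d : V).
Context (unbounded : forall th, ord mem th -> exists g, isolated_uplift mem d g /\ th ∈ g).

(* Otherwise every large stage would be assigned a code of rank at most that of
   c, against injectivity. *)
Lemma every_code_assigned c : is_code mem c -> exists g, assigned d g c.
Proof.
  intros Cc; apply NNPP; intros N.
  set (a := succ (rank c)); assert (Oa : ord mem a) by apply ord_succ, ord_rank.
  destruct (@replacement (fun b g => assigned d g b) (Vlevel a)) as [B mem_B].
  { unfold assigned, greedy_below; definability. }
  { intros b g g' _; apply assigned_inj. }
  destruct (@ord_bound (cup B (upair a a))) as (th & Oth & Hth).
  { intros x Hx; rewrite mem_cup, mem_upair in Hx; destruct Hx as [Hx|[-> | ->]]; auto.
    apply mem_B in Hx; destruct Hx as (b & _ & Hx & _); exact (isolated_uplift_ord Hx). }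
  destruct (unbounded Oth) as (g & Hg & Hthg); assert (Og := isolated_uplift_ord Hg).
  assert (Hag : a ∈ g).
  { refine (ord_mem_trans Og _ Hthg); apply Hth, mem_cup; auto using upair_l. }
  destruct (@assigned_below_free d a c g) as (b & Hb & Hgb); eauto using in_Vlevel_succ_rank.
  assert (Hgth : g ∈ th) by (apply Hth, mem_cup; left; apply mem_B; eauto).
  exact (mem_asym Hgth Hthg).
Qed.

Lemma assigned_unbounded r th : ord mem th ->
  (forall eta, ord mem eta -> is_code mem ⟨r, eta⟩) ->
  exists eta g, ord mem eta /\ ole mem th g /\ assigned d g ⟨r, eta⟩.
Proof.
  intros Oth Hr; apply NNPP; intros N.
  destruct (@replacement (fun g c => assigned d g c) th) as [B mem_B].
  { unfold assigned, greedy_below; definability. }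
  { intros g c c' _; apply assigned_unique. }
  destruct (ord_not_in_set (union (union B))) as (eta & Oeta & Neta).
  destruct (every_code_assigned (Hr eta Oeta)) as [g Hg].
  destruct (ord_mem_or_ole (isolated_uplift_ord (proj1 Hg)) Oth) as [Hlt|Hle];
    [|apply N; eauto].
  apply Neta, (@opair_in_union2 r), mem_B; eauto.
Qed.

End Unbounded.

(* The least uplift above th is isolated. *)
Lemma uplifting_unbounded k : uplifting mem k ->
  forall th, ord mem th -> exists g, isolated_uplift mem k g /\ th ∈ g.
Proof.
  intros [inacc_k up_k] th Oth; assert (Ok := inacc_ord inacc_k).
  destruct (up_k (succ th) (ord_succ Oth))
    as (g & vk & vg & inacc_g & Hle & Hvk & Hvg & Hel & Hne).
  assert (Og := inacc_ord inacc_g).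
  assert (Hthg : th ∈ g) by exact (mem_ole_trans Og (mem_succ_self th) Hle).
  assert (Hg : uplift mem k g).
  { split; [exact inacc_g|]; split; [|exists vk, vg; auto].
    apply is_Vlevel_iff in Hvk, Hvg; destruct Hvk as [_ ->], Hvg as [_ ->].
    destruct (ord_trichotomy Ok Og) as [|[-> |Hgk]]; auto; [tauto|].
    destruct (@mem_irrefl (Vlevel g)); apply Hel, Vlevel_in_Vlevel; auto. }
  destruct (@ord_least (fun g => uplift mem k g /\ th ∈ g) g)
    as (g0 & Og0 & _ & [Hg0 Hthg0] & least); [definability|auto..|].
  exists g0; split; [split; [exact Hg0|]|exact Hthg0].
  exists (succ th); split;
      [apply limit_succ; auto; exact (inacc_limit (uplift_inaccessible Hg0))|].
  intros g' Hg' Hup; apply mem_succ.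
  destruct (ord_mem_or_ole Oth (inacc_ord (uplift_inaccessible Hup))) as [Hlt|]; [|assumption].
  destruct (least g'); auto.
Qed.

(** * The Laver function in an inaccessible level *)

Section LaverFunction.

(* Q restricts the values, for instance to the ordinals. *)
Context (Q : forall W, (W -> W -> Prop) -> W -> Prop).

Section Level.

Context (k : V) (inacc_k : inaccessible mem k).
Let ord_k : ord mem k := inacc_ord inacc_k.
Let limit_k : limit mem k := inacc_limit inacc_k.
Let omega_k : omega ∈ k := inacc_omega inacc_k.
Local Notation W := (carrier (Vlevel k)).
Local Notation memW := (@cmem (Vlevel k)).
Local Notation "! x" := (proj1_sig x) (at level 1).
Local Notation lift := (exist (fun x => x ∈ Vlevel k)).

Lemma greedy_level (d f : W) : greedy memW d f <-> greedy_below !d k !f.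
Proof.
  unfold greedy; setoid_rewrite (absolute_gr limit_k).
  setoid_rewrite (absolute_isolated_uplift limit_k omega_k).
  setoid_rewrite (absolute_next_code_at limit_k omega_k); setoid_rewrite gr_iff.
  assert (Hord : forall g, ord mem g -> (g ∈ Vlevel k <-> g ∈ k))
    by (intros g Og; apply ord_in_Vlevel; auto).
  split; intros Hf g c.
  - split.
    + intros Hgc; assert (Hg := dom_in_level limit_k (carrier_in f) Hgc).
      assert (Hc := cod_in_level limit_k (carrier_in f) Hgc).
      apply (Hf (lift g Hg) (lift c Hc)) in Hgc; split; [|exact Hgc].
      apply (Hord g (isolated_uplift_ord (proj1 Hgc))), Hg.
    + intros (Hg & Hiso & Hc).
      assert (Hg' := proj2 (Hord g (isolated_uplift_ord Hiso)) Hg).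
      assert (Hc' := Vlevel_mono ord_k Hg (next_code_in_Vlevel Hc)).
      apply (Hf (lift g Hg') (lift c Hc')); auto.
  - rewrite (Hf !g !c); split; [tauto|]; intros [Hiso Hc]; split; [|auto].
    apply (Hord _ (isolated_uplift_ord Hiso)), carrier_in.
Qed.

Lemma least_code_level (d f c : W) : greedy_below !d k !f ->
  (least_code memW (fun c' => ~ exists g, gr memW f g c') c <-> next_code_at mem !f k !c).
Proof.
  intros Hf.
  assert (Hfree : forall c' : W, ~ (exists g, gr memW f g c') <-> free_code !f k !c').
  { intros c'; setoid_rewrite (absolute_gr limit_k); setoid_rewrite gr_iff; split.
    - intros N; split; [apply carrier_in|]; intros g _ Hgc; apply N.
      exists (lift g (dom_in_level limit_k (carrier_in f) Hgc)); exact Hgc.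
    - intros [_ N] [g Hgc]; apply (N !g); [apply (Hf !g !c'), Hgc|exact Hgc]. }
  rewrite next_code_at_iff; unfold least_code.
  setoid_rewrite Hfree; setoid_rewrite (absolute_is_code limit_k omega_k).
  setoid_rewrite (absolute_code_lt limit_k omega_k); setoid_rewrite carrier_eq.
  split; [|intros (_ & Cc & Hc & least); auto].
  intros (Cc & Hc & least); split; [exact ord_k|]; split; [exact Cc|]; split; [exact Hc|].
  intros c' Cc' Hc'; exact (least (lift c' (proj1 Hc')) Cc' Hc').
Qed.

Lemma guess_level (d x : W) : guess memW (Q memW) d x <-> exists f c,
  f ∈ Vlevel k /\ greedy_below !d k f /\ next_code_at mem f k c /\ decodes mem c !x /\ Q memW x.
Proof.
  unfold guess; split.
  - intros (f & c & Hf & Hc & Hdec & HQ); apply greedy_level in Hf.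
    apply (least_code_level c Hf) in Hc; apply (absolute_decodes limit_k omega_k) in Hdec.
    exists !f, !c; auto using carrier_in.
  - intros (f & c & Hfk & Hf & Hc & Hdec & HQ); assert (Hck := next_code_in_Vlevel Hc).
    exists (lift f Hfk), (lift c Hck).
    rewrite greedy_level, (@least_code_level d) by assumption.
    rewrite (absolute_decodes limit_k omega_k); auto.
Qed.

Lemma guess_unique (d x y : W) :
  guess memW (Q memW) d x -> guess memW (Q memW) d y -> x = y.
Proof.
  rewrite !guess_level; intros (f & c & _ & Hf & Hc & Hx & _) (f' & c' & _ & Hf' & Hc' & Hy & _).
  assert (E : c = c').
  { apply (@next_code_unique f k); [exact Hc|]; revert Hc'; apply next_code_congr.
    intros g b Hg; apply (greedy_below_agree ord_k ord_k Hf Hf'); assumption. }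
  subst c'; apply carrier_eq; exact (decodes_unique Hx Hy).
Qed.

(* The stages below k being bounded in k, the greedy assignment up to k is a
   member of V_k. *)
Lemma guess_of_assigned (d x : W) c :
  assigned !d k c -> decodes mem c !x -> Q memW x -> guess memW (Q memW) d x.
Proof.
  intros Hc Hdec HQ; destruct (greedy_below_exists !d ord_k) as (f & f_sub & Hf).
  apply (assigned_iff_next_code _ ord_k Hf) in Hc; [|right; reflexivity].
  destruct Hc as [[Hup (b & Hb & bounded)] Hc]; assert (Ob := ord_mem ord_k Hb).
  apply guess_level; exists f, c; repeat (split; [|auto]).
  apply (sub_in_level limit_k (x := cart b (Vlevel b))).
  - apply (cart_in_level limit_k); [apply ord_in_Vlevel; auto|].
    exact (Vlevel_in_Vlevel ord_k Hb).
  - intros p Hp; destruct (proj1 (mem_cart _ _ _) (f_sub p Hp)) as (g & c' & _ & _ & ->).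
    destruct (proj1 (Hf g c') Hp) as (Hg & Hiso & Hc'); apply opair_in_cart.
    assert (Hgb : g ∈ b) by exact (bounded g Hg (proj1 Hiso)).
    split; [exact Hgb|exact (Vlevel_mono Ob Hgb (next_code_in_Vlevel Hc'))].
Qed.

Lemma laver_unique (d x y : W) :
  laver memW (Q memW) d x -> laver memW (Q memW) d y -> x = y.
Proof.
  intros [_ [Hx|[N Hx]]] [_ [Hy|[N' Hy]]].
  - exact (guess_unique Hx Hy).
  - destruct N'; eauto.
  - destruct N; eauto.
  - apply (absolute_is_empty limit_k), is_empty_iff in Hx, Hy; apply carrier_eq; congruence.
Qed.
Lemma laver_total (d : W) : ord mem !d -> exists x, laver memW (Q memW) d x.
Proof.
  intros Od; apply (absolute_ord limit_k) in Od.
  destruct (classic (exists x, guess memW (Q memW) d x)) as [[x Hx]|N].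
  - exists x; split; auto.
  - exists (lift empty (Vlevel_empty limit_k)); split; [exact Od|right; split; [exact N|]].
    apply (absolute_is_empty limit_k), is_empty_empty.
Qed.

Definition is_laver_graph (l : V) : Prop := l ⊆ cart (Vlevel k) (Vlevel k) /\
  forall d x, ⟨d, x⟩ ∈ l <-> exists Hd Hx, laver memW (Q memW) (lift d Hd) (lift x Hx).

Lemma laver_graph_ord l d x : is_laver_graph l -> ⟨d, x⟩ ∈ l -> d ∈ k /\ x ∈ Vlevel k.
Proof.
  intros [_ mem_l] Hdx; apply mem_l in Hdx; destruct Hdx as (Hd & Hx & Od & _).
  apply (absolute_ord limit_k) in Od; split; [apply (ord_in_Vlevel ord_k Od), Hd|exact Hx].
Qed.

Lemma laver_graph_fun l : is_laver_graph l -> is_fun mem l k (Vlevel k).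
Proof.
  intros Hl; assert (Hl' := Hl); destruct Hl' as [l_sub mem_l].
  apply is_fun_iff; split; [|split].
  - intros p Hp; destruct (proj1 (mem_cart _ _ _) (l_sub p Hp)) as (d & x & _ & _ & ->).
    exact (proj2 (opair_in_cart _ _ _ _) (laver_graph_ord Hl Hp)).
  - intros d x y Hx Hy; apply mem_l in Hx, Hy.
    destruct Hx as (Hd & Hx & Hlx), Hy as (Hd' & Hy & Hly).
    rewrite (proof_irrelevance _ Hd' Hd) in Hly.
    exact (proj1 (carrier_eq _ _) (laver_unique Hlx Hly)).
  - intros d Hd; assert (Od := ord_mem ord_k Hd).
    assert (Hd' : d ∈ Vlevel k) by (apply ord_in_Vlevel; auto).
    destruct (@laver_total (lift d Hd') Od) as [[x Hx] Hlx]; exists x; apply mem_l; eauto.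
Qed.

Lemma decodes_in_Vlevel c x : c ∈ Vlevel k -> decodes mem c x -> x ∈ Vlevel k.
Proof.
  intros Hc Hdec; apply decodes_iff in Hdec.
  destruct Hdec as (a & p & s & eta & -> & Oa & Hx & _).
  apply (Vlevel_opair_inv limit_k), proj1, (Vlevel_opair_inv limit_k), proj1 in Hc.
  apply (ord_in_Vlevel ord_k Oa) in Hc; exact (Vlevel_mono ord_k Hc Hx).
Qed.

Context (absolute_Q : forall x : W, Q memW x <-> Q mem !x).

Lemma laver_graph_value l d x : is_laver_graph l -> ⟨d, x⟩ ∈ l -> Q mem x \/ x = empty.
Proof.
  intros [_ mem_l] Hdx; apply mem_l in Hdx.
  destruct Hdx as (Hd & Hx & _ & [(f & c & _ & _ & _ & HQ)|[_ Hempty]]).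
  - left; apply absolute_Q in HQ; exact HQ.
  - right; apply (absolute_is_empty limit_k), is_empty_iff in Hempty; exact Hempty.
Qed.

Lemma laver_graph_assigned l d c x : is_laver_graph l ->
  assigned d k c -> decodes mem c x -> Q mem x -> ⟨d, x⟩ ∈ l.
Proof.
  intros [_ mem_l] Hc Hdec HQ; assert (Hd := proj1 (proj2 (proj1 (proj1 Hc)))).
  assert (Od := ord_mem ord_k Hd).
  assert (Hck : c ∈ Vlevel k)
    by (destruct Hc as (_ & f & _ & Hc); exact (next_code_in_Vlevel Hc)).
  assert (Hd' : d ∈ Vlevel k) by (apply ord_in_Vlevel; auto).
  apply mem_l; exists Hd', (decodes_in_Vlevel Hck Hdec).
  split; [apply (absolute_ord limit_k), Od|left].
  apply (@guess_of_assigned _ _ c); [exact Hc|exact Hdec|apply absolute_Q, HQ].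
Qed.

End Level.

Context (definable_Q : definable1 (@Q _)).
Context (absolute_Q : forall k, inaccessible mem k -> forall x : carrier (Vlevel k),
  Q (@cmem (Vlevel k)) x <-> Q mem (proj1_sig x)).

Lemma laver_graph_exists : exists P, is_fml mem None P /\
  forall k, exists l, defines (Vlevel k) l P /\ is_laver_graph k l.
Proof.
  destruct (uniform_formula (definable_laver definable_Q
    (definable_term_var 0) (definable_term_var 1))) as [p Hp].
  exists (quote p); split; [apply fml_quote|]; intros k.
  apply (@defined_relation_exists (Vlevel k) p (laver (@cmem (Vlevel k)) (Q (@cmem (Vlevel k))))).
  exact (Hp (Structure (@cmem (Vlevel k)))).
Qed.

Lemma laver_for_exists (P : V -> Prop) (cod : V -> V -> Prop) :
  (forall x, P x -> OD mem x /\ Q mem x) ->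
  (forall g l, inaccessible mem g -> is_fun mem l g (Vlevel g) ->
     (forall d x, ⟨d, x⟩ ∈ l -> Q mem x \/ x = empty) -> exists c, cod c g /\ is_fun mem l g c) ->
  forall k, uplifting mem k -> exists h c l, is_H mem h k /\ cod c k /\ is_fun mem l k c /\
    laver_for mem P cod k l /\ definable_in mem h l.
Proof.
  intros P_OD Hcod k Uk; assert (inacc_k := proj1 Uk).
  destruct laver_graph_exists as (p & fml_p & Hgraph).
  assert (graph_cod : forall g l, inaccessible mem g -> is_laver_graph g l ->
    exists c, cod c g /\ is_fun mem l g c).
  { intros g l inacc_g Hl; apply Hcod; [exact inacc_g|exact (laver_graph_fun inacc_g Hl)|].
    intros d x; exact (laver_graph_value inacc_g (absolute_Q inacc_g) Hl). }
  destruct (Hgraph k) as (l & Hdef & Hl), (graph_cod k l inacc_k Hl) as (c & Hc & fun_l).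
  exists (Vlevel k), c, l; split; [apply (is_H_iff inacc_k); reflexivity|].
  do 2 (split; [assumption|]); split; [|exact (definable_in_of_defines fml_p Hdef)].
  exists (Vlevel k), c; split; [apply (is_H_iff inacc_k); reflexivity|].
  split; [exact Hc|]; split; [apply fun_l|].
  intros x Px th Oth; destruct (P_OD x Px) as [OD_x Qx].
  destruct (OD_decodes OD_x) as [r Hr].
  destruct (@assigned_unbounded k (uplifting_unbounded Uk) r th Oth)
    as (eta & g & Oeta & Hle & Hg);
    [intros eta Oeta; apply (Hr eta Oeta)|].
  assert (Hup := proj1 (proj1 Hg)); assert (inacc_g := uplift_inaccessible Hup).
  destruct (Hgraph g) as (l' & Hdef' & Hl'), (graph_cod g l' inacc_g Hl') as (c' & Hc' & fun_l').
  exists g, (Vlevel g), c', l'; do 2 (split; [assumption|]).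
  split; [apply (is_H_iff inacc_g); reflexivity|]; split; [exact Hc'|]; split; [apply fun_l'|].
  split.
  - apply (elem_sub_expand fml_p Hdef Hdef'); destruct Hup as (_ & _ & vk & vg & Hvk & Hvg & Hel).
    apply is_Vlevel_iff in Hvk, Hvg; destruct Hvk as [_ ->], Hvg as [_ ->]; exact Hel.
  - apply gr_iff; apply (laver_graph_assigned inacc_g (absolute_Q inacc_g) Hl' Hg);
      [apply (Hr eta Oeta)|exact Qx].
Qed.

End LaverFunction.

Lemma ord_laver_exists k : uplifting mem k -> exists h l, is_H mem h k /\ is_fun mem l k k /\
  ord_anticipating_laver mem k l /\ definable_in mem h l.
Proof.
  intros Uk.
  destruct (@laver_for_exists (@ord)) with (P := ord mem) (cod := fun c k : V => c = k) (k := k)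
    as (h & c & l & Hh & -> & Hl); [definability| | | |exact Uk|exists h, l; auto].
  - intros g inacc_g; apply absolute_ord, inacc_limit, inacc_g.
  - intros x Ox; split; [exact (ord_OD Ox)|exact Ox].
  - intros g l inacc_g fun_l values; exists g; split; [reflexivity|].
    assert (Og := inacc_ord inacc_g); apply is_fun_iff in fun_l; apply is_fun_iff.
    destruct fun_l as [l_sub Hl]; split; [|exact Hl]; intros p Hp.
    destruct (proj1 (mem_cart _ _ _) (l_sub p Hp)) as (d & x & Hd & Hx & ->).
    apply opair_in_cart; split; [exact Hd|]; apply (ord_in_Vlevel Og); [|exact Hx].
    destruct (values d x Hp) as [Ox| ->]; auto using ord_empty.
Qed.

Lemma OD_laver_exists (P : V -> Prop) k : (forall x, P x -> OD mem x) -> uplifting mem k ->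
  exists h l, is_H mem h k /\ is_fun mem l k h /\
    laver_for mem P (is_H mem) k l /\ definable_in mem h l.
Proof.
  intros P_OD Uk.
  destruct (@laver_for_exists (fun _ _ _ => True)) with (P := P) (cod := is_H mem) (k := k)
    as (h & c & l & Hh & Hc & Hl); [definability|tauto|auto| |exact Uk|].
  - intros g l inacc_g fun_l _; exists (Vlevel g); rewrite (is_H_iff inacc_g); auto.
  - assert (H_unique := is_H_iff (proj1 Uk)); apply H_unique in Hc; subst c.
    apply H_unique in Hh; subst h; exists (Vlevel k), l.
    split; [apply H_unique; reflexivity|exact Hl].
Qed.

End SetTheory.

Theorem theorem4p5 (V : Type) (mem : V -> V -> Prop) (hZFC : ZFC mem) :
  (forall k : V, uplifting mem k ->
     exists h l : V, is_H mem h k /\ is_fun mem l k k /\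
       ord_anticipating_laver mem k l /\ definable_in mem h l) /\
  (forall k : V, uplifting mem k ->
     exists h l : V, is_H mem h k /\ is_fun mem l k h /\
       HOD_anticipating_laver mem k l /\ definable_in mem h l) /\
  ((forall x : V, HOD mem x) ->
   forall k : V, uplifting mem k ->
     exists h l : V, is_H mem h k /\ is_fun mem l k h /\
       uplifting_laver mem k l /\ definable_in mem h l).
Proof.
  split; [exact (ord_laver_exists hZFC)|split].
  - intros k Uk; exact (OD_laver_exists hZFC (HOD_OD hZFC) Uk).
  - intros V_eq_HOD k Uk; apply (OD_laver_exists hZFC); [|exact Uk].
    intros x _; apply (HOD_OD hZFC), V_eq_HOD.
Qed.
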